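(* Let $1\le d\le n$ be integers, let $X_1,\ldots,X_n$ be independent random vectors with the standard normal distribution on $\mathbb{R}^d$, and set $\mathcal P_{n,d}^{(0)}=\mathrm{conv}[0,X_1,\ldots,X_n]$. Then $$\mathbb E\,\mathrm{Vol}_d(\mathcal P_{n,d}^{(0)})=\frac{\binom nd}{2^{\,n-\frac d2}\,\Gamma(\frac d2+1)}+\frac{\kappa_d\,n!}{d!\,(n-d-1)!}\int_0^{\infty}\Phi^{n-d-1}(t)\,\varphi^{d+1}(t)\,\mathrm dt,$$ where for $d=n$ the second summand is interpreted as $0$ (convention $1/(-1)!=0$).
   Context: $\mathrm{conv}$ denotes the convex hull and $\mathrm{Vol}_d$ is $d$-dimensional Lebesgue measure. $\kappa_d=\pi^{d/2}/\Gamma(\frac d2+1)$ is the volume of the $d$-dimensional unit ball. $\varphi(t)=\frac{1}{\sqrt{2\pi}}e^{-t^2/2}$ and $\Phi(t)=\int_{-\infty}^t\varphi(s)\,\mathrm ds$ are the standard normal density and distribution function. *)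

(* Defs.v *)
From HB Require Import structures.
From mathcomp Require Import all_boot all_order all_algebra.
From mathcomp Require Import all_classical all_reals all_analysis.

Set Implicit Arguments.
Unset Strict Implicit.
Unset Printing Implicit Defensive.

Import Order.TTheory GRing.Theory Num.Theory.
Import numFieldNormedType.Exports.

Local Open Scope classical_set_scope.
Local Open Scope ring_scope.

(* 'rV[T]_n carries the product sigma-algebra, i.e. the one generated by the
   coordinate maps, exactly as n.-tuple T does in the library; for T := R this
   is the Borel sigma-algebra of R^n. *)
Section measurable_rV.
Context {d} {T : measurableType d}.
Variable n : nat.

Let coors : 'I_n -> 'rV[T]_n -> T := fun i v => v ord0 i.

Let rV_set0 : g_sigma_preimage coors set0.
Proof. exact: sigma_algebra0. Qed.

Let rV_setC A : g_sigma_preimage coors A -> g_sigma_preimage coors (~` A).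
Proof. exact: sigma_algebraC. Qed.

Let rV_bigcup (F : _^nat) : (forall i, g_sigma_preimage coors (F i)) ->
  g_sigma_preimage coors (\bigcup_i (F i)).
Proof. exact: sigma_algebra_bigcup. Qed.

HB.instance Definition _ := @isMeasurable.Build (measure_tuple_display d)
  'rV[T]_n (g_sigma_preimage coors) rV_set0 rV_setC rV_bigcup.

End measurable_rV.

Lemma measurable_coord d (T : measurableType d) n (i : 'I_n) :
  measurable_fun [set: 'rV[T]_n] (fun v => v ord0 i).
Proof.
move=> _ Y mY; rewrite setTI; apply: sub_sigma_algebra => /=.
rewrite -bigcup_seq/=; exists i => /=; first by rewrite mem_index_enum.
by exists Y => //; rewrite setTI.
Qed.

Lemma measurable_fun_rVP d1 d2 (T1 : measurableType d1)
    (T2 : measurableType d2) n (f : T1 -> 'rV[T2]_n) :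
  measurable_fun [set: T1] f <->
  forall i, measurable_fun [set: T1] (fun x => f x ord0 i).
Proof.
split=> [mf i|mf].
  by apply: (measurableT_comp (measurable_coord i)).
apply: (@measurability _ _ _ _ setT f
  (\big[setU/set0]_(i < n)
    preimage_set_system setT (fun v : 'rV[T2]_n => v ord0 i) measurable)) => //.
move=> _ [B + <-]; rewrite -bigcup_seq /= => -[i _ [C mC <-]].
by rewrite !setTI -[X in measurable X]setTI; exact: (mf i).
Qed.

Section lebesgue_rV.
Context {R : realType}.
Local Open Scope ereal_scope.

Definition cons_rV n (p : R * 'rV[R]_n) : 'rV[R]_n.+1 :=
  row_mx (p.1)%:M p.2.

Definition uncons_rV n (v : 'rV[R]_n.+1) : R * 'rV[R]_n :=
  (v ord0 ord0, \row_i v ord0 (lift ord0 i)).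

Lemma cons_rV0 n (p : R * 'rV[R]_n) : cons_rV p ord0 ord0 = p.1.
Proof.
have <- : lshift n (ord0 : 'I_1) = ord0 :> 'I_n.+1 by exact/val_inj.
by rewrite /cons_rV (@row_mxEl _ 1 1 n) mxE eqxx.
Qed.

Lemma cons_rVS n (p : R * 'rV[R]_n) (i : 'I_n) :
  cons_rV p ord0 (lift ord0 i) = p.2 ord0 i.
Proof.
have <- : rshift 1 i = lift ord0 i :> 'I_n.+1 by exact/val_inj.
by rewrite /cons_rV (@row_mxEr _ 1 1 n).
Qed.

Lemma cons_rVK n : cancel (@cons_rV n) (@uncons_rV n).
Proof.
move=> p; rewrite /uncons_rV cons_rV0 [RHS]surjective_pairing; congr (_, _).
by apply/rowP => i; rewrite mxE cons_rVS.
Qed.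

Lemma measurable_cons_rV n : measurable_fun [set: R * 'rV[R]_n] (@cons_rV n).
Proof.
apply/measurable_fun_rVP => i; have [j ->|->] := unliftP ord0 i.
  under eq_fun do rewrite cons_rVS.
  exact: (measurableT_comp (measurable_coord j)).
by under eq_fun do rewrite cons_rV0; exact: measurable_fst.
Qed.

Lemma measurable_uncons_rV n : measurable_fun [set: 'rV[R]_n.+1] (@uncons_rV n).
Proof.
apply/measurable_fun_pairP; split; first exact: measurable_coord.
apply/measurable_fun_rVP => i.
rewrite (_ : (fun _ => _) = fun v : 'rV[R]_n.+1 => v ord0 (lift ord0 i)).
  exact: measurable_coord.
by apply/funext => v; rewrite /= mxE.
Qed.

Definition lebesgue_cons n (m : {sigma_finite_measure set 'rV[R]_n -> \bar R})
  : set 'rV[R]_n.+1 -> \bar R :=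
  pushforward (lebesgue_measure \x m) (@cons_rV n).

Section lebesgue_cons_measure.
Variables (n : nat) (m : {sigma_finite_measure set 'rV[R]_n -> \bar R}).

Let mcons A : measurable A -> measurable (@cons_rV n @^-1` A).
Proof.
by move=> mA; rewrite -[X in measurable X]setTI; exact: measurable_cons_rV.
Qed.

Let lebesgue_cons0 : lebesgue_cons m set0 = 0.
Proof. by rewrite /lebesgue_cons /pushforward preimage_set0 measure0. Qed.

Let lebesgue_cons_ge0 A : 0 <= lebesgue_cons m A.
Proof. exact: (measure_ge0 (lebesgue_measure \x m)). Qed.

Let lebesgue_cons_sigma_additive : semi_sigma_additive (lebesgue_cons m).
Proof.
move=> F mF tF mUF; rewrite /lebesgue_cons /pushforward preimage_bigcup.
apply: measure_semi_sigma_additive.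
- by move=> k; exact: mcons.
- apply/trivIsetP => /= i j _ _ ij; rewrite -preimage_setI.
  by move/trivIsetP : tF => /(_ _ _ _ _ ij) ->//; rewrite preimage_set0.
- by rewrite -preimage_bigcup; exact: mcons.
Qed.

HB.instance Definition _ := isMeasure.Build _ _ _ (lebesgue_cons m)
  lebesgue_cons0 lebesgue_cons_ge0 lebesgue_cons_sigma_additive.

Let lebesgue_cons_sigma_finite : sigma_finite setT (lebesgue_cons m).
Proof.
have /sigma_finiteP[F [TF ndF Foo]] := sigma_finiteT (@lebesgue_measure R).
have /sigma_finiteP[G [TG ndG Goo]] := sigma_finiteT m.
exists (fun k => @uncons_rV n @^-1` (F k `*` G k)).
  rewrite -preimage_bigcup; apply/seteqP; split=> // v _.
  have [i _ Fi] : (\bigcup_i F i) (uncons_rV v).1 by rewrite -TF.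
  have [j _ Gj] : (\bigcup_i G i) (uncons_rV v).2 by rewrite -TG.
  exists (maxn i j) => //; split.
    by move: Fi; exact/subsetPset/ndF/leq_maxl.
  by move: Gj; exact/subsetPset/ndG/leq_maxr.
move=> k; have [mF Fk] := Foo k; have [mG Gk] := Goo k; split.
  rewrite -[X in measurable X]setTI; apply: measurable_uncons_rV => //.
  exact: measurableX.
rewrite /lebesgue_cons /pushforward -comp_preimage (_ : _ \o _ = id).
  by rewrite preimage_id product_measure1E// lte_mul_pinfty// ge0_fin_numE.
by apply/funext => p; exact: cons_rVK.
Qed.

HB.instance Definition _ := Measure_isSigmaFinite.Build _ _ _ (lebesgue_cons m)
  lebesgue_cons_sigma_finite.

End lebesgue_cons_measure.

(* n-dimensional Lebesgue measure, as the n-fold product of the 1-dimensional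
   one; on R^0 it is the unit mass. *)
Fixpoint lebesgue_rV n : {sigma_finite_measure set 'rV[R]_n -> \bar R} :=
  match n with
  | 0 => \d_(0%R : 'rV[R]_0)
  | n'.+1 => lebesgue_cons (lebesgue_rV n')
  end.

Lemma lebesgue_rV_box n (B : 'I_n -> set R) :
  (forall i, measurable (B i)) ->
  lebesgue_rV n [set v | forall i, B i (v ord0 i)] =
  \prod_(i < n) lebesgue_measure (B i).
Proof.
elim: n B => [|n IH] B mB.
  rewrite big_ord0 /= /dirac indicE.
  by rewrite mem_set// => -[].
rewrite big_ord_recl -IH; last by move=> i; exact: mB.
rewrite /= -product_measure1E//.
  congr (product_measure1 _ _ _); apply/seteqP; split=> [p /= Bp|p [/= B0 BS] i].
    split; first by have := Bp ord0; rewrite cons_rV0.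
    by move=> i; have := Bp (lift ord0 i); rewrite cons_rVS.
  by have [j ->|->] := unliftP ord0 i; [rewrite cons_rVS|rewrite cons_rV0].
  exact: mB.
have -> : (fun v : 'rV[R]_n => forall i, B (lift ord0 i) (v ord0 i)) =
    \bigcap_i ((fun v : 'rV[R]_n => v ord0 i) @^-1` B (lift ord0 i)).
  by apply/seteqP; split=> v /= Bv i; [move=> _|]; exact: Bv.
apply: fin_bigcap_measurable => [|i _]; first exact: finite_finset.
by rewrite -[X in measurable X]setTI; apply: measurable_coord => //; exact: mB.
Qed.

End lebesgue_rV.

Arguments lebesgue_rV {R} n.

Definition convex_hull (R : numDomainType) (E : lmodType R) (A : set E)
  : set E := smallest (@convex_set R E) A.

Section special_functions.
Context {R : realType}.
Implicit Types s t : R.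

(* Euler integral of the second kind; it converges, and is the Gamma function,
   for 0 < s only. *)
Definition Gamma s : R :=
  \int[lebesgue_measure]_(x in `]0, +oo[) (x `^ (s - 1) * expR (- x)).

Definition unit_ball_vol (d : nat) : R :=
  pi `^ (d%:R / 2) / Gamma (d%:R / 2 + 1).

Definition phi t : R := normal_pdf 0 1 t.

Definition Phi t : R := \int[lebesgue_measure]_(s in `]-oo, t]) phi s.

Definition std_normal_density n (v : 'rV[R]_n) : R :=
  (2 * pi) `^ (- (n%:R / 2)) * expR (- (\sum_(i < n) v ord0 i ^+ 2) / 2).

End special_functions.

Section random_vectors.
Local Open Scope ereal_scope.
Context d (T : measurableType d) (R : realType) (P : probability T R).

Definition mutually_independent d' (T' : measurableType d') (I : finType)
    (X : I -> {RV P >-> T'}) :=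
  forall (J : {set I}) (B : I -> set T'), (forall i, measurable (B i)) ->
    P (\bigcap_(i in [set` J]) (X i @^-1` B i)) =
    \prod_(i in J) P (X i @^-1` B i).

Definition std_normal_vector n (X : {RV P >-> 'rV[R]_n}) :=
  forall A : set 'rV[R]_n, measurable A ->
    distribution P X A = \int[lebesgue_rV n]_(v in A) (std_normal_density v)%:E.

End random_vectors.

(* Main.v *)
Require Import Defs.
From HB Require Import structures.
From mathcomp Require Import all_boot all_order all_algebra.
From mathcomp Require Import all_classical all_reals all_analysis.
From mathcomp Require Import measurable_realfun ring lra.

Set Implicit Arguments.
Unset Strict Implicit.
Unset Printing Implicit Defensive.

Import Order.TTheory GRing.Theory Num.Theory.
Import numFieldNormedType.Exports.

Local Open Scope classical_set_scope.
Local Open Scope ring_scope.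

(* Almost surely every d of the points X_i form an invertible matrix A, and then
   a_A = A^{-1} (1, ..., 1)^T is the normal for which their facet lies in
   <a_A, x> = 1.  For almost every v, consider the linear program minimising the
   sum of the c_i >= 0 subject to v = sum c_i X_i: its optimal basis is unique,
   so the hull is, up to a null set, the disjoint union of the simplices
   conv[0, A] over those d-subsets A whose facet has all other points on its
   origin side, <a_A, X_j> < 1.  By independence each A contributes
   E (|det A| Phi(1 / |a_A|)^(n - d)) / d!.

   A reflection sending (1, ..., 1) to a multiple of the first axis turns
   1 / |a_A| into |det A| / (vol B sqrt d), where B consists of the last d - 1
   rows and vol B is the length of its cross product; since
   |det A| / vol B is the modulus of a standard normal variable independent of
   B, the expectation factors.  What is left is a one-dimensional integral,
   which an integration by parts brings to the stated form, and E (vol B), which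
   is obtained from E |det A|; the latter follows from
   int |det A| G(l A) dl = 1 by averaging over A first. *)

(** * Linear changes of variables *)

(** Polar coordinates are avoided: the tools are Tonelli, linear substitutions and reflections, and
    radial integrals appear as the half-line moments [mom p] of exp (- t ^ 2 / 2). Averaging |det A|
    G(l A) over A gives E |det A| times a constant multiple of (1 + |l| ^ 2) ^ (- (d + 1) / 2). This
    power is itself written as a moment in an extra variable t, after which l can be integrated
    first; the outcome is E (vol B) = mom d. Gamma enters only through Gamma (d / 2 + 1) = 2 ^ (- d
    / 2) mom (d + 1), and mom d * mom (d + 1) = d! mom 0 reconciles the constants. In the
    integration by parts, d t phi ^ d is minus the derivative of phi ^ d. The boundary term at 0,
    Phi(0) ^ (n - d) phi(0) ^ d, becomes the first summand of the formula, and the remaining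
    integral becomes the second. The volume of the hull is not shown to be measurable in the sample.
    It agrees almost surely with a measurable finite sum, and that determines its integral. *)

Section push_measure.
Context d1 d2 (T1 : measurableType d1) (T2 : measurableType d2) (R : realType).
Variables (m : {measure set T1 -> \bar R}) (f : T1 -> T2).
Hypothesis mf : measurable_fun setT f.

(** Stated as an existence so that later arguments handle an opaque measure, known only through its
    values and its integrals. *)
Lemma pushforward_exists : exists m' : {measure set T2 -> \bar R},
  (forall A, m' A = m (f @^-1` A)) /\
  (forall F : T2 -> \bar R, measurable_fun setT F -> (forall x, 0 <= F x)%E ->
    (\int[m']_x F x = \int[m]_x F (f x))%E).
Proof.
unshelve eexists (pushforward m f : {measure set T2 -> \bar R}) => //.
split=> // F mF F0; exact: (ge0_integral_pushforward mf m measurableT mF).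
Qed.

End push_measure.

Section lebesgue_line.
Context {R : realType}.
Local Notation mu := (@lebesgue_measure R).

Lemma measurable_affine (a b : R) : measurable_fun setT (fun x : R => a * x + b).
Proof. by apply: measurable_funD => //; exact: measurable_funM. Qed.

Lemma ge0_integral_opp (f : R -> \bar R) :
  measurable_fun setT f -> (forall x, 0 <= f x)%E ->
  (\int[mu]_x f (- x)%R = \int[mu]_x f x)%E.
Proof.
move=> mf f0.
have [m [mE mI]] := @pushforward_exists _ _ (measurableTypeR R) (measurableTypeR R) _ mu _ (@oppr_measurable R setT).
rewrite -mI//; apply: eq_measure_integral => A mA _.
by rewrite mE; exact: lebesgue_measureN.
Qed.

Lemma ge0_integral_affine (a b : R) (f : R -> \bar R) : a != 0 ->
  measurable_fun setT f -> (forall x, 0 <= f x)%E ->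
  (`|a|%:E * \int[mu]_x f (a * x + b)%R = \int[mu]_x f x)%E.
Proof.
have H (c : R) : 0 < c -> measurable_fun setT f -> (forall x, 0 <= f x)%E ->
  (c%:E * \int[mu]_x f (c * x + b)%R = \int[mu]_x f x)%E.
  move=> c0 mf f0.
  have [m [mE mI]] := @pushforward_exists _ _ (measurableTypeR R) (measurableTypeR R) _ mu _ (measurable_affine c b).
  (* The image of [mu] under x -> c x + b, multiplied by c, gives every interval []u, v]] its
     length, so it is [mu]. A negative slope is reduced to this case by x -> - x. *)
  pose m' := mscale (NngNum (ltW c0)) m.
  transitivity (\int[m']_x f x)%E.
    by rewrite ge0_integral_mscale// mI.
  apply: eq_measure_integral => A mA _; apply/esym.
  apply: lebesgue_measure_unique => //= _ [[u v]] _ <-.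
  rewrite /m' /mscale /= mE.
  rewrite (_ : _ @^-1` _ = `](u - b) / c, (v - b) / c]%classic); last first.
    by apply/seteqP; split=> x /=; rewrite !in_itv /= ltr_pdivrMr // ler_pdivlMr // ltrBlDr lerBrDr mulrC.
  rewrite lebesgue_measure_itv; apply/esym.
  apply: (eq_trans (congr1 (fun z => c%:E * z)%E
    (lebesgue_measure_itv `](u - b) / c, (v - b) / c]))).
  rewrite /= !lte_fin ltr_pM2r ?invr_gt0// ltrD2r.
  case: ifPn => _; last by rewrite mule0.
  by rewrite -!EFinD -EFinM; congr (_%:E); field; rewrite gt_eqF.
move=> a0 mf f0; have [a_lt0|a_gt0|a_eq0] := ltgtP a 0.
- rewrite ltr0_norm// -[RHS](H (- a))//; last by rewrite oppr_gt0.
  congr (_ * _)%E.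
  rewrite -[LHS]ge0_integral_opp//.
    by apply: eq_integral => x _; rewrite mulrN mulNr.
  by apply: (measurableT_comp mf); exact: measurable_affine.
- by rewrite gtr0_norm// H.
- by rewrite a_eq0 eqxx in a0.
Qed.

End lebesgue_line.

Section lebesgue_rV_theory.
Context {R : realType}.
Local Notation mu := (@lebesgue_measure R).

Lemma ge0_integral_rV0 (F : 'rV[R]_0 -> \bar R) : (forall x, 0 <= F x)%E ->
  (\int[lebesgue_rV 0]_x F x = F 0%R)%E.
Proof.
move=> F0; rewrite /= integral_dirac//; last first.
  apply: (@eq_measurable_fun _ _ _ _ _ (cst (F 0))) => //.
  by move=> x _; rewrite /cst (thinmx0 x).
by rewrite diracT mul1e.
Qed.

Lemma measurable_fun_cons n (F : 'rV[R]_n.+1 -> \bar R) : measurable_fun setT F ->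
  measurable_fun setT (fun p : R * 'rV[R]_n => F (cons_rV p)).
Proof. by move=> mF; apply: measurableT_comp => //; exact: measurable_cons_rV. Qed.

Lemma ge0_integral_rVS n (F : 'rV[R]_n.+1 -> \bar R) :
  measurable_fun setT F -> (forall x, 0 <= F x)%E ->
  (\int[lebesgue_rV n.+1]_x F x = \int[mu]_t \int[lebesgue_rV n]_y F (cons_rV (t, y)))%E.
Proof.
move=> mF F0.
transitivity (\int[mu \x lebesgue_rV n]_p F (cons_rV p))%E.
  rewrite /= /lebesgue_cons ge0_integral_pushforward//.
  exact: measurable_cons_rV.
by rewrite fubini_tonelli1//; exact: measurable_fun_cons.
Qed.

Lemma ge0_integral_rVSr n (F : 'rV[R]_n.+1 -> \bar R) :
  measurable_fun setT F -> (forall x, 0 <= F x)%E ->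
  (\int[lebesgue_rV n.+1]_x F x = \int[lebesgue_rV n]_y \int[mu]_t F (cons_rV (t, y)))%E.
Proof.
move=> mF F0; rewrite ge0_integral_rVS//.
exact: (@fubini_tonelli _ _ _ _ R mu (lebesgue_rV n) (fun p => F (cons_rV p)) (measurable_fun_cons mF)).
Qed.

Lemma measurable_fun_mx_sum d (T : measurableType d) (n p : nat) (f : T -> 'rV[R]_n) (M : 'M[R]_(n, p)) :
  measurable_fun setT f -> measurable_fun setT (fun x => f x *m M).
Proof.
move=> /measurable_fun_rVP mf; apply/measurable_fun_rVP => j.
under eq_fun do rewrite mxE.
by apply: measurable_sum => i; apply: measurable_funM => //; exact: mf.
Qed.

Lemma measurable_fun_addmx d (T : measurableType d) (n : nat) (f g : T -> 'rV[R]_n) :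
  measurable_fun setT f -> measurable_fun setT g -> measurable_fun setT (fun x => f x + g x).
Proof.
move=> /measurable_fun_rVP mf /measurable_fun_rVP mg; apply/measurable_fun_rVP => j.
under eq_fun do rewrite mxE.
by apply: measurable_funD; [exact: mf|exact: mg].
Qed.

Lemma uncons_rVK n : cancel (@uncons_rV R n) (@cons_rV R n).
Proof.
move=> v; apply/rowP => i; have [j ->|->] := unliftP ord0 i.
  by rewrite cons_rVS mxE.
by rewrite cons_rV0.
Qed.

Lemma cons_rVD n (s t : R) (y z : 'rV[R]_n) :
  cons_rV (s, y) + cons_rV (t, z) = cons_rV (s + t, y + z).
Proof. by rewrite /cons_rV (@add_row_mx _ 1 1 n) raddfD. Qed.

Lemma measurable_integral_cons n (F : 'rV[R]_n.+1 -> \bar R) :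
  measurable_fun setT F -> (forall x, 0 <= F x)%E ->
  measurable_fun setT (fun t => \int[lebesgue_rV n]_y F (cons_rV (t, y)))%E.
Proof.
move=> mF F0.
exact: (@measurable_fun_fubini_tonelli_F _ _ _ _ R (lebesgue_rV n) _
  (measurable_fun_cons mF) (fun p => F0 _)).
Qed.

Lemma ge0_integral_rV_translate n (u : 'rV[R]_n) (F : 'rV[R]_n -> \bar R) :
  measurable_fun setT F -> (forall x, 0 <= F x)%E ->
  (\int[lebesgue_rV n]_x F (x + u)%R = \int[lebesgue_rV n]_x F x)%E.
Proof.
elim: n u F => [|n IH] u F mF F0.
  by apply: eq_integral => x _; rewrite (thinmx0 u) addr0.
have mFu : measurable_fun setT (fun x : 'rV[R]_n.+1 => F (x + u)).
  by apply: (measurableT_comp mF); exact: measurable_fun_addmx.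
rewrite ge0_integral_rVS//.
rewrite (ge0_integral_rVS mF F0).
rewrite -(uncons_rVK u) /uncons_rV.
set a := u ord0 ord0; set w := \row_i _.
have mFt t : measurable_fun setT (fun y => F (cons_rV (t, y))).
  exact: (measurableT_comp (measurable_fun_cons mF) (measurable_pair1 t)).
pose G (t : R) := (\int[lebesgue_rV n]_y F (cons_rV (t, y)))%E.
have mG : measurable_fun setT G by exact: measurable_integral_cons.
transitivity (\int[mu]_t G (1 * t + a)%R)%E.
  apply: eq_integral => t _; apply: (eq_trans _ (IH w (fun y => F (cons_rV ((1 * t + a)%R, y))) _ _)) => //.
 by apply: eq_integral => y _; rewrite [in RHS]mul1r cons_rVD.
rewrite -[RHS](@ge0_integral_affine R 1 a G (oner_neq0 _))//.
  by rewrite normr1 mul1e.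
by move=> t; exact: integral_ge0.
Qed.

(** The Jacobian stands on the left, so no division occurs and the property passes to products.
    Matrices act on row vectors from the right. *)
Definition lin_cov n (M : 'M[R]_n) := forall F : 'rV[R]_n -> \bar R,
  measurable_fun setT F -> (forall x, 0 <= F x)%E ->
  (`|\det M|%:E * \int[lebesgue_rV n]_x F (x *m M) = \int[lebesgue_rV n]_x F x)%E.

Lemma lin_covM n (M N : 'M[R]_n) : lin_cov M -> lin_cov N -> lin_cov (M *m N).
Proof.
move=> hM hN F mF F0; rewrite det_mulmx normrM -(hN F)// -(hM (fun x : 'rV[R]_n => F (x *m N)))//.
  rewrite muleA -EFinM [(`|\det N| * _)%R]mulrC; congr (_ * _)%E.
  by apply: eq_integral => x _; rewrite mulmxA.
by apply: (measurableT_comp mF); exact: measurable_fun_mx_sum.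
Qed.

Lemma cons_rV_mul_block n (a : R) (r : 'rV[R]_n) (c : 'cV[R]_n) (M : 'M[R]_n) (t : R) (y : 'rV[R]_n) :
  cons_rV (t, y) *m (block_mx a%:M r c M : 'M[R]_(1 + n)) =
  cons_rV (a * t + (y *m c) ord0 ord0, y *m M + t *: r).
Proof.
rewrite /cons_rV (@mul_row_block _ 1 1 n 1 n) /= -scalar_mxM mul_scalar_mx [_ + y *m M]addrC.
by rewrite [y *m c]mx11_scalar -raddfD mulrC /= !mxE eqxx mulr1n.
Qed.

(** The first coordinate is integrated innermost: with the others fixed it is only translated, by
    [y *m c]. *)
Lemma lin_cov_lower n (c : 'cV[R]_n) : lin_cov (block_mx 1%:M 0 c 1%:M : 'M[R]_(1 + n)).
Proof.
move=> F mF F0; rewrite det_lblock !det1 mulr1 normr1 mul1e.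
rewrite ge0_integral_rVSr//; last first.
  by apply: (measurableT_comp mF); exact: measurable_fun_mx_sum.
rewrite (ge0_integral_rVSr mF F0); apply: eq_integral => y _.
have := @ge0_integral_affine R 1 ((y *m c) ord0 ord0) (fun t => F (cons_rV (t, y))) (oner_neq0 _).
rewrite normr1 mul1e => <-//; last first.
  exact: (measurableT_comp (measurable_fun_cons mF) (measurable_pair2 y)).
apply: eq_integral => t _; congr F.
by rewrite cons_rV_mul_block scaler0 addr0 mulmx1.
Qed.

(** The first coordinate t is integrated outermost: it is scaled by [a], and for fixed t the
    remaining ones undergo [M] followed by a translation by [t *: c]. *)
Lemma lin_cov_upper n (a : R) (c : 'rV[R]_n) (M : 'M[R]_n) : a != 0 -> lin_cov M ->
  lin_cov (block_mx a%:M c 0 M : 'M[R]_(1 + n)).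
Proof.
move=> a0 hM F mF F0; rewrite det_ublock det_scalar expr1 normrM.
rewrite ge0_integral_rVS//; last first.
  by apply: (measurableT_comp mF); exact: measurable_fun_mx_sum.
rewrite (ge0_integral_rVS mF F0).
have mFt t : measurable_fun setT (fun y => F (cons_rV (t, y))).
  exact: (measurableT_comp (measurable_fun_cons mF) (measurable_pair1 t)).
pose G (t : R) := (\int[lebesgue_rV n]_y F (cons_rV (t, y)))%E.
have mG : measurable_fun setT G by exact: measurable_integral_cons.
have G0 t : (0 <= G t)%E by exact: integral_ge0.
rewrite -(ge0_integral_affine 0 a0 mG G0) EFinM -muleA; congr (_ * _)%E.
rewrite -ge0_integralZl//; last 2 first.
- apply: (@measurable_integral_cons n (fun x : 'rV[R]_n.+1 => F (x *m _))) => //.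
  by apply: (measurableT_comp mF); exact: measurable_fun_mx_sum.
- by move=> t _; exact: integral_ge0.
apply: eq_integral => t _; rewrite addr0 /G.
rewrite -(ge0_integral_rV_translate (t *: c) (mFt (a * t)))//.
rewrite -(hM (fun y => F (cons_rV (a * t, y + t *: c))))//; last first.
  by apply: (measurableT_comp (mFt _)); exact: measurable_fun_addmx.
congr (_ * _)%E; apply: eq_integral => y _; congr F.
by rewrite cons_rV_mul_block mulmx0 mxE addr0.
Qed.

(** One step of Gaussian elimination; the lower right block of the second factor is the Schur
    complement of the pivot. *)
Lemma lin_cov_block n (a : R) (c : 'cV[R]_n) (r : 'rV[R]_n) (S : 'M[R]_n) :
  a != 0 -> (block_mx a%:M r c S : 'M[R]_(1 + n)) =
    block_mx (1%R)%:M 0 (a^-1 *: c) 1%:M *m block_mx a%:M r 0 (S - a^-1 *: c *m r).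
Proof.
move=> a0; rewrite mulmx_block !mul1mx !mul0mx !addr0 mul_mx_scalar scalerA divff// scale1r.
by rewrite addrC subrK.
Qed.

Lemma lin_cov_unit n (M : 'M[R]_n) : M \in unitmx -> lin_cov M.
Proof.
elim: n M => [|n IH] M uM.
  move=> F mF F0; rewrite det_mx00 normr1 mul1e.
  by apply: eq_integral => x _; rewrite (thinmx0 x) mul0mx.
have step (a : R) (c : 'cV[R]_n) (r : 'rV[R]_n) (S : 'M[R]_n) : a != 0 ->
    (block_mx a%:M r c S : 'M[R]_(1 + n)) \in unitmx ->
    lin_cov (block_mx a%:M r c S : 'M[R]_(1 + n)).
  move=> a0; rewrite lin_cov_block// unitmx_mul => /andP[_ u2].
  apply: lin_covM; first exact: lin_cov_lower.
  apply: lin_cov_upper => //; apply: IH.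
  by move: u2; rewrite !unitmxE det_ublock unitrM => /andP[].
have stepM (N : 'M[R]_(1 + n)) : N ord0 ord0 != 0 -> N \in unitmx -> lin_cov N.
  move=> N0; rewrite -(submxK N) [ulsubmx N]mx11_scalar; apply: step.
  by rewrite !mxE !lshift0.
have [M0|M0] := eqVneq (M ord0 ord0) 0; last exact: stepM.
have [j Mj] : exists j, M (lift ord0 j) ord0 != 0.
  apply/existsP; apply: contraPT uM; rewrite negb_exists => /forallP H.
  rewrite unitmxE (expand_det_col _ ord0) big1 ?unitr0// => i _.
  have [k ->|->] := unliftP ord0 i; last by rewrite M0 mul0r.
  by have := H k; rewrite negbK => /eqP ->; rewrite mul0r.
(* Multiplying by [e 1] on the left adds row [lift ord0 j] to the first row, which replaces the zero
   pivot by [M (lift ord0 j) ord0]; [e (-1)] undoes this. *)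
pose e (s : R) := (block_mx (1%R)%:M (s *: delta_mx ord0 j) 0 1%:M : 'M[R]_(1 + n)).
have eK : e (-1) *m e 1 = 1%:M.
  rewrite /e mulmx_block !mul1mx !mulmx1 !mulmx0 !mul0mx !addr0 !add0r.
  by rewrite scale1r scaleN1r subrr -scalar_mx_block.
have ue s : e s \in unitmx by rewrite unitmxE det_ublock !det1 mulr1 unitr1.
rewrite -[M]mul1mx -eK -mulmxA; apply: lin_covM.
  apply: lin_cov_upper; first exact: oner_neq0.
  by apply: IH; exact: unitmx1.
apply: stepM; last by rewrite unitmx_mul ue.
have lE : lshift n (ord0 : 'I_1) = ord0 by exact/val_inj.
have rE k : rshift 1 k = lift ord0 k :> 'I_(1 + n) by exact/val_inj.
have eE k : e 1 ord0 (lift ord0 k) = (k == j)%:R.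
  by rewrite -rE -[X in e 1 X]lE /e block_mxEur !mxE mul1r eqxx.
rewrite mxE (@big_ord_recl _ _ _ n) M0 mulr0 add0r.
rewrite (bigD1 j)//= big1 => [|k kj]; first by rewrite eE eqxx mul1r addr0.
by rewrite eE (negPf kj) mul0r.
Qed.

End lebesgue_rV_theory.

(** * Measures with a density *)

Section density.
Context d (T : measurableType d) (R : realType).
Variables (m : {measure set T -> \bar R}) (g : T -> R).
Hypotheses (mg : measurable_fun setT g) (g0 : forall x, 0 <= g x).
Local Open Scope ereal_scope.

Let mEg : measurable_fun setT (EFin \o g). Proof. exact/measurable_EFinP. Qed.

Let density A := \int[m]_(x in A) (g x)%:E.

Let density0 : density set0 = 0.
Proof. by rewrite /density integral_set0. Qed.

Let density_ge0 A : 0 <= density A.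
Proof. by apply: integral_ge0 => x _; rewrite lee_fin. Qed.

Let density_sigma_additive : semi_sigma_additive density.
Proof.
move=> /= A mA tA mUA; rewrite /density ge0_integral_bigcup//=.
- by apply: is_cvg_ereal_nneg_natsum_cond => n _ _; exact: density_ge0.
- exact: measurable_funTS.
- by move=> x _; rewrite lee_fin.
Qed.

HB.instance Definition _ := isMeasure.Build _ _ _
  density density0 density_ge0 density_sigma_additive.

Lemma density_exists : exists m' : {measure set T -> \bar R},
  forall A, measurable A -> m' A = \int[m]_(x in A) (g x)%:E.
Proof. by exists [the measure _ _ of density]. Qed.

Import HBNNSimple.

(** The hypothesis is the case of indicators; finite sums give simple functions, and monotone
    convergence the rest. *)
Lemma ge0_integral_density (m' : {measure set T -> \bar R}) :
  (forall A, measurable A -> m' A = \int[m]_(x in A) (g x)%:E) ->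
  forall F : T -> \bar R, measurable_fun setT F -> (forall x, 0 <= F x) ->
  \int[m']_x F x = \int[m]_x ((g x)%:E * F x).
Proof.
move=> m'E F mF F0.
pose f_ := nnsfun_approx measurableT mF.
transitivity (limn (fun n => \int[m']_x (f_ n x)%:E)).
  rewrite -monotone_convergence//.
  - apply: eq_integral => y _; apply/esym/cvg_lim => //.
    exact: cvg_nnsfun_approx.
  - by move=> n; exact/measurable_EFinP/measurable_funP.
  - by move=> n y _; rewrite lee_fin.
  - by move=> y _ i j ij; rewrite lee_fin; exact/lefP/nd_nnsfun_approx.
rewrite [X in limn X](_ : _ = (fun n => \int[m]_x ((g x)%:E * (f_ n x)%:E))).
  rewrite -monotone_convergence//; last 3 first.
    - move=> n; apply: emeasurable_funM => //.
      by apply/measurable_EFinP/measurable_funP.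
    - by move=> n x _; rewrite mule_ge0// lee_fin.
    - move=> x _ i j ij; rewrite lee_wpmul2l// lee_fin//.
      exact/lefP/nd_nnsfun_approx.
  apply: eq_integral => x _; apply/cvg_lim => //.
  by apply: cvgeZl => //; exact: cvg_nnsfun_approx.
apply/funext => n.
rewrite (eq_integral (fun x => \sum_(k \in range (f_ n)) (k%:E * (\1_(f_ n @^-1` [set k]) x)%:E))); last first.
  by move=> x _; rewrite fimfunE -fsumEFin//.
rewrite ge0_integral_fsum//; last 2 first.
- by move=> k; exact/measurable_EFinP/measurable_funM.
- by move=> k x _; exact: nnfun_muleindic_ge0.
rewrite [RHS](eq_integral (fun x => \sum_(k \in range (f_ n)) (k%:E * ((g x)%:E * (\1_(f_ n @^-1` [set k]) x)%:E)))); last first.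
  move=> x _; rewrite fimfunE -fsumEFin// ge0_mule_fsumr//; last first.
    by move=> k; exact: nnfun_muleindic_ge0.
  by apply: eq_fsbigr => k _; rewrite EFinM muleCA.
rewrite ge0_integral_fsum//; last 2 first.
- move=> k; apply: emeasurable_funM => //; apply: emeasurable_funM => //.
  exact/measurable_EFinP.
- move=> k x _; rewrite muleCA mule_ge0// ?lee_fin//.
  exact: nnfun_muleindic_ge0.
apply: eq_fsbigr => k; rewrite inE => -[y _ <-].
have mk : measurable (f_ n @^-1` [set f_ n y]) by [].
rewrite ge0_integralZl_EFin//; last first.
  exact/measurable_EFinP.
rewrite ge0_integralZl_EFin//; last 2 first.
- by move=> x _; rewrite mule_ge0// lee_fin.
- by apply: emeasurable_funM => //; exact/measurable_EFinP.
congr (_ * _); rewrite integral_indic// setIT m'E//.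
rewrite integral_mkcond.
apply: eq_integral => x _; rewrite patchE.
rewrite indicE; case: ifPn => _; by rewrite ?mule1 ?mule0.
Qed.

End density.

(** * Boxes determine measures on row vectors *)

Section boxes.
Context {R : realType}.
Local Notation mu := (@lebesgue_measure R).

Definition rV_box n (B : 'I_n -> set R) : set 'rV[R]_n :=
  [set v | forall i, B i (v ord0 i)].

Lemma measurable_rV_box n (B : 'I_n -> set R) :
  (forall i, measurable (B i)) -> measurable (rV_box B).
Proof.
move=> mB; have -> : rV_box B = \bigcap_i ((fun v : 'rV[R]_n => v ord0 i) @^-1` B i).
  by apply/seteqP; split=> v /= Bv i; [move=> _|]; exact: Bv.
apply: fin_bigcap_measurable => [|i _]; first exact: finite_finset.
by rewrite -[X in measurable X]setTI; apply: measurable_coord => //; exact: mB.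
Qed.

Definition rV_boxes n : set (set 'rV[R]_n) :=
  [set A | exists2 B : 'I_n -> set R, (forall i, measurable (B i)) & A = rV_box B].

Lemma measurable_rV_boxes n : @measurable _ 'rV[R]_n = <<s @rV_boxes n >>.
Proof.
apply/seteqP; split; last first.
  apply: smallest_sub; first exact: sigma_algebra_measurable.
  by move=> _ [B mB ->]; exact: measurable_rV_box.
apply: sub_smallest2r; first exact: smallest_sigma_algebra.
move=> A; rewrite -bigcup_seq/= => -[i _ /= [C mC <-]].
exists (fun j => if j == i then C else setT).
  by move=> j; case: ifP.
apply/seteqP; split=> v /= => [[_ Cv] j|/(_ i)]; last by rewrite eqxx.
by case: eqVneq => [->|].
Qed.

(** Boxes are stable under intersection and generate the sigma-algebra, and the cubes of side 2 k
    exhaust the space with finite measure. *)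
Lemma measure_boxes_unique n (m1 m2 : {measure set 'rV[R]_n -> \bar R}) :
  (forall B, (forall i, measurable (B i)) -> m1 (rV_box B) = m2 (rV_box B)) ->
  (forall k : nat, (m1 (rV_box (fun=> `[(- k%:R)%R, k%:R]%classic)) < +oo)%E) ->
  forall A, measurable A -> m1 A = m2 A.
Proof.
move=> m12 m1oo A mA.
apply: (measure_unique (@rV_boxes n) (fun k : nat => rV_box (fun=> `[(- k%:R)%R, k%:R]%classic))) => //.
- exact: measurable_rV_boxes.
- move=> _ _ [B mB ->] [C mC ->]; exists (fun i => B i `&` C i).
    by move=> i; exact: measurableI.
  apply/seteqP; split=> v /= => [[Bv Cv] i|BCv]; first by split.
  by split=> i; have [] := BCv i.
- by move=> k; exists (fun=> `[(- k%:R)%R, k%:R]%classic).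
- apply/seteqP; split=> // v _.
  (* The sum serves as a common bound: it dominates each of its terms. *)
  exists (\sum_(i < n) Num.bound `|v ord0 i|)%N => // i /=.
  rewrite in_itv /= -ler_norml; apply: (le_trans (ltW (archi_boundP (normr_ge0 _)))).
  by rewrite ler_nat (bigD1 i)//= leq_addr.
- by move=> _ [B mB ->]; exact: m12.
Qed.


Lemma lebesgue_rV_boxE n (B : 'I_n -> set R) : (forall i, measurable (B i)) ->
  lebesgue_rV n (rV_box B) = (\prod_(i < n) mu (B i))%E.
Proof. exact: lebesgue_rV_box. Qed.

Lemma lebesgue_rV_cube_lty n (k : nat) :
  (lebesgue_rV n (rV_box (fun=> `[(- k%:R)%R, k%:R]%classic)) < +oo :> \bar R)%E.
Proof.
rewrite lebesgue_rV_boxE//.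
rewrite (eq_bigr (fun=> (k%:R + k%:R)%:E)).
  by rewrite prodEFin ltry.
move=> i _; rewrite lebesgue_measure_itv /= lte_fin; case: ltP => [_|k0].
  by rewrite -EFinD opprK.
congr (_%:E); have : (0 : R) <= k%:R by [].
lra.
Qed.

(** Tonelli for an arbitrary splitting of the coordinates into two blocks: [s] tells where each
    coordinate goes. Both measures give a box the product of the lengths of its sides. *)
Lemma ge0_integral_reshape p q m (s : 'I_p + 'I_q -> 'I_m) (f : 'rV[R]_p * 'rV[R]_q -> 'rV[R]_m) :
  bijective s ->
  (forall x y i, f (x, y) ord0 (s (inl i)) = x ord0 i) ->
  (forall x y j, f (x, y) ord0 (s (inr j)) = y ord0 j) ->
  forall F : 'rV[R]_m -> \bar R, measurable_fun setT F -> (forall x, 0 <= F x)%E ->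
  (\int[lebesgue_rV m]_z F z = \int[lebesgue_rV p]_x \int[lebesgue_rV q]_y F (f (x, y)))%E.
Proof.
move=> [t st ts] fl fr F mF F0.
have mf : measurable_fun setT f.
  apply/measurable_fun_rVP => k; rewrite -(ts k); case: (t k) => [i|j].
    apply: (eq_measurable_fun (fun z : 'rV[R]_p * 'rV[R]_q => z.1 ord0 i)).
      by move=> [x y] _; rewrite fl.
    by apply: (measurableT_comp (measurable_coord i)); exact: measurable_fst.
  apply: (eq_measurable_fun (fun z : 'rV[R]_p * 'rV[R]_q => z.2 ord0 j)).
    by move=> [x y] _; rewrite fr.
  by apply: (measurableT_comp (measurable_coord j)); exact: measurable_snd.
have [n [nE nI]] := pushforward_exists (lebesgue_rV p \x lebesgue_rV q)%E mf.
transitivity (\int[n]_z F z)%E; last first.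
  rewrite nI// fubini_tonelli1//; exact: (measurableT_comp mF mf).
apply: eq_measure_integral => A mA _.
apply: measure_boxes_unique => // [B mB|k].
  rewrite nE (_ : f @^-1` _ = rV_box (fun i => B (s (inl i))) `*` rV_box (fun j => B (s (inr j)))).
    have E1 := lebesgue_rV_boxE mB.
    have E2 := lebesgue_rV_boxE (fun i => mB (s (inl i))).
    have E3 := lebesgue_rV_boxE (fun i => mB (s (inr i))).
    apply: (eq_trans E1); apply/esym.
    apply: (eq_trans (product_measure1E (lebesgue_rV p) (lebesgue_rV q) _ _)); try exact: measurable_rV_box.
    apply: (eq_trans (congr2 mule E2 E3)).
    by rewrite [RHS](reindex s)/= ?big_sumType//; exists t => x _.
  apply/seteqP; split=> -[x y] /= => [H|[H1 H2] k].
    by split=> i; rewrite -1?(fl x y) -1?(fr x y); exact: H.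
  by rewrite -(ts k); case: (t k) => i; rewrite ?fl ?fr; [exact: H1|exact: H2].
exact: lebesgue_rV_cube_lty.
Qed.

End boxes.

(** * Gaussian integrals over vectors and matrices *)

Section gauss.
Context {R : realType}.
Local Notation mu := (@lebesgue_measure R).
Local Notation G := (@std_normal_density R _).

Definition sqn n (v : 'rV[R]_n) : R := \sum_(i < n) v ord0 i ^+ 2.

Lemma sqn_ge0 n (v : 'rV[R]_n) : 0 <= sqn v.
Proof. by apply: sumr_ge0 => i _; exact: sqr_ge0. Qed.

Lemma sqnE n (v : 'rV[R]_n) : sqn v = (v *m v^T) ord0 ord0.
Proof. by rewrite mxE; apply: eq_bigr => i _; rewrite mxE expr2. Qed.

Lemma sqnZ n (a : R) (v : 'rV[R]_n) : sqn (a *: v) = a ^+ 2 * sqn v.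
Proof. by rewrite mulr_sumr; apply: eq_bigr => i _; rewrite mxE exprMn. Qed.

Lemma sqn_eq0 n (v : 'rV[R]_n) : (sqn v == 0) = (v == 0).
Proof.
apply/eqP/eqP => [|->]; last by rewrite /sqn big1// => i _; rewrite mxE expr0n.
move/eqP; rewrite psumr_eq0; last by move=> i _; exact: sqr_ge0.
move=> /allP v0; apply/rowP => i; rewrite mxE.
by have := v0 i; rewrite mem_index_enum sqrf_eq0 => /(_ isT)/eqP.
Qed.

Lemma sqn_cons n (t : R) (y : 'rV[R]_n) : sqn (cons_rV (t, y)) = t ^+ 2 + sqn y.
Proof.
by rewrite /sqn big_ord_recl cons_rV0; congr (_ + _); apply: eq_bigr => i _; rewrite cons_rVS.
Qed.

Lemma measurable_sqn n : measurable_fun setT (@sqn n).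
Proof.
by apply: measurable_sum => i; apply: measurable_funX; exact: measurable_coord.
Qed.

Lemma std_normal_density_gt0 n (v : 'rV[R]_n) : 0 < G v.
Proof. by rewrite mulr_gt0 ?expR_gt0// powR_gt0// mulr_gt0// pi_gt0. Qed.

Lemma std_normal_density_ge0 n (v : 'rV[R]_n) : 0 <= G v.
Proof. exact/ltW/std_normal_density_gt0. Qed.

Lemma measurable_std_normal_density n :
  measurable_fun setT (@std_normal_density R n).
Proof.
apply: measurable_funM => //; apply: measurableT_comp => //.
apply: measurable_funM => //; apply: measurableT_comp => //.
exact: measurable_sqn.
Qed.
Hint Resolve measurable_std_normal_density : core.

Lemma phiE (t : R) : phi t = (2 * pi) `^ (- (1 / 2)) * expR (- t ^+ 2 / 2).
Proof.
have pi2 : 0 <= 2 * pi :> R by rewrite mulr_ge0// pi_ge0.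
rewrite /phi normal_pdfE ?oner_neq0// /normal_peak /normal_fun subr0 expr1n mul1r.
by rewrite div1r powRN powR12_sqrt// -[pi *+ 2]mulr_natl.
Qed.

Lemma phi_ge0 (t : R) : 0 <= phi t. Proof. exact: normal_pdf_ge0. Qed.

Lemma measurable_phi : measurable_fun setT (@phi R).
Proof. exact: measurable_normal_pdf. Qed.
Hint Resolve measurable_phi : core.

Lemma powR_twopiD (a b : R) : (2 * pi) `^ (a + b) = (2 * pi) `^ a * (2 * pi) `^ b :> R.
Proof. by rewrite powRD//; apply/implyP => _; rewrite gt_eqF// mulr_gt0// pi_gt0. Qed.

Lemma density_reshape p q m (v : 'rV[R]_m) (x : 'rV[R]_p) (y : 'rV[R]_q) :
  m = (p + q)%N -> sqn v = sqn x + sqn y -> G v = G x * G y.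
Proof.
move=> mE vE; rewrite /std_normal_density -!/(sqn _) vE mE mulrACA -expRD -powR_twopiD.
by congr (_ `^ _ * expR _); rewrite ?natrD; field.
Qed.

Lemma density_cons n (t : R) (y : 'rV[R]_n) : G (cons_rV (t, y)) = phi t * G y.
Proof.
rewrite phiE /std_normal_density -!/(sqn _) sqn_cons mulrACA -expRD -powR_twopiD.
by congr (_ `^ _ * expR _); rewrite -?natr1; field.
Qed.

(* Expectations under the standard normal law: [gint] of a random vector, [gmx]
   of a random matrix with independent entries. *)
Definition gint n (F : 'rV[R]_n -> \bar R) : \bar R :=
  (\int[lebesgue_rV n]_x ((G x)%:E * F x))%E.

Lemma eq_gint n (F F' : 'rV[R]_n -> \bar R) : F =1 F' -> gint F = gint F'.
Proof. by move=> FF'; apply: eq_integral => x _; rewrite FF'. Qed.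

Lemma gint_ge0 n (F : 'rV[R]_n -> \bar R) : (forall x, 0 <= F x)%E -> (0 <= gint F)%E.
Proof.
move=> F0; apply: integral_ge0 => x _; rewrite mule_ge0// lee_fin.
exact: std_normal_density_ge0.
Qed.

Lemma measurable_gint_fun n (F : 'rV[R]_n -> \bar R) : measurable_fun setT F ->
  measurable_fun setT (fun x => (G x)%:E * F x)%E.
Proof. by move=> mF; apply: emeasurable_funM => //; apply/measurable_EFinP; exact: measurable_std_normal_density. Qed.

Lemma gint_fun_ge0 n (F : 'rV[R]_n -> \bar R) : (forall x, 0 <= F x)%E ->
  (forall x, 0 <= (G x)%:E * F x)%E.
Proof. by move=> F0 x; rewrite mule_ge0// lee_fin std_normal_density_ge0. Qed.

Lemma gintZl n (k : R) (F : 'rV[R]_n -> \bar R) : 0 <= k -> measurable_fun setT F ->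
  (forall x, 0 <= F x)%E -> (gint (fun x => k%:E * F x) = k%:E * gint F)%E.
Proof.
move=> k0 mF F0; rewrite /gint -ge0_integralZl_EFin//; last 2 first.
- by move=> x _; exact: gint_fun_ge0.
- exact: measurable_gint_fun.
by apply: eq_integral => x _; rewrite muleCA.
Qed.

Lemma gint_cons n (F : 'rV[R]_n.+1 -> \bar R) : measurable_fun setT F ->
  (forall x, 0 <= F x)%E ->
  (gint F = \int[mu]_t ((phi t)%:E * gint (fun y => F (cons_rV (t, y)))))%E.
Proof.
move=> mF F0; rewrite /gint.
rewrite (ge0_integral_rVS (measurable_gint_fun mF) (gint_fun_ge0 F0)).
apply: eq_integral => t _; rewrite -ge0_integralZl_EFin//.
- by apply: eq_integral => y _; rewrite density_cons EFinM muleA.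
- by move=> y _; exact: (gint_fun_ge0 (fun y => F0 (cons_rV (t, y)))).
- apply: measurable_gint_fun.
  exact: (measurableT_comp (measurable_fun_cons mF) (measurable_pair1 t)).
- exact: phi_ge0.
Qed.

Lemma gint_box n (B : 'I_n -> set R) : (forall i, measurable (B i)) ->
  (gint (fun x => (\1_(rV_box B) x)%:E) = \prod_(i < n) \int[mu]_(t in B i) (phi t)%:E)%E.
Proof.
elim: n B => [|n IH] B mB.
  rewrite big_ord0 /gint ge0_integral_rV0; last first.
    by apply: gint_fun_ge0 => x; rewrite lee_fin.
  rewrite indicE mem_set; last by move=> -[].
  rewrite mule1 /std_normal_density big_ord0.
  by rewrite mul0r oppr0 powRr0 mul0r expR0 mulr1.
rewrite gint_cons; last 2 first.
- by apply/measurable_EFinP; apply: measurable_indic; exact: measurable_rV_box.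
- by move=> x; rewrite lee_fin.
rewrite big_ord_recl; pose B' (i : 'I_n) := B (lift ord0 i).
have mB' i : measurable (B' i) by exact: mB.
rewrite -[X in (_ * X)%E]/(\prod_(i < n) \int[mu]_(t in B' i) (phi t)%:E)%E -(IH _ mB').
transitivity (\int[mu]_t (gint (fun y : 'rV[R]_n => (\1_(rV_box B') y)%:E) * ((phi t)%:E * (\1_(B ord0) t)%:E)))%E.
  apply: eq_integral => t _; rewrite [RHS]muleC -muleA; congr (_ * _)%E.
  rewrite -gintZl//; last first.
    by apply/measurable_EFinP; apply: measurable_indic; exact: measurable_rV_box.
  apply: eq_gint => y; rewrite -EFinM; congr (_%:E).
  rewrite !indicE -natrM mulnb; congr (nat_of_bool _)%:R.
  apply/idP/andP => [|[]]; rewrite !inE.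
    move=> H; split.
      by have := H ord0; rewrite cons_rV0.
    by move=> i; have := H (lift ord0 i); rewrite cons_rVS.
  move=> H0 HS i; have [j ->|->] := unliftP ord0 i.
    by rewrite cons_rVS; exact: HS.
  by rewrite cons_rV0.
rewrite ge0_integralZl//; last 3 first.
- apply: emeasurable_funM; apply/measurable_EFinP => //.
  by apply: measurable_indic; exact: mB.
- by move=> t _; rewrite mule_ge0// lee_fin// phi_ge0.
- by apply: gint_ge0 => x; rewrite lee_fin.
rewrite muleC; congr (_ * _)%E.
rewrite [RHS]integral_mkcond; apply: eq_integral => t _; rewrite patchE indicE.
by case: ifPn => _; rewrite ?mule1 ?mule0.
Qed.

Lemma integral_phi : (\int[mu]_t (phi t)%:E = 1)%E.
Proof. by rewrite integral_normal_pdf. Qed.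

Lemma gint1 n : gint (fun _ : 'rV[R]_n => 1%E) = 1%E.
Proof.
have := @gint_box n (fun=> setT) (fun=> measurableT).
under eq_gint => x.
  rewrite indicE mem_set//.
  over.
move=> ->; rewrite big1// => i _; exact: integral_phi.
Qed.

End gauss.

Section gauss_invariance.
Context {R : realType}.
Local Notation mu := (@lebesgue_measure R).
Local Notation G := (@std_normal_density R _).

Lemma gint_cst n (c : \bar R) : (0 <= c)%E -> gint (fun _ : 'rV[R]_n => c) = c.
Proof.
move=> c0; rewrite /gint ge0_integralZr//; last 2 first.
- by apply/measurable_EFinP; exact: measurable_std_normal_density.
- by move=> x _; rewrite lee_fin std_normal_density_ge0.
rewrite -[RHS]mul1e -[X in (_ = X * _)%E](@gint1 R n); congr (_ * _)%E.
by apply: eq_integral => x _; rewrite mule1.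
Qed.

Lemma gint_reshape p q m (s : 'I_p + 'I_q -> 'I_m) (f : 'rV[R]_p * 'rV[R]_q -> 'rV[R]_m) :
  bijective s ->
  (forall x y i, f (x, y) ord0 (s (inl i)) = x ord0 i) ->
  (forall x y j, f (x, y) ord0 (s (inr j)) = y ord0 j) ->
  forall F : 'rV[R]_m -> \bar R, measurable_fun setT F -> (forall x, 0 <= F x)%E ->
  (gint F = gint (fun x => gint (fun y => F (f (x, y)))))%E.
Proof.
move=> sb fl fr F mF F0; rewrite {1}/gint.
rewrite (ge0_integral_reshape sb fl fr (measurable_gint_fun mF) (gint_fun_ge0 F0)).
apply: eq_integral => x _.
have [t st ts] := sb.
have mf : measurable_fun setT (fun y => f (x, y)).
  apply/measurable_fun_rVP => k; rewrite -(ts k); case: (t k) => [i|j].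
    by apply: (eq_measurable_fun (fun=> x ord0 i)) => // y _; rewrite fl.
  apply: (eq_measurable_fun (fun y : 'rV[R]_q => y ord0 j)).
    by move=> y _; rewrite fr.
  exact: measurable_coord.
have mFf : measurable_fun setT (fun y => F (f (x, y))) by exact: measurableT_comp mF mf.
rewrite /gint -ge0_integralZl_EFin//; last 3 first.
- by move=> y _; exact: (gint_fun_ge0 (fun y => F0 (f (x, y)))).
- exact: (measurable_gint_fun mFf).
- exact: std_normal_density_ge0.
apply: eq_integral => y _; rewrite muleA -EFinM; congr (_%:E * _)%E.
apply: density_reshape.
  by have := bij_eq_card sb; rewrite card_sum !card_ord.
by rewrite /sqn (reindex s)/= ?big_sumType; [congr (_ + _); apply: eq_bigr => i _; rewrite ?fl ?fr|exists t => y' _].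
Qed.

Lemma gint_isometry n (M : 'M[R]_n) : M \in unitmx ->
  (forall x, sqn (x *m M) = sqn x) ->
  forall F : 'rV[R]_n -> \bar R, measurable_fun setT F -> (forall x, 0 <= F x)%E ->
  gint (fun x => F (x *m M)) = gint F.
Proof.
move=> uM iM.
have H (F : 'rV[R]_n -> \bar R) : measurable_fun setT F -> (forall x, 0 <= F x)%E ->
    (`|\det M|%:E * gint (fun x => F (x *m M)) = gint F)%E.
  move=> mF F0.
  rewrite /gint -(lin_cov_unit uM (measurable_gint_fun mF) (gint_fun_ge0 F0)).
  apply: (congr1 (mule _)); apply: eq_integral => x _.
  by rewrite (_ : G (x *m M) = G x)// /std_normal_density -!/(sqn _) iM.
(* An isometry has |det| = 1: the change of variables is tested on the constant 1, whose Gaussian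
   integral is 1. *)
have d1 : `|\det M|%:E = 1%E :> \bar R.
  by have := H (fun=> 1%E) (measurable_cst _) (fun=> lee01); rewrite gint1 mule1.
by move=> F mF F0; rewrite -[RHS]H// d1 mul1e.
Qed.

(* The reflection exchanging [u] and [|u| e_0]. *)
Lemma householder n (u : 'rV[R]_n.+1) :
  exists Q : 'M[R]_n.+1, [/\ Q^T = Q, Q *m Q = 1%:M &
    u *m Q = Num.sqrt (sqn u) *: delta_mx ord0 ord0].
Proof.
set r := Num.sqrt (sqn u); set e := (delta_mx ord0 ord0 : 'rV[R]_n.+1).
have rr : r ^+ 2 = sqn u by rewrite sqr_sqrtr ?sqn_ge0.
pose w := u - r *: e.
have [w0|w0] := eqVneq w 0.
  exists 1%:M; rewrite trmx1 !mulmx1; split=> //.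
  by apply/eqP; rewrite -subr_eq0 -/w w0.
pose c := sqn w.
have c0 : c != 0 by rewrite sqn_eq0.
have wwT : w *m w^T = c%:M by rewrite [LHS]mx11_scalar -sqnE.
(* Since |u| = r, expanding gives |u - r e| ^ 2 = 2 <u, u - r e>. Hence <u, w> = c / 2, and the
   reflection subtracts exactly [w] from [u]. *)
have cE : c = (u *m w^T) ord0 ord0 * 2.
  apply/eqP; rewrite -subr_eq0 mxE mulr_suml /c /sqn -sumrB.
  rewrite (eq_bigr (fun i => r ^+ 2 * (i == ord0)%:R - u ord0 i ^+ 2)); last first.
    move=> i _; rewrite !mxE eqxx /=; case: (i == ord0) => /=; ring.
  rewrite sumrB -/(sqn u) -rr (bigD1 ord0)//= big1 => [|i /negPf ->]; last by rewrite mulr0.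
  by rewrite mulr1 addr0 subrr.
have wd : w = u - r *: e by [].
clearbody c w.
exists (1%:M - (2 / c) *: (w^T *m w)); split.
- by rewrite linearB /= trmx1 linearZ /= trmx_mul trmxK.
- rewrite mulmxBl mul1mx mulmxBr mulmx1 -scalemxAl -scalemxAr scalerA.
  rewrite mulmxA -(mulmxA w^T w) wwT mul_mx_scalar -scalemxAl scalerA.

  rewrite (_ : 2 / c * (2 / c) * c = 2 / c + 2 / c); last by field.
  by rewrite scalerDl opprB addrK subrK.
- rewrite mulmxBr mulmx1 -scalemxAr mulmxA.
  have -> : u *m w^T = (c / 2)%:M by rewrite [LHS]mx11_scalar cE; congr (_%:M); field.
  rewrite mul_scalar_mx scalerA (_ : 2 / c * (c / 2) = 1) ?scale1r; last by field.
  by rewrite wd opprB addrC subrK.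
Qed.

(** By rotation invariance [u] may be replaced by |u| e_0, so <x, u> has the law of |u| times a
    single normal coordinate. *)
Lemma gint_linear n (u : 'rV[R]_n) (F : R -> \bar R) : measurable_fun setT F -> (forall x, 0 <= F x)%E ->
  (gint (fun x => F ((x *m u^T) ord0 ord0)) =
   \int[mu]_t ((phi t)%:E * F (Num.sqrt (sqn u) * t)%R))%E.
Proof.
move=> mF F0; case: n u => [|n] u.
  have u0 : u = 0 by exact: thinmx0.
  rewrite /gint ge0_integral_rV0; last by apply: gint_fun_ge0 => x.
  have -> : sqn u = 0 by rewrite /sqn big_ord0.
  rewrite sqrtr0 mul0mx mxE.
  under [RHS]eq_integral do rewrite mul0r.
  rewrite ge0_integralZr//; last 2 first.
  - by apply/measurable_EFinP; exact: measurable_phi.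
  - by move=> x _; rewrite lee_fin phi_ge0.
  rewrite integral_phi; congr (_ * _)%E.
  by rewrite /std_normal_density big_ord0 !mul0r oppr0 powRr0 mul0r expR0 mulr1.
have [Q [QT QQ uQ]] := householder u.
have mlin (v : 'rV[R]_n.+1) : measurable_fun setT (fun x : 'rV[R]_n.+1 => (x *m v^T) ord0 ord0).
  have := @measurable_fun_mx_sum R _ _ _ _ (fun x : 'rV[R]_n.+1 => x) v^T.
  by move=> H; apply: (measurableT_comp (measurable_coord ord0)); exact: H.
have uQ' : Q \in unitmx by case: (mulmx1_unit QQ).
rewrite -(gint_isometry uQ'); last 3 first.
- by move=> x; rewrite !sqnE trmx_mul QT mulmxA -(mulmxA x) QQ mulmx1.
- by apply: (measurableT_comp mF); exact: mlin.
- by move=> x.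
set r := Num.sqrt _ in uQ *.
have E x : ((x *m Q *m u^T) ord0 ord0 = r * x ord0 ord0)%R.
  rewrite -mulmxA -{1}QT -trmx_mul uQ linearZ /= trmx_delta -scalemxAr mxE; congr (_ * _).
  rewrite mxE (bigD1 ord0)//= big1 => [|i i0]; rewrite mxE ?eqxx ?mulr1 ?addr0//.
  by rewrite (negPf i0) mulr0.
under eq_gint do rewrite E.
rewrite gint_cons; last 2 first.
- apply: (measurableT_comp mF); apply: measurable_funM => //; exact: measurable_coord.
- by [].
apply: eq_integral => t _; congr (_ * _)%E.
transitivity (gint (fun _ : 'rV[R]_n => F (r * t)%R)); last by rewrite gint_cst.
by apply: eq_gint => y; rewrite cons_rV0.
Qed.

(** One measure with three descriptions: boxes for uniqueness arguments, the density for
    [std_normal_vector], and integrals for [gint]. *)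
Lemma gauss_measure_exists n : exists D : {measure set 'rV[R]_n -> \bar R},
  [/\ (forall B, (forall i, measurable (B i)) -> D (rV_box B) = \prod_(i < n) \int[mu]_(t in B i) (phi t)%:E)%E,
      (forall A, measurable A -> D A = \int[lebesgue_rV n]_(x in A) (G x)%:E)%E &
      (forall F, measurable_fun setT F -> (forall x, 0 <= F x)%E -> \int[D]_x F x = gint F)%E].
Proof.
have [D DE] := @density_exists _ _ R (lebesgue_rV n) _ (@measurable_std_normal_density R n)
  (@std_normal_density_ge0 R n).
have DI : (forall F, measurable_fun setT F -> (forall x, 0 <= F x)%E -> \int[D]_x F x = gint F)%E.
  exact: (ge0_integral_density (@measurable_std_normal_density R n) (@std_normal_density_ge0 R n) DE).
exists D; split=> // B mB; have mbox := measurable_rV_box mB.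
rewrite -gint_box// -DI//; last first.
  by apply/measurable_EFinP; exact: measurable_indic.
by rewrite integral_indic// setIT.
Qed.

Lemma measure_boxes_unique_fin n (m1 m2 : {measure set 'rV[R]_n -> \bar R}) :
  (m1 setT < +oo)%E ->
  (forall B, (forall i, measurable (B i)) -> m1 (rV_box B) = m2 (rV_box B)) ->
  forall A, measurable A -> m1 A = m2 A.
Proof.
move=> m1T m12; apply: measure_boxes_unique => // k.
apply: (le_lt_trans _ m1T); apply: le_measure; rewrite ?inE//.
exact: measurable_rV_box.
Qed.

End gauss_invariance.

(** * Random matrices with independent normal entries *)

Section gauss_matrix.
Context {R : realType}.
Local Notation mu := (@lebesgue_measure R).

Definition gmx n d (F : 'M[R]_(n, d) -> \bar R) : \bar R :=
  gint (fun x : 'rV[R]_(n * d) => F (vec_mx x)).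

Definition mx_measurable n d (F : 'M[R]_(n, d) -> \bar R) :=
  measurable_fun setT (fun x : 'rV[R]_(n * d) => F (vec_mx x)).

Lemma eq_gmx n d (F F' : 'M[R]_(n, d) -> \bar R) : F =1 F' -> gmx F = gmx F'.
Proof. by move=> FF'; apply: eq_gint => x. Qed.

Lemma vec_index n d : exists g : 'I_(n * d) -> 'I_n * 'I_d,
  cancel g (uncurry (@mxvec_index n d)) /\ cancel (uncurry (@mxvec_index n d)) g.
Proof.
have [g gK Kg] := curry_mxvec_bij n d.
by exists g; split=> x; [exact: Kg|exact: gK].
Qed.

Lemma mxvec_index_inj n d i i' j j' :
  @mxvec_index n d i j = mxvec_index i' j' -> i = i' /\ j = j'.
Proof.
have [g [_ Kg]] := vec_index n d => /(congr1 g).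
by rewrite -[mxvec_index i j]/(uncurry _ (i, j)) -[mxvec_index i' j']/(uncurry _ (i', j')) !Kg => -[].
Qed.

Lemma gmx_col_mx a b d (F : 'M[R]_(a + b, d) -> \bar R) :
  mx_measurable F -> (forall A, 0 <= F A)%E ->
  gmx F = gmx (fun A : 'M[R]_(a, d) => gmx (fun B : 'M[R]_(b, d) => F (col_mx A B))).
Proof.
move=> mF F0.
have [ga [gaK Kga]] := vec_index a d; have [gb [gbK Kgb]] := vec_index b d.
pose s (k : 'I_(a * d) + 'I_(b * d)) : 'I_((a + b) * d) := match k with
  | inl i => mxvec_index (lshift b (ga i).1) (ga i).2
  | inr i => mxvec_index (rshift a (gb i).1) (gb i).2 end.
pose f (xy : 'rV[R]_(a * d) * 'rV[R]_(b * d)) := mxvec (col_mx (vec_mx xy.1) (vec_mx xy.2)).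
have sb : bijective s.
  apply: inj_card_bij; last by rewrite card_sum !card_ord mulnDl.
  move=> [i|i] [j|j] /= /mxvec_index_inj [].
  + by move=> /lshift_inj e1 e2; congr inl; rewrite -(gaK i) -(gaK j) [ga i]surjective_pairing e1 e2 -surjective_pairing.
  + by move=> /eqP; rewrite eq_lrshift.
  + by move=> /eqP; rewrite eq_rlshift.
  + by move=> /rshift_inj e1 e2; congr inr; rewrite -(gbK i) -(gbK j) [gb i]surjective_pairing e1 e2 -surjective_pairing.
have fl x y i : f (x, y) ord0 (s (inl i)) = x ord0 i.
  rewrite /f /s mxvecE col_mxEu mxE -[mxvec_index _ _]/(uncurry _ (_, _)).
  by rewrite -surjective_pairing gaK.
have fr x y i : f (x, y) ord0 (s (inr i)) = y ord0 i.
  rewrite /f /s mxvecE col_mxEd mxE -[mxvec_index _ _]/(uncurry _ (_, _)).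
  by rewrite -surjective_pairing gbK.
apply: (eq_trans (gint_reshape sb fl fr mF (fun x => F0 _))).
by apply: eq_gint => x; apply: eq_gint => y; rewrite mxvecK.
Qed.

(** The order is opposite to that of [gmx_col_mx]: the single row is integrated inside, with the
    other rows held fixed, which suits the expansion of a determinant along its first row. *)
Lemma gmx_row_mx b d (F : 'M[R]_(1 + b, d) -> \bar R) :
  mx_measurable F -> (forall A, 0 <= F A)%E ->
  gmx F = gmx (fun B : 'M[R]_(b, d) => gint (fun x : 'rV[R]_d => F (col_mx x B))).
Proof.
move=> mF F0.
have [gb [gbK Kgb]] := vec_index b d.
pose s (k : 'I_(b * d) + 'I_d) : 'I_((1 + b) * d) := match k with
  | inr i => mxvec_index (lshift b ord0) i
  | inl i => mxvec_index (rshift 1 (gb i).1) (gb i).2 end.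
pose f (xy : 'rV[R]_(b * d) * 'rV[R]_d) := mxvec (col_mx xy.2 (vec_mx xy.1)).
have sb : bijective s.
  apply: inj_card_bij; last by rewrite card_sum !card_ord mulnDl mul1n addnC.
  move=> [i|i] [j|j] /= /mxvec_index_inj [].
  + by move=> /rshift_inj e1 e2; congr inl; rewrite -(gbK i) -(gbK j) [gb i]surjective_pairing e1 e2 -surjective_pairing.
  + by move=> /eqP; rewrite eq_rlshift.
  + by move=> /eqP; rewrite eq_lrshift.
  + by move=> _ ->.
have fl x y i : f (x, y) ord0 (s (inl i)) = x ord0 i.
  rewrite /f /s mxvecE col_mxEd mxE -[mxvec_index _ _]/(uncurry _ (_, _)).
  by rewrite -surjective_pairing gbK.
have fr x y i : f (x, y) ord0 (s (inr i)) = y ord0 i.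
  by rewrite /f /s mxvecE col_mxEu.
apply: (eq_trans (gint_reshape sb fl fr mF (fun x => F0 _))).
by apply: eq_gint => x; apply: eq_gint => y; rewrite mxvecK.
Qed.

Lemma sqn_mxvec n d (A : 'M[R]_(n, d)) : sqn (mxvec A) = \tr (A^T *m A).
Proof.
have [g [gK Kg]] := vec_index n d.
rewrite /sqn (reindex (uncurry (@mxvec_index n d)))/=; last by exists g => x _.
rewrite (eq_bigr (fun p => mxvec A ord0 (mxvec_index p.1 p.2) ^+ 2)); last by case.
rewrite -(pair_bigA _ (fun i j => mxvec A ord0 (mxvec_index i j) ^+ 2))/=.
rewrite exchange_big; apply: eq_bigr => j _; rewrite mxE; apply: eq_bigr => i _.
by rewrite mxvecE mxE expr2.
Qed.

(** On flattened matrices A -> Q A is an isometry, because tr ((Q A)^T (Q A)) = tr (A^T A). *)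
Lemma gmx_orthogonal n d (Q : 'M[R]_n) (F : 'M[R]_(n, d) -> \bar R) :
  Q^T *m Q = 1%:M -> mx_measurable F -> (forall A, 0 <= F A)%E ->
  gmx (fun A => F (Q *m A)) = gmx F.
Proof.
move=> QQ mF F0; rewrite /gmx.
have E (x : 'rV[R]_(n * d)) : x *m lin_mulmx Q = mxvec (Q *m vec_mx x).
  by rewrite -{1}(vec_mxK x) mul_vec_lin; reflexivity.
have uM : lin_mulmx Q \in @unitmx R (n * d).
  have : lin_mulmx Q *m lin_mulmx Q^T = 1%:M :> 'M[R]_(n * d).
    apply/row_matrixP => i; rewrite !rowE mulmxA E.
    by rewrite mul_vec_lin /= mulmxA QQ mul1mx vec_mxK mulmx1.
  by case/mulmx1_unit.
have iM (x : 'rV[R]_(n * d)) : sqn (x *m lin_mulmx Q) = sqn x.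
  rewrite E -[in RHS](vec_mxK x) !sqn_mxvec trmx_mul mulmxA -(mulmxA _ Q^T Q).
  by rewrite QQ mulmx1.
apply: (eq_trans _ (gint_isometry uM iM mF (fun x => F0 _))).
by apply: eq_gint => x; rewrite E mxvecK.
Qed.

(** The two laws agree on boxes: independence factors the probability of a box over the rows, and
    normality of each row factors it further over the entries. *)
Lemma gmx_joint disp (Omega : measurableType disp) (P : probability Omega R) k d
    (X : 'I_k -> {RV P >-> 'rV[R]_d}) :
  mutually_independent X -> (forall i, std_normal_vector (X i)) ->
  forall F : 'M[R]_(k, d) -> \bar R, mx_measurable F -> (forall A, 0 <= F A)%E ->
  (\int[P]_w F (\matrix_(i, j) X i w ord0 j) = gmx F)%E.
Proof.
move=> indX nX F mF F0.
pose f w := mxvec (\matrix_(i, j) X i w ord0 j).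
have mf : measurable_fun setT f.
  apply/measurable_fun_rVP => l; case/mxvec_indexP: l => i j.
  apply: (eq_measurable_fun (fun w => X i w ord0 j)).
    by move=> w _; rewrite mxvecE mxE.
  exact: (measurableT_comp (measurable_coord j)).
have [m [mE mI]] := pushforward_exists P mf.
have [D [Dbox _ DI]] := @gauss_measure_exists R (k * d).
transitivity (\int[m]_x F (vec_mx x))%E.
  by rewrite mI//; apply: eq_integral => w _; rewrite mxvecK.
rewrite /gmx -DI//; apply: eq_measure_integral => A mA _.
apply: measure_boxes_unique_fin => // [|B mB].
  have -> : m setT = 1%E by rewrite mE; exact: probability_setT.
  exact: ltry.
rewrite mE Dbox//.
pose C i := rV_box (fun j => B (mxvec_index i j)).
have mC i : measurable (C i) by exact: measurable_rV_box.
have -> : f @^-1` rV_box B = \bigcap_(i in [set` [set: 'I_k]%SET]) (X i @^-1` C i).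
  apply/seteqP; split=> w /=.
    by move=> H i _ j /=; have := H (mxvec_index i j); rewrite mxvecE mxE.
  move=> H l; case/mxvec_indexP: l => i j; rewrite mxvecE mxE.
  by apply: (H i); rewrite /= inE.
apply: (eq_trans (indX [set: 'I_k]%SET C mC)).
have [g [gK Kg]] := vec_index k d.
rewrite [RHS](reindex (uncurry (@mxvec_index k d)))/=; last by exists g => x _.
rewrite [RHS](eq_bigr (fun p => \int[mu]_(t in B (mxvec_index p.1 p.2)) (phi t)%:E)%E); last by case.
rewrite -(pair_bigA _ (fun i j => \int[mu]_(t in B (mxvec_index i j)) (phi t)%:E)%E)/=.
apply: eq_big => [i|i _]; first by rewrite inE.
have [D' [D'box D'E _]] := @gauss_measure_exists R d.
rewrite -D'box// D'E; last exact: measurable_rV_box.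
exact: nX.
Qed.

Lemma mutually_independent_comp disp (Omega : measurableType disp) (P : probability Omega R)
    d' (T' : measurableType d') (I J : finType) (X : I -> {RV P >-> T'}) (e : J -> I) :
  injective e -> mutually_independent X -> mutually_independent (X \o e).
Proof.
move=> ie indX K B mB.
(* The events are transported along [e]; indices outside its image get the sure event. *)
pose B' i := if [pick j | e j == i] is Some j then B j else setT.
have B'E j : B' (e j) = B j.
  rewrite /B'; case: pickP => [j' /eqP/ie ->//|/(_ j)]; by rewrite eqxx.
have mB' i : measurable (B' i).
  by rewrite /B'; case: pickP.
have := indX (e @: K) B' mB'.
rewrite big_imset/=; last by move=> ? ? _ _; exact: ie.
under [in RHS]eq_bigr do rewrite B'E.
move=> <-; congr (P _); apply/seteqP; split=> w /=.
  by move=> H i /imsetP[j jK ->]; rewrite B'E; exact: H.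
move=> H j jK; have := H (e j); rewrite /= B'E; apply.
by rewrite /= imset_f.
Qed.

End gauss_matrix.

Section measurable_matrix.
Context d (T : measurableType d) {R : realType}.

Lemma measurable_det n (f : T -> 'M[R]_n) :
  (forall i j, measurable_fun setT (fun x => f x i j)) ->
  measurable_fun setT (fun x => \det (f x)).
Proof.
move=> mf; apply: measurable_sum => s; apply: measurable_funM => //.
by apply: measurable_prod => i _; exact: mf.
Qed.

Lemma measurable_adj n (f : T -> 'M[R]_n) :
  (forall i j, measurable_fun setT (fun x => f x i j)) ->
  forall i j, measurable_fun setT (fun x => (\adj (f x)) i j).
Proof.
move=> mf i j; under eq_fun do rewrite mxE.
apply: measurable_funM => //; apply: measurable_det => k l.
by under eq_fun do rewrite !mxE; exact: mf.
Qed.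

Lemma measurable_mulmx m n p (f : T -> 'M[R]_(m, n)) (g : T -> 'M[R]_(n, p)) :
  (forall i j, measurable_fun setT (fun x => f x i j)) ->
  (forall i j, measurable_fun setT (fun x => g x i j)) ->
  forall i j, measurable_fun setT (fun x => (f x *m g x) i j).
Proof.
move=> mf mg i j; under eq_fun do rewrite mxE.
by apply: measurable_sum => k; apply: measurable_funM; [exact: mf|exact: mg].
Qed.

End measurable_matrix.

Lemma measurable_vec_mx (R : realType) n d (i : 'I_n) (j : 'I_d) :
  measurable_fun setT (fun x : 'rV[R]_(n * d) => vec_mx x i j).
Proof. by under eq_fun do rewrite mxE; exact: measurable_coord. Qed.

(** The inverse is continuous away from 0, and on the singleton 0 it is constant by the convention
    0^-1 = 0. *)
Lemma measurable_inv_real (R : realType) : measurable_fun setT (@GRing.inv R).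
Proof.
have [N [mN N1]] : exists N : set R, measurable N /\ N = [set~ 0].
  by exists [set~ 0]; split=> //; apply: measurableC; exact: measurable_set1.
rewrite -(setUv N); apply/measurable_funU => //; first exact: measurableC.
split.
  apply: open_continuous_measurable_fun.
    by rewrite N1; apply: closed_openC; exact: closed_eq.
  by move=> x; rewrite inE N1 => /eqP x0; exact: inv_continuous.
have -> : ~` N = [set 0] by rewrite N1 setCK.
apply: (eq_measurable_fun (cst (0 : R))) => // x.
by rewrite inE /= => ->; rewrite invr0.
Qed.

Lemma measurable_funV d (T : measurableType d) (R : realType) (f : T -> R) :
  measurable_fun setT f -> measurable_fun setT (fun x => (f x)^-1).
Proof. by move=> mf; exact: (measurableT_comp (@measurable_inv_real R) mf). Qed.

(** * Null sets *)

Section null_sets.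
Context {R : realType}.
Local Notation mu := (@lebesgue_measure R).

(** The indicator of x + t u in S is integrated over all (t, x). With x inside, translation
    invariance yields the measure of S times the infinite length of the line; with t inside, the
    result is 0. Hence S is null. *)
Lemma lebesgue_rV_null n (S : set 'rV[R]_n) (u : 'rV[R]_n) : measurable S ->
  (forall x, mu [set t | S (x + t *: u)] = 0%E) -> lebesgue_rV n S = 0%E.
Proof.
move=> mS Su.
pose F (p : R * 'rV[R]_n) : \bar R := (\1_S (p.2 + p.1 *: u))%:E.
have mf : measurable_fun setT (fun p : R * 'rV[R]_n => p.2 + p.1 *: u).
  apply: measurable_fun_addmx; first exact: measurable_snd.
  apply/measurable_fun_rVP => i; under eq_fun do rewrite mxE.
  by apply: measurable_funM => //; exact: measurable_fst.
have mF : measurable_fun setT F.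
  by apply/measurable_EFinP; apply: measurableT_comp mf; exact: measurable_indic.
have F0 p : (0 <= F p)%E by rewrite lee_fin.
have m1S : measurable_fun setT (fun x => (\1_S x)%:E : \bar R).
  by apply/measurable_EFinP; exact: measurable_indic.
have E1 : (\int[mu]_t \int[lebesgue_rV n]_x F (t, x) = \int[mu]_t lebesgue_rV n S)%E.
  apply: eq_integral => t _; rewrite /F /=.
  rewrite (ge0_integral_rV_translate (t *: u) m1S); last by move=> x; rewrite lee_fin.
  by rewrite integral_indic// setIT.
have E2 : (\int[lebesgue_rV n]_x \int[mu]_t F (t, x) = 0)%E.
  apply: integral0_eq => x _; rewrite /F /=.
  rewrite -[RHS](Su x) -[in RHS](setIT [set t | _]) -integral_indic//.
  rewrite -[X in measurable X]setTI.
  have := measurableT_comp mf (measurable_pair2 x).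
  by apply.
have := @fubini_tonelli _ _ _ _ R mu (lebesgue_rV n) F mF F0.
rewrite E1 E2 integral_cst//= => /eqP.
rewrite mule_eq0 => /orP[/eqP//|/eqP].
have -> : mu [set: R] = +oo%E by rewrite -set_itvNyy lebesgue_measure_itv.
by [].
Qed.

Lemma finite_roots (p : {poly R}) : p != 0 -> finite_set [set t | root p t].
Proof.
have [n] := ubnP (size p); elim: n p => // n IH p pn p0.
have [[a pa]|np] := pselect (exists a, root p a); last first.
  rewrite (_ : [set t | _] = set0)//; apply/seteqP; split=> // t pt.
  by case: np; exists t.
have [q pE] := factor_theorem _ _ pa.
have q0 : q != 0 by apply: contraNneq p0 => q0; rewrite pE q0 mul0r.
apply: (@sub_finite_set _ _ ([set t | root q t] `|` [set a])).
  by move=> t /=; rewrite pE rootM root_XsubC => /orP[|/eqP]; [left|right].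
rewrite finite_setU; split; last exact: finite_set1.
by apply: IH => //; move: pn; rewrite pE size_Mmonic ?monicXsubC// size_XsubC addn2 ltnS.
Qed.

(* A line in the direction of the identity meets the singular matrices in the
   roots of a characteristic polynomial. *)
Lemma det_line_finite n (A : 'M[R]_n.+1) :
  finite_set [set t : R | \det (A + t%:M) = 0].
Proof.
have cp0 : char_poly (- A) != 0 by rewrite monic_neq0 ?char_poly_monic.
apply: (@sub_finite_set _ _ [set t | root (char_poly (- A)) t]); last exact: finite_roots.
move=> t /= d0; rewrite -eigenvalue_root_char /eigenvalue /eigenspace kermx_eq0 row_free_unit.
by rewrite unitmxE -opprD -scaleN1r detZ d0 mulr0 unitr0.
Qed.

Lemma finite_set_null (S : set R) : finite_set S -> mu S = 0%E.
Proof. by move=> /finite_set_countable; exact: countable_lebesgue_measure0. Qed.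

Lemma det_null n : lebesgue_rV (n.+1 * n.+1)
  [set x : 'rV[R]_(n.+1 * n.+1) | \det (vec_mx x : 'M[R]_n.+1) = 0] = 0%E.
Proof.
apply: (@lebesgue_rV_null _ _ (mxvec 1%:M)).
  have := @measurable_det _ 'rV[R]_(n.+1 * n.+1) R n.+1 _ (@measurable_vec_mx R n.+1 n.+1).
  move=> /(_ measurableT [set 0] (measurable_set1 _)); rewrite setTI.
  by [].
move=> x; apply: finite_set_null.
apply: sub_finite_set (det_line_finite (vec_mx x)) => t /=.
by rewrite linearD /= linearZ /= mxvecK scalemx1.
Qed.

End null_sets.

(** * Absolute determinants of Gaussian matrices *)

Section gaussian_determinant.
Context {R : realType}.
Local Notation mu := (@lebesgue_measure R).
Local Notation G := (@std_normal_density R _).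

(** The generalised cross product of the rows of [B]. The zero row is a placeholder: cofactors along
    the first row do not depend on it. *)
Definition cross b (B : 'M[R]_(b, b.+1)) : 'rV[R]_b.+1 :=
  \row_j cofactor (col_mx 0 B : 'M[R]_(1 + b)) ord0 j.

Lemma cofactor_col_mx b (x : 'rV[R]_b.+1) (B : 'M[R]_(b, b.+1)) j :
  cofactor (col_mx x B : 'M[R]_(1 + b)) ord0 j = cross B ord0 j.
Proof.
rewrite mxE /cofactor; congr (_ * \det _); apply/matrixP => i k; rewrite !mxE.
have rE : lift ord0 i = rshift 1 i :> 'I_(1 + b) by exact/val_inj.
by rewrite rE (unsplitK (inr i : 'I_1 + 'I_b)).
Qed.

Lemma det_col_mx b (x : 'rV[R]_b.+1) (B : 'M[R]_(b, b.+1)) :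
  \det (col_mx x B : 'M[R]_(1 + b)) = (x *m (cross B)^T) ord0 ord0.
Proof.
rewrite (expand_det_row _ ord0) mxE; apply: eq_bigr => j _.
rewrite cofactor_col_mx; congr (_ * _); last by rewrite [RHS]mxE.
have lE : lshift b (ord0 : 'I_1) = ord0 by exact/val_inj.
by rewrite -[X in col_mx x B X]lE (@col_mxEu _ 1 b).
Qed.

Lemma measurable_cross d (T : measurableType d) b (f : T -> 'M[R]_(b, b.+1)) :
  (forall i j, measurable_fun setT (fun x => f x i j)) ->
  measurable_fun setT (fun x => cross (f x)).
Proof.
move=> mf; apply/measurable_fun_rVP => j; under eq_fun do rewrite mxE.
apply: measurable_funM => //; apply: measurable_det => i k.
have rE : lift ord0 i = rshift 1 i :> 'I_(1 + b) by exact/val_inj.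
by under eq_fun do rewrite !mxE rE (unsplitK (inr i : 'I_1 + 'I_b)); exact: mf.
Qed.

(** The b-dimensional volume of the parallelepiped spanned by the rows of [B]. *)
Definition vol_cross b (B : 'M[R]_(b, b.+1)) := Num.sqrt (sqn (cross B)).

Lemma measurable_sqrt : measurable_fun setT (@Num.sqrt R).
Proof. by apply: continuous_measurable_fun; exact: sqrt_continuous. Qed.

Lemma measurable_vol_cross d (T : measurableType d) b (f : T -> 'M[R]_(b, b.+1)) :
  (forall i j, measurable_fun setT (fun x => f x i j)) ->
  measurable_fun setT (fun x => vol_cross (f x)).
Proof.
move=> mf; apply: (measurableT_comp measurable_sqrt).
by apply: (measurableT_comp (@measurable_sqn R _)); exact: measurable_cross.
Qed.

Lemma measurable_profile (g : R -> R) (c : R) : measurable_fun setT g ->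
  measurable_fun setT (fun t : R => (`|t| * g (`|t| / c))%:E).
Proof.
move=> mg; have mabs : measurable_fun setT (fun x : R => `|x|) by exact: normr_measurable.
apply/measurable_EFinP; apply: measurable_funM => //.
by apply: measurableT_comp => //; apply: measurable_funM.
Qed.

(** For a standard normal N this is E (|N| g(|N|)). In the application N is det A / vol B, and the
    weight |N| is what remains of |det A| once vol B is factored out. *)
Definition profile (g : R -> R) : \bar R :=
  (\int[mu]_t ((phi t)%:E * (`|t| * g `|t|)%:E))%E.

Lemma profile_ge0 (g : R -> R) : (forall x, 0 <= g x) -> (0 <= profile g)%E.
Proof.
by move=> g0; apply: integral_ge0 => t _; rewrite mule_ge0// lee_fin ?phi_ge0// mulr_ge0.
Qed.

Lemma gint_det_profile b (g : R -> R) (B : 'M[R]_(b, b.+1)) :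
  measurable_fun setT g -> (forall x, 0 <= g x) ->
  (gint (fun x : 'rV[R]_b.+1 => (`|\det (col_mx x B : 'M[R]_(1 + b))| *
      g (`|\det (col_mx x B : 'M[R]_(1 + b))| / vol_cross B))%:E) =
   profile g * (vol_cross B)%:E)%E.
Proof.
move=> mg g0; pose r := vol_cross B.
transitivity (gint (fun x : 'rV[R]_b.+1 =>
    ((fun t => (`|t| * g (`|t| / r))%:E) ((x *m (cross B)^T) ord0 ord0)))).
  by apply: eq_gint => x; rewrite det_col_mx.
rewrite (gint_linear _ (measurable_profile r mg)); last by move=> t; rewrite lee_fin mulr_ge0.
rewrite -/(vol_cross B) -/r muleC -ge0_integralZl//; last 3 first.
- apply: emeasurable_funM; first by apply/measurable_EFinP; exact: measurable_phi.
  have mabs : measurable_fun setT (fun x : R => `|x|) by exact: normr_measurable.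
  by apply/measurable_EFinP; apply: measurable_funM => //; exact: measurableT_comp.
- by move=> t _; rewrite mule_ge0// lee_fin ?phi_ge0// mulr_ge0.
- by rewrite lee_fin sqrtr_ge0.
apply: eq_integral => t _; rewrite [RHS]muleCA; congr (_ * _)%E.
rewrite -EFinM; congr (_%:E).
(* When [r] is 0 the quotient takes its default value, but both sides carry a factor 0. *)
have [r0|r0] := eqVneq r 0; first by rewrite r0 !mul0r normr0 mul0r.
rewrite normrM (ger0_norm (sqrtr_ge0 _ : 0 <= r)) mulrA; congr (_ * g _).
by rewrite mulrAC divff// mul1r.
Qed.

Lemma mx_measurable_vol_cross b :
  mx_measurable (fun B : 'M[R]_(b, b.+1) => (vol_cross B)%:E).
Proof.
apply/measurable_EFinP; apply: measurable_vol_cross => i j.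
exact: measurable_vec_mx.
Qed.

Lemma measurable_absdet n :
  measurable_fun setT (fun x : 'rV[R]_(n * n) => `|\det (vec_mx x : 'M[R]_n)|).
Proof.
apply: measurableT_comp => //.
exact: (@measurable_det _ 'rV[R]_(n * n) R _ _ (@measurable_vec_mx R n n)).
Qed.

(* Given the rows of [B], the determinant is the inner product of a standard
   normal vector with [cross B]. *)
Lemma gmx_det_profile b (g : R -> R) : measurable_fun setT g -> (forall x, 0 <= g x) ->
  (gmx (fun A : 'M[R]_(1 + b) => (`|\det A| * g (`|\det A| / vol_cross (dsubmx A)))%:E) =
   profile g * gmx (fun B : 'M[R]_(b, b.+1) => (vol_cross B)%:E))%E.
Proof.
move=> mg g0; rewrite gmx_row_mx; last 2 first.
- apply/measurable_EFinP.
  apply: measurable_funM; first exact: measurable_absdet.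
  apply: (measurableT_comp mg); apply: measurable_funM; first exact: measurable_absdet.
  apply: measurable_funV.
  apply: measurable_vol_cross => i j; under eq_fun do rewrite !mxE.
  exact: measurable_coord.
- by move=> A; rewrite lee_fin mulr_ge0.
transitivity (gmx (fun B : 'M[R]_(b, b.+1) => profile g * (vol_cross B)%:E)%E).
  apply: eq_gmx => B; rewrite -(gint_det_profile B mg g0).
  by apply: eq_gint => x; rewrite (@col_mxKd _ 1 b).
rewrite /gmx /gint -ge0_integralZl//; last 3 first.
- by apply: measurable_gint_fun; exact: mx_measurable_vol_cross.
- by move=> x _; rewrite mule_ge0// lee_fin ?std_normal_density_ge0// sqrtr_ge0.
- exact: profile_ge0.
by apply: eq_integral => x _; rewrite muleCA.
Qed.

Lemma gmxZl n d (k : R) (F : 'M[R]_(n, d) -> \bar R) : 0 <= k -> mx_measurable F ->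
  (forall x, 0 <= F x)%E -> (gmx (fun x => k%:E * F x) = k%:E * gmx F)%E.
Proof. by move=> k0 mF F0; rewrite /gmx -gintZl. Qed.

(** Kept in the extended reals: finiteness comes with [moment_mom], after the recursion has been
    established. *)
Definition moment p : \bar R :=
  (\int[mu]_t (\1_`]0%R, +oo[ t * t ^+ p * expR (- t ^+ 2 / 2))%:E)%E.

(** The extra factor turns the density into G(k x). Substituting k x for x costs k ^ (b + 1) from
    the Jacobian and one more k from the determinant, which is linear in x. *)
Lemma gint_det_scale b (B : 'M[R]_(b, b.+1)) (s : R) : 0 <= s ->
  let k := Num.sqrt (1 + s) in
  (gint (fun x : 'rV[R]_b.+1 => (`|\det (col_mx x B : 'M[R]_(1 + b))| * expR (- (s * sqn x) / 2))%:E) =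
   (k ^- b.+2)%:E * gint (fun x : 'rV[R]_b.+1 => (`|\det (col_mx x B : 'M[R]_(1 + b))|)%:E))%E.
Proof.
move=> s0 k.
have k0 : 0 < k by rewrite sqrtr_gt0 ltr_pwDl.
have kk : k ^+ 2 = 1 + s by rewrite sqr_sqrtr// addr_ge0.
have mdet : measurable_fun setT (fun x : 'rV[R]_b.+1 => `|\det (col_mx x B : 'M[R]_(1 + b))|).
  under eq_fun do rewrite det_col_mx.
  apply: measurableT_comp => //.
  have := @measurable_fun_mx_sum R _ _ _ _ (fun x : 'rV[R]_b.+1 => x) (cross B)^T.
  by move=> H; apply: (measurableT_comp (measurable_coord ord0)); exact: H.
pose H (x : 'rV[R]_b.+1) : \bar R := ((G x)%:E * (`|\det (col_mx x B : 'M[R]_(1 + b))|)%:E)%E.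
have mH : measurable_fun setT H by apply: measurable_gint_fun; exact/measurable_EFinP.
have H0 x : (0 <= H x)%E by rewrite mule_ge0// lee_fin std_normal_density_ge0.
have uk : (k%:M : 'M[R]_b.+1) \in unitmx.
  by rewrite unitmxE det_scalar unitrX// unitfE gt_eqF.
rewrite /gint -[X in (_ * X)%E](lin_cov_unit uk mH H0) det_scalar muleA -EFinM.
rewrite ger0_norm ?exprn_ge0// ?ltW// [k ^- b.+2](_ : _ = k^-1 * k ^- b.+1); last first.
  by rewrite exprS invfM.
rewrite -mulrA mulVf ?expf_neq0 ?gt_eqF// mulr1 -ge0_integralZl_EFin//; last 2 first.
- apply: (measurableT_comp mH).
  have := @measurable_fun_mx_sum R _ _ _ _ (fun x : 'rV[R]_b.+1 => x) k%:M.
  by apply.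
- by rewrite invr_ge0 ltW.
apply: eq_integral => x _; rewrite /H -!EFinM; congr (_%:E).
have -> : \det (col_mx (x *m k%:M) B : 'M[R]_(1 + b)) = k * \det (col_mx x B : 'M[R]_(1 + b)).
  by rewrite !det_col_mx mul_mx_scalar -scalemxAl [LHS]mxE.
rewrite normrM (gtr0_norm k0) mul_mx_scalar.
have key : G x * expR (- (s * sqn x) / 2) = G (k *: x).
  rewrite /std_normal_density -!/(sqn _) sqnZ kk -mulrA -expRD; congr (_ * expR _).
  by field.
rewrite mulrCA key; set D := `|_|; set g := G _.
by field; rewrite gt_eqF.
Qed.

Lemma gint_absdet b (B : 'M[R]_(b, b.+1)) :
  (gint (fun x : 'rV[R]_b.+1 => (`|\det (col_mx x B : 'M[R]_(1 + b))|)%:E) =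
   profile (fun=> 1%R) * (vol_cross B)%:E)%E.
Proof. by rewrite -gint_det_profile//; apply: eq_gint => x; rewrite mulr1. Qed.

Lemma mx_measurable_gint_absdet b :
  mx_measurable (fun B : 'M[R]_(b, b.+1) =>
    gint (fun x : 'rV[R]_b.+1 => (`|\det (col_mx x B : 'M[R]_(1 + b))|)%:E)).
Proof.
rewrite /mx_measurable; under eq_fun do rewrite gint_absdet.
by apply: emeasurable_funM => //; exact: mx_measurable_vol_cross.
Qed.

Lemma orthogonal_absdet n (Q : 'M[R]_n) : Q^T *m Q = 1%:M -> `|\det Q| = 1.
Proof.
move=> QQ; have : `|\det Q| ^+ 2 = 1.
  by rewrite -normrX expr2 -{1}det_tr -det_mulmx QQ det1 normr1.
by move/eqP; rewrite sqrp_eq1// => /eqP.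
Qed.

(** After a reflection taking l to |l| e_0, G(l A) depends only on the first row of A. Conditioning
    on the other rows leaves [gint_det_scale] with s = |l| ^ 2. *)
Lemma gmx_det_gauss b (l : 'rV[R]_b.+1) :
  (gmx (fun A : 'M[R]_(1 + b) => (`|\det A|%:E * (G (l *m A))%:E)) =
   ((2 * pi) `^ (- (b.+1%:R / 2)) * Num.sqrt (1 + sqn l) ^- b.+2)%:E *
   gmx (fun A : 'M[R]_(1 + b) => `|\det A|%:E))%E.
Proof.
have [Q [QT QQ lQ]] := householder l.
have oQ : Q^T *m Q = 1%:M by rewrite QT.
set c := (2 * pi) `^ (- (b.+1%:R / 2)).
have c0 : 0 <= c by exact: powR_ge0.
have mG (a : R) : measurable_fun setT (fun x : 'rV[R]_b.+1 => G (a *: x)).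
  apply: (measurableT_comp (@measurable_std_normal_density R _)).
  apply/measurable_fun_rVP => i; under eq_fun do rewrite mxE.
  by apply: measurable_funM => //; exact: measurable_coord.
have mF : mx_measurable (fun A : 'M[R]_(1 + b) => (`|\det A|%:E * (G (l *m A))%:E)%E).
  apply: emeasurable_funM; apply/measurable_EFinP; first exact: measurable_absdet.
  apply: (measurableT_comp (@measurable_std_normal_density R _)).
  apply/measurable_fun_rVP => i; apply: measurable_mulmx => // j k.
  exact: measurable_vec_mx.
rewrite -(gmx_orthogonal oQ mF); last first.
  by move=> A; rewrite mule_ge0// lee_fin std_normal_density_ge0.
transitivity (gmx (fun A : 'M[R]_(1 + b) =>
    (`|\det A| * (c * expR (- (sqn l * sqn (row ord0 A)) / 2)))%:E)).
  apply: eq_gmx => A; rewrite -EFinM; congr (_%:E).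
  rewrite det_mulmx normrM (orthogonal_absdet oQ) mul1r; congr (_ * _).
  rewrite mulmxA lQ -scalemxAl -rowE /std_normal_density -!/(sqn _) sqnZ.
  by rewrite sqr_sqrtr ?sqn_ge0.
rewrite gmx_row_mx; last 2 first.
- apply/measurable_EFinP; apply: measurable_funM; first exact: measurable_absdet.
  apply: measurable_funM => //; apply: measurableT_comp => //.
  apply: measurable_funM => //; apply: measurableT_comp => //.
  apply: measurable_funM => //.
  apply: (measurableT_comp (@measurable_sqn R _)).
  apply/measurable_fun_rVP => i; under eq_fun do rewrite mxE.
  exact: measurable_vec_mx.
- by move=> A; rewrite lee_fin mulr_ge0// mulr_ge0// expR_ge0.
rewrite [X in (_ * X)%E]gmx_row_mx; last 2 first.
- by apply/measurable_EFinP; exact: measurable_absdet.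
- by move=> A; rewrite lee_fin.
rewrite -gmxZl; last 3 first.
- by rewrite mulr_ge0// invr_ge0 exprn_ge0// sqrtr_ge0.
- exact: mx_measurable_gint_absdet.
- by move=> B; apply: gint_ge0 => x; rewrite lee_fin.
apply: eq_gmx => B; rewrite EFinM -muleA -gint_det_scale ?sqn_ge0//.
apply/esym; apply: (eq_trans (esym (gintZl c0 _ _))).
  apply/measurable_EFinP; apply: measurable_funM.
    under eq_fun do rewrite det_col_mx.
    apply: measurableT_comp => //.
    have := @measurable_fun_mx_sum R _ _ _ _ (fun x : 'rV[R]_b.+1 => x) (cross B)^T.
    by move=> H; apply: (measurableT_comp (measurable_coord ord0)); exact: H.
  apply: measurableT_comp => //.
  apply: measurable_funM => //; apply: measurableT_comp => //.
  by apply: measurable_funM => //; exact: measurable_sqn.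
  by move=> x; rewrite lee_fin mulr_ge0// expR_ge0.
apply/esym; apply: eq_gint => x; rewrite -EFinM; congr (_%:E).
rewrite mulrCA; congr (_ * (_ * expR (- (_ * sqn _) / 2))).
have lE : lshift b (ord0 : 'I_1) = ord0 by exact/val_inj.
by apply/rowP => j; rewrite mxE -[X in col_mx x B X]lE (@col_mxEu _ 1 b).
Qed.

End gaussian_determinant.

Section expected_determinant.
Context {R : realType}.
Local Notation mu := (@lebesgue_measure R).
Local Notation G := (@std_normal_density R _).

Lemma integral_density n : (\int[lebesgue_rV n]_x (G x)%:E = 1)%E.
Proof. by rewrite -(@gint1 R n); apply: eq_integral => x _; rewrite mule1. Qed.

Lemma integral_density_mulmx n (A : 'M[R]_n) : \det A != 0 ->
  (`|\det A|%:E * \int[lebesgue_rV n]_l (G (l *m A))%:E = 1)%E.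
Proof.
move=> dA; have uA : A \in unitmx by rewrite unitmxE unitfE.
rewrite -(integral_density n); apply: (lin_cov_unit uA).
  by apply/measurable_EFinP; exact: measurable_std_normal_density.
by move=> x; rewrite lee_fin std_normal_density_ge0.
Qed.

Lemma measurable_density_mulmx d (T : measurableType d) p n (f : T -> 'rV[R]_p) (g : T -> 'M[R]_(p, n)) :
  (forall j, measurable_fun setT (fun x => f x ord0 j)) ->
  (forall i j, measurable_fun setT (fun x => g x i j)) ->
  measurable_fun setT (fun x => G (f x *m g x)).
Proof.
move=> mf mg; apply: (measurableT_comp (@measurable_std_normal_density R _)).
apply/measurable_fun_rVP => i; apply: measurable_mulmx => // j k.
by rewrite ord1.
Qed.

(** After exchanging the integrals, the inner one over l equals 1 for every invertible A, and
    singular matrices form a null set. *)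
Lemma integral_gmx_det_gauss b :
  (\int[lebesgue_rV b.+1]_l gmx (fun A : 'M[R]_b.+1 => `|\det A|%:E * (G (l *m A))%:E) = 1)%E.
Proof.
pose f (p : 'rV[R]_(b.+1 * b.+1) * 'rV[R]_b.+1) : \bar R :=
  (G p.1 * (`|\det (vec_mx p.1 : 'M[R]_b.+1)| * G (p.2 *m vec_mx p.1)))%:E.
have mf : measurable_fun setT f.
  apply/measurable_EFinP; apply: measurable_funM.
    apply: (measurableT_comp (@measurable_std_normal_density R _)); exact: measurable_fst.
  apply: measurable_funM.
    exact: (measurableT_comp (@measurable_absdet R _) measurable_fst).
  apply: measurable_density_mulmx => [j|i j].
    exact: (measurableT_comp (measurable_coord j) measurable_snd).
  exact: (measurableT_comp (@measurable_vec_mx R _ _ i j) measurable_fst).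
have f0 p : (0 <= f p)%E.
  by rewrite lee_fin mulr_ge0 ?std_normal_density_ge0// mulr_ge0// std_normal_density_ge0.
transitivity (\int[lebesgue_rV b.+1]_l \int[lebesgue_rV (b.+1 * b.+1)]_x f (x, l))%E.
  by apply: eq_integral => l _; apply: eq_integral => x _.
rewrite -(@fubini_tonelli _ _ _ _ R (lebesgue_rV _) (lebesgue_rV b.+1) f mf f0).
rewrite -(integral_density (b.+1 * b.+1)).
apply: ge0_ae_eq_integral => //.
- exact: (@measurable_fun_fubini_tonelli_F _ _ _ _ R (lebesgue_rV b.+1) f mf f0).
- by apply/measurable_EFinP; exact: measurable_std_normal_density.
- by move=> x _; exact: integral_ge0.
- by move=> x _; rewrite lee_fin std_normal_density_ge0.
exists [set x : 'rV[R]_(b.+1 * b.+1) | \det (vec_mx x : 'M[R]_b.+1) = 0]; split.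
- have := @measurable_det _ 'rV[R]_(b.+1 * b.+1) R b.+1 _ (@measurable_vec_mx R b.+1 b.+1).
  by move=> /(_ measurableT [set 0] (measurable_set1 _)); rewrite setTI.
- exact: det_null.
move=> x /=; apply: contra_notP => dx _.
have dx0 : \det (vec_mx x : 'M[R]_b.+1) != 0 by exact/eqP.
rewrite -[RHS]mule1 -(integral_density_mulmx dx0).
have mGx : measurable_fun setT (fun l : 'rV[R]_b.+1 => (G (l *m vec_mx x))%:E).
  apply/measurable_EFinP; apply: measurable_density_mulmx => [j|//].
  exact: measurable_coord.
rewrite -ge0_integralZl_EFin//; last first.
  by move=> l _; rewrite lee_fin std_normal_density_ge0.
rewrite -ge0_integralZl_EFin//; last 3 first.
- by move=> l _; rewrite -EFinM lee_fin mulr_ge0// std_normal_density_ge0.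
- exact: measurable_funeM.
- exact: std_normal_density_ge0.
Qed.

Definition moment_fun (p : nat) (t : R) : R :=
  \1_`]0, +oo[ t * t ^+ p * expR (- t ^+ 2 / 2).

Lemma moment_fun_ge0 p t : 0 <= moment_fun p t.
Proof.
rewrite /moment_fun indicE; case: (boolP (t \in _)) => [|_]; last by rewrite !mul0r.
by rewrite inE /= in_itv /= andbT => t0; rewrite mul1r mulr_ge0 ?expR_ge0// exprn_ge0// ltW.
Qed.

Lemma measurable_moment_fun p : measurable_fun setT (moment_fun p).
Proof.
apply: measurable_funM; first apply: measurable_funM => //.
apply: measurableT_comp => //; apply: measurable_funM => //.
by apply: measurableT_comp => //; exact: measurable_funX.
Qed.

Lemma moment_scale p (k : R) : 0 < k ->
  ((k ^+ p.+1)%:E * \int[mu]_t (\1_`]0%R, +oo[ t * t ^+ p * expR (- (k * t) ^+ 2 / 2))%:E = @moment R p)%E.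
Proof.
move=> k0.
have mh : measurable_fun setT (fun t => (moment_fun p t)%:E).
  by apply/measurable_EFinP; exact: measurable_moment_fun.
have h0 t : (0 <= (moment_fun p t)%:E)%E by rewrite lee_fin moment_fun_ge0.
have kn0 : k != 0 by rewrite gt_eqF.
transitivity (\int[mu]_t (moment_fun p t)%:E)%E; last by [].
apply: (eq_trans _ (ge0_integral_affine 0 kn0 mh h0)).
rewrite gtr0_norm// exprS EFinM -muleA; apply: (congr1 (mule _)).
rewrite -ge0_integralZl_EFin//; last 3 first.
- move=> t _; rewrite lee_fin indicE; case: (boolP (t \in _)) => [|_]; last by rewrite !mul0r.
  by rewrite inE /= in_itv /= andbT => t0; rewrite mul1r mulr_ge0 ?expR_ge0// exprn_ge0// ltW.
- apply/measurable_EFinP; apply: measurable_funM; first apply: measurable_funM => //.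
  apply: measurableT_comp => //; apply: measurable_funM => //.
  by apply: measurableT_comp => //; apply: measurable_funX; exact: measurable_funM.
- by rewrite exprn_ge0// ltW.
apply: eq_integral => t _; rewrite -EFinM; congr (_%:E).
rewrite /moment_fun addr0 [(k * t) ^+ p]exprMn !mulrA; congr (_ * _ * _).
rewrite mulrC; congr (_ * _).
by rewrite !indicE; congr (nat_of_bool _)%:R; apply/idP/idP; rewrite !inE /= !in_itv /= !andbT pmulr_rgt0.
Qed.

(* Both evaluations of the double integral of [|det A| * G (l *m A)]: over [l]
   first it is [1], over [A] first it is given by [gmx_det_gauss]. *)
Lemma absdet_moment b :
  (@moment R b.+1 = gmx (fun A : 'M[R]_(1 + b) => `|\det A|%:E) * @moment R 0)%E.
Proof.
set D := gmx _.
have D0 : (0 <= D)%E by apply: gint_ge0 => x; rewrite lee_fin.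
(* Over t, [f (l, t)] integrates to [moment b.+1] times the factor of [gmx_det_gauss]. Over l, G(t
   l) integrates to t ^ (- (b + 1)), which cancels the power of t and leaves the integrand of
   [moment 0]. *)
pose f (p : 'rV[R]_b.+1 * R) : \bar R := (moment_fun b.+1 p.2 * G (p.2 *: p.1))%:E.
have mf : measurable_fun setT f.
  apply/measurable_EFinP; apply: measurable_funM.
    exact: (measurableT_comp (measurable_moment_fun _) measurable_snd).
  apply: (measurableT_comp (@measurable_std_normal_density R _)).
  apply/measurable_fun_rVP => i; under eq_fun do rewrite mxE.
  apply: measurable_funM; first exact: measurable_snd.
  exact: (measurableT_comp (measurable_coord i) measurable_fst).
have f0 p : (0 <= f p)%E.
  by rewrite lee_fin mulr_ge0 ?moment_fun_ge0// std_normal_density_ge0.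
have mfF := @measurable_fun_fubini_tonelli_F _ _ _ _ R mu f mf f0.
transitivity (\int[lebesgue_rV b.+1]_l (D * \int[mu]_t f (l, t)))%E; last first.
  rewrite ge0_integralZl//; last by move=> l _; exact: integral_ge0.
  apply: (congr1 (mule _)).
  rewrite (@fubini_tonelli _ _ _ _ R (lebesgue_rV _) mu f mf f0).
  apply: eq_integral => t _; rewrite /f /=.
  have mGt : measurable_fun setT (fun l : 'rV[R]_b.+1 => (G (t *: l))%:E).
    apply/measurable_EFinP; apply: (measurableT_comp (@measurable_std_normal_density R _)).
    apply/measurable_fun_rVP => i; under eq_fun do rewrite mxE.
    by apply: measurable_funM => //; exact: measurable_coord.
  transitivity ((moment_fun b.+1 t)%:E * \int[lebesgue_rV b.+1]_l (G (t *: l))%:E)%E.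
    rewrite -ge0_integralZl_EFin//; last exact: moment_fun_ge0.
    by move=> l _; rewrite lee_fin std_normal_density_ge0.
  rewrite /moment_fun indicE; case: (boolP (t \in _)) => [|_]; last by rewrite !mul0r mul0e.
  rewrite inE /= in_itv /= andbT => t0.
  have dt : \det (t%:M : 'M[R]_b.+1) != 0 by rewrite det_scalar expf_neq0// gt_eqF.
  have := integral_density_mulmx dt; rewrite det_scalar ger0_norm ?exprn_ge0 ?ltW// => E.
  rewrite !mul1r EFinM muleAC -[RHS]mul1e; congr (_ * _)%E; rewrite -E.
  by apply: (congr1 (mule _)); apply: eq_integral => l _; rewrite mul_mx_scalar.
have mgmx : measurable_fun setT (fun l : 'rV[R]_b.+1 =>
    gmx (fun A : 'M[R]_(1 + b) => `|\det A|%:E * (G (l *m A))%:E)%E).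
  under eq_fun do rewrite gmx_det_gauss.
  apply: emeasurable_funM => //; apply/measurable_EFinP; apply: measurable_funM => //.
  apply: measurable_funV; apply: measurable_funX.
  apply: (measurableT_comp (@measurable_sqrt R)); apply: measurable_funD => //.
  exact: measurable_sqn.
(* The inserted factor 1 is next replaced by the double integral that evaluates to it. *)
apply: (eq_trans (esym (mul1e _))).
apply: (eq_trans (congr1 (fun z => z * _)%E (esym (@integral_gmx_det_gauss b)))).
have g0 l : setT l -> (0 <= gmx (fun A : 'M[R]_(1 + b) => `|\det A|%:E * (G (l *m A))%:E))%E.
  by move=> _; apply: gint_ge0 => x; rewrite mule_ge0// lee_fin std_normal_density_ge0.
have M0 : (0 <= @moment R b.+1)%E.
  by apply: integral_ge0 => t _; rewrite lee_fin moment_fun_ge0.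
apply: (eq_trans (esym (ge0_integralZr _ measurableT mgmx g0 M0))).
apply: eq_integral => l _; rewrite gmx_det_gauss -/D muleAC [RHS]muleC; congr (_ * _)%E.
set k := Num.sqrt _; set c := _ `^ _.
have s0 := sqn_ge0 l.
have k0 : 0 < k by rewrite sqrtr_gt0 ltr_pwDl.
have kk : k ^+ 2 = 1 + sqn l by rewrite sqr_sqrtr// addr_ge0.
rewrite -(moment_scale b.+1 k0) muleA -EFinM -mulrA mulVf ?expf_neq0 ?gt_eqF// mulr1.
rewrite -ge0_integralZl_EFin//; last 3 first.
- move=> t _; rewrite lee_fin indicE; case: (boolP (t \in _)) => [|_]; last by rewrite !mul0r.
  by rewrite inE /= in_itv /= andbT => t0; rewrite mul1r mulr_ge0 ?expR_ge0// exprn_ge0// ltW.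
- apply/measurable_EFinP; apply: measurable_funM; first apply: measurable_funM => //.
  apply: measurableT_comp => //; apply: measurable_funM => //.
  by apply: measurableT_comp => //; apply: measurable_funX; exact: measurable_funM.
- exact: powR_ge0.
apply: eq_integral => t _; rewrite -EFinM /f /=; congr (_%:E).
rewrite /moment_fun /std_normal_density -!/(sqn _) sqnZ.
rewrite (_ : - (k * t) ^+ 2 / 2 = - t ^+ 2 / 2 + - (t ^+ 2 * sqn l) / 2).
  by rewrite expRD /c; ring.
by rewrite exprMn kk; field.
Qed.

End expected_determinant.

(** * One-dimensional integrals *)

Section half_line.
Context {R : realType}.
Local Notation mu := (@lebesgue_measure R).

Lemma is_derive_continuous (F f : R -> R) : (forall x : R, is_derive x 1 F (f x)) ->
  continuous F.
Proof. by move=> dF x; apply/differentiable_continuous/derivable1_diffP; have [] := dF x. Qed.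

Lemma is_derive_derive1 (F f : R -> R) : (forall x : R, is_derive x 1 F (f x)) ->
  derive1 F =1 f.
Proof. by move=> dF x; rewrite derive1E; apply: derive_val. Qed.

Lemma integral_derive (F f : R -> R) a b : (forall x : R, is_derive x 1 F (f x)) ->
  continuous f -> a <= b ->
  (\int[mu]_(x in `[a, b]) (f x)%:E = (F b - F a)%:E)%E.
Proof.
move=> dF cf; rewrite le_eqVlt => /predU1P[<-|ab].
  by rewrite set_itv1 integral_set1 subrr.
rewrite (@continuous_FTC2 _ f F)// ?EFinB//.
- exact: continuous_subspaceT.
- have cF := is_derive_continuous dF; split.
  + by move=> x _; have [] := dF x.
  + by apply: cvg_at_right_filter; exact: cF.
  + by apply: cvg_at_left_filter; exact: cF.
- by move=> x _; exact: is_derive_derive1.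
Qed.

Lemma integral_derive_y (F f : R -> R) (a l : R) : (forall x : R, is_derive x 1 F (f x)) ->
  continuous f -> (forall x, a <= x -> 0 <= f x) -> F x @[x --> +oo] --> l ->
  (\int[mu]_(x in `[a, +oo[) (f x)%:E = (l - F a)%:E)%E.
Proof.
move=> dF cf f0 Fl.
rewrite (@ge0_continuous_FTC2y _ f F a l)// ?EFinB//.
- exact: continuous_subspaceT.
- by apply: cvg_at_right_filter; have cF := is_derive_continuous dF; exact: cF.
- by move=> x _; exact: is_derive_derive1.
Qed.

(** Tonelli on the region 0 <= s, theta s <= t: [h] is the s-integral of [u] at fixed t, [k] the
    t-integral of [v] at fixed s. The identity as [theta] gives integration by parts; theta s = s ^
    2 / 2 replaces a substitution in the Gamma integral. *)
Lemma integral_swap_region (theta u v h k : R -> R) :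
  measurable_fun setT theta -> measurable_fun setT u -> measurable_fun setT v ->
  (forall s, 0 <= s -> 0 <= theta s) ->
  (forall t, 0 <= t -> 0 <= u t) -> (forall t, 0 <= t -> 0 <= v t) ->
  (forall t : R, (0 <= t)%R ->
    \int[mu]_(s in [set s | ((0 <= s) && (theta s <= t))%R]) (u s)%:E = (h t)%:E)%E ->
  (forall s : R, (0 <= s)%R -> \int[mu]_(t in `[theta s, +oo[) (v t)%:E = (k s)%:E)%E ->
  (\int[mu]_(t in `[0%R, +oo[) (h t * v t)%:E =
   \int[mu]_(s in `[0%R, +oo[) (u s * k s)%:E)%E.
Proof.
move=> mt mu_ mv t0 u0 v0 head tail.
pose f (p : R * R) : \bar R := (((0 <= p.2) && (theta p.2 <= p.1))%:R * (u p.2 * v p.1))%:E.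
have f0 p : (0 <= f p)%E.
  rewrite lee_fin; case: (boolP (_ && _)) => [/andP[s0 st]|_]; last by rewrite mul0r.
  by rewrite mul1r mulr_ge0 ?u0 ?v0//; apply: le_trans st; exact: t0.
have mb : measurable_fun setT (fun p : R * R => (0 <= p.2) && (theta p.2 <= p.1)).
  apply: measurable_and; first by apply: measurable_fun_ler => //; exact: measurable_snd.
  by apply: measurable_fun_ler; [exact: (measurableT_comp mt measurable_snd)|exact: measurable_fst].
have mf : measurable_fun setT f.
  apply/measurable_EFinP; apply: measurable_funM; last first.
    apply: measurable_funM; [exact: (measurableT_comp mu_ measurable_snd)|
      exact: (measurableT_comp mv measurable_fst)].
  exact: (@measurableT_comp _ _ _ _ _ _ (fun b : bool => b%:R : R)).
have inner1 (t : R) : 0 <= t -> (\int[mu]_s f (t, s) = (h t * v t)%:E)%E.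
  move=> t_ge0; rewrite EFinM -(head _ t_ge0) muleC.
  have mS : measurable [set s | (0 <= s) && (theta s <= t)].
    rewrite (_ : [set s | _] = (fun s : R => (0 <= s) && (theta s <= t)) @^-1` [set true])//.
    rewrite -[X in measurable X]setTI.
    exact: (measurableT_comp mb (measurable_pair1 t)).
  rewrite -ge0_integralZl_EFin//; last 3 first.
  - by move=> s /= /andP[s0 _]; rewrite lee_fin u0.
  - by apply: measurable_funTS; exact/measurable_EFinP.
  - exact: v0.
  rewrite [RHS]integral_mkcond; apply: eq_integral => s _; rewrite patchE /f /=.
  rewrite (_ : (s \in _) = ((0 <= s) && (theta s <= t))); last by apply/idP/idP; rewrite inE.
  by case: ifPn => _; rewrite ?mul1r ?mul0r ?mule0// mulrC EFinM.
have inner2 (s : R) : 0 <= s -> (\int[mu]_t f (t, s) = (u s * k s)%:E)%E.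
  move=> s0; rewrite EFinM -(tail _ s0) -ge0_integralZl_EFin//; last 3 first.
  - by move=> t /=; rewrite in_itv /= andbT => st; rewrite lee_fin v0//; apply: le_trans st; exact: t0.
  - by apply: measurable_funTS; exact/measurable_EFinP.
  - exact: u0.
  rewrite [RHS]integral_mkcond; apply: eq_integral => t _; rewrite patchE /f /= mem_setE in_itv /= andbT s0 /=.
  by case: ifPn => _; rewrite ?mul1r ?mul0r ?mule0// EFinM.
have E1 : (\int[mu]_t \int[mu]_s f (t, s) = \int[mu]_(t in `[0%R, +oo[) (h t * v t)%:E)%E.
  rewrite [RHS]integral_mkcond; apply: eq_integral => t _; rewrite patchE.
  rewrite mem_setE in_itv /= andbT; case: ifPn => [t_ge0|nt]; first exact: inner1.
  apply: integral0_eq => s _; rewrite /f /=; case: (boolP (_ && _)) => [/andP[s0 st]|_].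
    by rewrite (le_trans (t0 _ s0) st) in nt.
  by rewrite mul0r.
have E2 : (\int[mu]_s \int[mu]_t f (t, s) = \int[mu]_(s in `[0%R, +oo[) (u s * k s)%:E)%E.
  rewrite [RHS]integral_mkcond; apply: eq_integral => s _; rewrite patchE.
  rewrite mem_setE in_itv /= andbT; case: ifPn => [s0|ns]; first exact: inner2.
  by apply: integral0_eq => t _; rewrite /f /= (negPf ns) mul0r.
have E3 := @fubini_tonelli _ _ _ _ R mu mu f mf f0.
by rewrite -E2 -E3 E1.
Qed.

(* [U t = U 0 + \int_0^t u] turns both sides into integrals over [0 <= s <= t]. *)
Lemma ge0_integration_by_parts_y (U u V v : R -> R) :
  (forall x : R, is_derive x 1 U (u x)) -> continuous u ->
  (forall t, 0 <= t -> 0 <= u t) -> 0 <= U 0 ->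
  (forall x : R, is_derive x 1 V (- v x)) -> continuous v ->
  (forall t, 0 <= t -> 0 <= v t) -> V x @[x --> +oo] --> (0 : R) ->
  (\int[mu]_(t in `[0%R, +oo[) (U t * v t)%:E =
   (U 0 * V 0)%:E + \int[mu]_(t in `[0%R, +oo[) (u t * V t)%:E)%E.
Proof.
move=> dU cu u0 U0 dV cv v0 V0.
have mu_ : measurable_fun setT u by exact: continuous_measurable_fun.
have mv : measurable_fun setT v by exact: continuous_measurable_fun.
have tail (s : R) : 0 <= s -> (\int[mu]_(t in `[s, +oo[) (v t)%:E = (V s)%:E)%E.
  move=> s0; have dNV (x : R) : is_derive x 1 (- V) (v x).
    by rewrite -[v x]opprK; exact: is_deriveN.
  rewrite (integral_derive_y dNV (l := 0))//.
  - by rewrite sub0r opprK.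
  - by move=> x sx; apply: v0; exact: le_trans sx.
  - by rewrite -[X in _ --> X]oppr0; exact: cvgN.
have head (t : R) : 0 <= t -> (\int[mu]_(s in `[0%R, t]) (u s)%:E = (U t - U 0)%:E)%E.
  by move=> t0; exact: integral_derive.
have Ut (t : R) : 0 <= t -> U 0 <= U t.
  move=> t0; rewrite -subr_ge0 -lee_fin -head//; apply: integral_ge0 => s /=.
  by rewrite in_itv /= lee_fin => /andP[s0 _]; exact: u0.
rewrite -(@integral_swap_region (fun s => s) u v (fun t => U t - U 0) V)//.
rewrite EFinM -(tail 0 (lexx _)) -ge0_integralZl_EFin//; last 2 first.
- by move=> t /=; rewrite in_itv /= andbT lee_fin; exact: v0.
- by apply: measurable_funTS; exact/measurable_EFinP.
have mU : measurable_fun setT U.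
  by apply: continuous_measurable_fun; exact: is_derive_continuous dU.
rewrite -ge0_integralD//; last 4 first.
- by move=> t /=; rewrite in_itv /= andbT -EFinM lee_fin => t0; rewrite mulr_ge0 ?v0.
- by apply: measurable_funTS; apply/measurable_EFinP; exact: measurable_funM.
- by move=> t /=; rewrite in_itv /= andbT lee_fin => t0; rewrite mulr_ge0 ?v0// subr_ge0 Ut.
- by apply: measurable_funTS; apply/measurable_EFinP; apply: measurable_funM => //; exact: measurable_funB.
by apply: eq_integral => t _; rewrite -EFinM -EFinD -mulrDl addrC subrK.
Qed.

End half_line.

Section gaussian_line.
Context {R : realType}.
Local Notation mu := (@lebesgue_measure R).

Definition egauss (t : R) : R := expR (- t ^+ 2 / 2).

Definition phi0 : R := (2 * pi) `^ (- (1 / 2)).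

Lemma phi_egauss t : phi t = phi0 * egauss t. Proof. exact: phiE. Qed.

Lemma phi0_gt0 : 0 < phi0. Proof. by rewrite powR_gt0// mulr_gt0// pi_gt0. Qed.

Lemma is_derive_egauss (t : R) : is_derive t 1 egauss (- (t * egauss t)).
Proof.
have H : is_derive t 1 (fun x : R => (- 2^-1) *: x ^+ 2) (- t).
  by apply: is_derive_eq; rewrite /GRing.scale /=; field.
have -> : egauss = expR \o (fun x : R => (- 2^-1) *: x ^+ 2).
  by apply/funext => x; rewrite /egauss /=; congr expR; rewrite /GRing.scale /=; field.
apply: is_derive_eq; rewrite /GRing.scale /= /egauss.
by rewrite mulrC mulNr; congr (- (_ * expR _)); field.
Qed.

Lemma continuous_egauss : continuous egauss.
Proof. exact: is_derive_continuous is_derive_egauss. Qed.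

Lemma cvg_egauss : egauss x @[x --> +oo] --> (0 : R).
Proof.
apply: (@squeeze_cvgr _ _ _ _ (cst 0) (fun x : R => expR (- x))).
- near=> x; rewrite expR_ge0/= ler_expR.
  (* From 2 on, x <= x ^ 2 / 2. *)
  have x2 : 2 <= x by near: x; exact: nbhs_pinfty_ge.
  by nra.
- exact: cvg_cst.
- exact: cvgr_expR.
Unshelve. all: by end_near. Qed.

Lemma momentE p : (@moment R p = \int[mu]_(t in `[0%R, +oo[) (t ^+ p * egauss t)%:E)%E.
Proof.
rewrite -integral_itv_obnd_cbnd; last first.
  apply: measurable_funTS; apply/measurable_EFinP; apply: measurable_funM.
    exact: measurable_funX.
  by apply: continuous_measurable_fun; exact: continuous_egauss.
rewrite [RHS]integral_mkcond; apply: eq_integral => t _; rewrite patchE indicE.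
by case: ifPn => _; rewrite ?mul1r ?mul0r.
Qed.

Lemma moment1 : @moment R 1 = 1%E.
Proof.
rewrite momentE.
have dF (x : R) : is_derive x 1 (- egauss) (x * egauss x).
  rewrite -[x * _]opprK; apply: is_deriveN; exact: is_derive_egauss.
rewrite (integral_derive_y dF (l := 0)).
- by rewrite sub0r opprK /egauss expr0n mulNr mul0r oppr0 expR0.
- move=> x; apply: cvgM; first exact: cvg_id.
  exact: continuous_egauss.
- by move=> x x0; rewrite mulr_ge0 ?expR_ge0.
- by rewrite -[X in _ --> X]oppr0; apply: cvgN; exact: cvg_egauss.
Qed.

(** Integration by parts with t ^ (p + 1) against t exp (- t ^ 2 / 2), which is minus the derivative
    of [egauss]; the boundary terms vanish. *)
Lemma momentSS p : (@moment R p.+2 = (p.+1%:R)%:E * @moment R p)%E.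
Proof.
rewrite !momentE.
have dU (x : R) : is_derive x 1 (fun x : R => x ^+ p.+1) (p.+1%:R * x ^+ p).
  have -> : (fun x : R => x ^+ p.+1) = (id : R -> R) ^+ p.+1 by apply/funext => y; rewrite exprfctE.
  by apply: is_derive_eq; rewrite /GRing.scale /= mulr1.
have cU : continuous (fun x : R => p.+1%:R * x ^+ p).
  by move=> x; apply: cvgM; [exact: cvg_cst|exact: exprn_continuous].
have cv : continuous (fun x : R => x * egauss x).
  by move=> x; apply: cvgM; [exact: cvg_id|exact: continuous_egauss].
have u0 (t : R) : 0 <= t -> 0 <= p.+1%:R * t ^+ p by move=> t0; rewrite mulr_ge0// exprn_ge0.
have v0 (t : R) : 0 <= t -> 0 <= t * egauss t by move=> t0; rewrite mulr_ge0 ?expR_ge0.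
have U0 : 0 <= (0 : R) ^+ p.+1 by rewrite expr0n.
have := ge0_integration_by_parts_y dU cU u0 U0 is_derive_egauss cv v0 cvg_egauss.
rewrite expr0n mul0r add0e => E.
transitivity (\int[mu]_(t in `[0%R, +oo[) (t ^+ p.+1 * (t * egauss t))%:E)%E.
  by apply: eq_integral => t _; rewrite mulrA -exprSr.
rewrite E -ge0_integralZl_EFin//.
- by apply: eq_integral => t _; rewrite -EFinM mulrA.
- by move=> t /=; rewrite in_itv /= andbT lee_fin => t0; rewrite mulr_ge0 ?expR_ge0// exprn_ge0.
- apply: measurable_funTS; apply/measurable_EFinP; apply: measurable_funM.
    exact: measurable_funX.
  by apply: continuous_measurable_fun; exact: continuous_egauss.
Qed.

Lemma phi_even (t : R) : phi (- t) = phi t. Proof. by rewrite !phiE sqrrN. Qed.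

Lemma continuous_phi : continuous (@phi R).
Proof. exact: continuous_normal_pdf (oner_neq0 _). Qed.

Lemma integral_half_phi : (\int[mu]_(t in `[0%R, +oo[) (phi t)%:E = (2^-1)%:E :> \bar R)%E.
Proof.
have := @ge0_symfun_integralT R (@phi R) phi_ge0 continuous_phi (fun x => esym (phi_even x)).
rewrite integral_phi (_ : [set x : R | 0 <= x] = `[0, +oo[%classic); last first.
  by apply/seteqP; split=> x /=; rewrite in_itv /= andbT.
set I := (X in (_ * X)%E) => E.
have I0 : (0 <= I)%E by apply: integral_ge0 => t _; rewrite lee_fin phi_ge0.
have : (2^-1%:E * 1 = 2^-1%:E * (2%:E * I))%E by rewrite -E.
by rewrite mule1 muleA -EFinM mulVf// mul1e => /esym.
Qed.

Lemma moment0 : @moment R 0 = ((2 * phi0)^-1)%:E.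
Proof.
have p0 := phi0_gt0.
have : (phi0%:E * @moment R 0 = (2^-1)%:E)%E.
  rewrite -integral_half_phi momentE -ge0_integralZl_EFin//.
  - by apply: eq_integral => t _; rewrite -EFinM expr0 mul1r phi_egauss.
  - by move=> t _; rewrite expr0 mul1r lee_fin expR_ge0.
  - apply: measurable_funTS; apply/measurable_EFinP; apply: measurable_funM => //.
    by apply: continuous_measurable_fun; exact: continuous_egauss.
  - exact: ltW.
move=> E; rewrite -[LHS]mul1e -[1%E]/(1%:E) -(mulVf (lt0r_neq0 p0)) EFinM -muleA E -EFinM.
by congr (_%:E); field; exact: lt0r_neq0.
Qed.

(* [mom p] is the integral of [t ^ p * exp (- t ^ 2 / 2)] over the half-line;
   [mom 0 = sqrt (pi / 2)]. *)
Fixpoint mom (p : nat) : R :=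
  match p with
  | 0 => (2 * phi0)^-1
  | 1 => 1
  | (q.+1 as q').+1 => q'%:R * mom q
  end.

Lemma moment_mom p : @moment R p = (mom p)%:E.
Proof.
suff : @moment R p = (mom p)%:E /\ @moment R p.+1 = (mom p.+1)%:E by case.
elim: p => [|p [IH1 IH2]]; first by split; [exact: moment0|exact: moment1].
by split=> //; rewrite momentSS IH1 -EFinM.
Qed.

(** Legendre's duplication formula in disguise, as mom p = 2 ^ ((p - 1) / 2) Gamma ((p + 1) / 2).
    Here the recursion alone suffices: passing from p to p + 1 multiplies the product by p + 1. *)
Lemma mom_mulS p : mom p * mom p.+1 = p`!%:R * mom 0.
Proof.
elim: p => [|p IH]; first by rewrite /= mulr1 mul1r.
rewrite (_ : mom p.+2 = p.+1%:R * mom p)// mulrCA [mom p.+1 * _]mulrC IH mulrA -natrM.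
by rewrite factS.
Qed.

Lemma mom_gt0 p : 0 < mom p.
Proof.
suff : 0 < mom p /\ 0 < mom p.+1 by case.
elim: p => [|p [IH1 IH2]]; first by split=> //=; rewrite invr_gt0 mulr_gt0// phi0_gt0.
by split=> //; rewrite [mom _](_ : _ = p.+1%:R * mom p)// mulr_gt0.
Qed.

End gaussian_line.

(** * Half-integer values of Gamma and the normal distribution function *)

Section gamma_profile.
Context {R : realType}.
Local Notation mu := (@lebesgue_measure R).

Lemma integral_expRN (a : R) : (\int[mu]_(t in `[a, +oo[) (expR (- t))%:E = (expR (- a))%:E)%E.
Proof.
have dE (x : R) : is_derive x 1 (fun x : R => - expR (- x)) (expR (- x)).
  have -> : (fun x : R => - expR (- x)) = - (expR \o -%R) by [].
  by apply: is_derive_eq; rewrite /GRing.scale /=; ring.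
have cE : continuous (fun x : R => expR (- x)).
  by move=> x; apply: continuous_comp; [exact: oppr_continuous|exact: continuous_expR].
rewrite (integral_derive_y dE (l := 0))//.
- by rewrite sub0r opprK.
- by rewrite -[X in _ --> X]oppr0; apply: cvgN; exact: cvgr_expR.
Qed.

(** The power x ^ ((b + 1) / 2) is written as the integral of [u] from 0 to sqrt (2 x). Swapping the
    order leaves the tail of exp (- x) from s ^ 2 / 2, which is [egauss s], so the result is c (b +
    1) mom b = c mom (b + 2). *)
Lemma Gamma_half b :
  Gamma (b.+1%:R / 2 + 1) = Num.sqrt 2 ^- b.+1 * mom b.+2 :> R.
Proof.
pose c : R := Num.sqrt 2 ^- b.+1.
have c0 : 0 < c by rewrite invr_gt0 exprn_gt0// sqrtr_gt0.
have mexp : measurable_fun setT (fun t : R => expR (- t)) by exact: measurableT_comp.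
have msq : measurable_fun setT (fun t : R => c * Num.sqrt (2 * t) ^+ b.+1).
  apply: measurable_funM => //; apply: measurable_funX.
  by apply: (measurableT_comp (@measurable_sqrt R)); exact: measurable_funM.
suff E : (\int[mu]_(x in `]0%R, +oo[) (x `^ (b.+1%:R / 2 + 1 - 1) * expR (- x))%:E =
    (c * mom b.+2)%:E)%E by rewrite /Gamma /Rintegral E.
rewrite addrK.
transitivity (\int[mu]_(t in `]0%R, +oo[) ((c * Num.sqrt (2 * t) ^+ b.+1) * expR (- t))%:E)%E.
  apply: eq_integral => t; rewrite inE /= in_itv /= andbT => t0; congr ((_ * _)%:E).
  rewrite sqrtrM// exprMn mulrA mulVf ?mul1r ?expf_neq0// ?gt_eqF ?sqrtr_gt0//.
  by rewrite -powR12_sqrt ?ltW// -powR_mulrn ?powR_ge0// -powRrM mulrC.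
rewrite integral_itv_obnd_cbnd; last first.
  by apply: measurable_funTS; apply/measurable_EFinP; exact: measurable_funM.
pose u (s : R) := c * (b.+1%:R * s ^+ b).
have cu : continuous u.
  move=> x; apply: cvgM; first exact: cvg_cst.
  by apply: cvgM; [exact: cvg_cst|exact: exprn_continuous].
have dU (x : R) : is_derive x 1 (fun x : R => c * x ^+ b.+1) (u x).
  have -> : (fun x : R => c * x ^+ b.+1) = c *: ((id : R -> R) ^+ b.+1).
    by apply/funext => y; rewrite scalrfctE exprfctE.
  by apply: is_derive_eq; rewrite /GRing.scale /= mulr1.
rewrite (@integral_swap_region R (fun s => s ^+ 2 / 2) u (fun t => expR (- t)) _ egauss).
- rewrite [mom _](_ : _ = b.+1%:R * mom b)// mulrA EFinM -moment_mom momentE -ge0_integralZl_EFin//.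
  + by apply: eq_integral => t _; rewrite -EFinM /u !mulrA.
  + by move=> t /=; rewrite in_itv /= andbT lee_fin => t0; rewrite mulr_ge0 ?expR_ge0// exprn_ge0.
  + apply: measurable_funTS; apply/measurable_EFinP; apply: measurable_funM.
      exact: measurable_funX.
    by apply: continuous_measurable_fun; exact: continuous_egauss.
  + by rewrite mulr_ge0// ltW.
- by apply: measurable_funM => //; exact: measurable_funX.
- exact: continuous_measurable_fun.
- exact: mexp.
- by move=> s _; rewrite mulr_ge0// sqr_ge0.
- move=> t t0; apply: mulr_ge0; first exact: ltW.
  by apply: mulr_ge0 => //; exact: exprn_ge0.
- by move=> t _; exact: expR_ge0.
- move=> t t0; have t20 : 0 <= 2 * t by rewrite mulr_ge0.
  rewrite (_ : [set s | _] = `[0, Num.sqrt (2 * t)]%classic); last first.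
    apply/seteqP; split=> s /=; rewrite in_itv /= => /andP[s0 st]; rewrite s0 /=.
      by rewrite -(ger0_norm s0) -sqrtr_sqr ler_sqrt//; lra.
    have : s ^+ 2 <= Num.sqrt (2 * t) ^+ 2 by rewrite lerXn2r// nnegrE sqrtr_ge0.
    by rewrite sqr_sqrtr//; lra.
  by rewrite (integral_derive dU cu (sqrtr_ge0 _)) expr0n mulr0 subr0.
- by move=> s _; rewrite integral_expRN /egauss mulNr.
Qed.

Lemma Phi_ereal (t : R) : (\int[mu]_(s in `]-oo, t]) (phi s)%:E = (Phi t)%:E)%E.
Proof.
rewrite /Phi /Rintegral fineK// ge0_fin_numE; last first.
  by apply: integral_ge0 => s _; rewrite lee_fin phi_ge0.
apply: (@le_lt_trans _ _ 1%E); last exact: ltry.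
rewrite -(@integral_phi R); apply: ge0_subset_integral => //.
- by apply/measurable_EFinP; exact: measurable_phi.
- by move=> s _; rewrite lee_fin phi_ge0.
Qed.

Lemma Phi_ge0 (t : R) : 0 <= Phi t.
Proof. by rewrite -lee_fin -Phi_ereal integral_ge0// => s _; rewrite lee_fin phi_ge0. Qed.

Lemma Phi_le1 (t : R) : Phi t <= 1.
Proof.
rewrite -lee_fin -Phi_ereal -[X in (_ <= X)%E](@integral_phi R).
apply: ge0_subset_integral => //.
- by apply/measurable_EFinP; exact: measurable_phi.
- by move=> s _; rewrite lee_fin phi_ge0.
Qed.

Lemma Phi0 : Phi 0 = 2^-1 :> R.
Proof.
apply: EFin_inj; rewrite -Phi_ereal -integral_half_phi.
rewrite (ge0_integration_by_substitution0 (f := fun t => (phi t)%:E)).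
- by apply: eq_integral => t _; rewrite phi_even.
- by apply/measurable_EFinP; exact: measurable_phi.
- by move=> t; rewrite lee_fin phi_ge0.
Qed.

Lemma is_derive_Phi (x : R) : is_derive x 1 (@Phi R) (phi x).
Proof.
have x1 : x < x + 1 by rewrite ltrDl.
have intphi : mu.-integrable [set` Interval -oo%O (BRight (x + 1))] (EFin \o @phi R).
  by apply: (integrableS measurableT) => //; exact: integrable_normal_pdf.
have [||d1 d2] := @continuous_FTC1 R (@phi R) -oo%O x (x + 1) x1 intphi.
  by rewrite ltNyr.
  exact: continuous_phi.
apply: DeriveDef; first exact: d1.
rewrite -derive1E; exact: d2.
Qed.

Lemma continuous_Phi : continuous (@Phi R).
Proof. exact: is_derive_continuous is_derive_Phi. Qed.

Lemma measurable_Phi : measurable_fun setT (@Phi R).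
Proof. exact: continuous_measurable_fun continuous_Phi. Qed.

Lemma is_derive_phi (x : R) : is_derive x 1 (@phi R) (- (x * phi x)).
Proof.
have -> : - (x * phi x) = phi0 *: - (x * egauss x) :> R.
  by rewrite phi_egauss /GRing.scale /=; ring.
have -> : @phi R = phi0 *: egauss by apply/funext => t; rewrite phi_egauss.
by apply: is_deriveZ; exact: is_derive_egauss.
Qed.

Lemma phi_at0 : phi 0 = phi0 :> R.
Proof. by rewrite phi_egauss /egauss expr0n /= oppr0 mul0r expR0 mulr1. Qed.

Lemma phi_le (t : R) : phi t <= phi0.
Proof.
have e1 : egauss t <= 1 by rewrite -expR0 ler_expR; have := sqr_ge0 t; lra.
by rewrite phi_egauss ler_piMr// ltW// phi0_gt0.
Qed.

Lemma continuous_funX (f : R -> R) n : continuous f -> continuous (fun x => f x ^+ n).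
Proof.
move=> cf x; apply: (@continuous_comp _ _ _ f (fun y : R => y ^+ n)); first exact: cf.
exact: exprn_continuous.
Qed.

(** Phi ^ m is differentiated and phi ^ (d + 1) plays the part of the tail integral; the boundary
    term is Phi(0) ^ m phi(0) ^ (d + 1). For m = 0 the factor [m%:R] makes [m.-1] harmless. *)
Lemma Phi_integral_by_parts d m :
  (\int[mu]_(t in `[0%R, +oo[) (Phi t ^+ m * (d.+1%:R * (t * phi t ^+ d.+1)))%:E =
   (2^-1 ^+ m * phi0 ^+ d.+1)%:E +
   \int[mu]_(t in `[0%R, +oo[) (m%:R * (Phi t ^+ m.-1 * phi t ^+ d.+2))%:E)%E.
Proof.
have dU (x : R) : is_derive x 1 (fun x : R => Phi x ^+ m) (m%:R * Phi x ^+ m.-1 * phi x).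
  have -> : (fun x : R => Phi x ^+ m) = (@Phi R) ^+ m by apply/funext => y; rewrite exprfctE.
  have := is_derive_Phi x => dP.
  exact: is_derive_eq.
have dV (x : R) : is_derive x 1 (fun x : R => phi x ^+ d.+1) (- (d.+1%:R * (x * phi x ^+ d.+1))).
  have -> : (fun x : R => phi x ^+ d.+1) = (@phi R) ^+ d.+1 by apply/funext => y; rewrite exprfctE.
  have := is_derive_phi x => dP.
  by apply: is_derive_eq; rewrite /GRing.scale /= exprS; ring.
have cu : continuous (fun x : R => m%:R * Phi x ^+ m.-1 * phi x).
  move=> x; apply: cvgM; last exact: continuous_phi.
  apply: cvgM; first exact: cvg_cst.
  have H := @continuous_funX (@Phi R) m.-1 continuous_Phi; exact: H.
have cv : continuous (fun x : R => d.+1%:R * (x * phi x ^+ d.+1)).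
  move=> x; apply: cvgM; first exact: cvg_cst.
  apply: cvgM; first exact: cvg_id.
  have H := @continuous_funX (@phi R) d.+1 (@continuous_phi R); exact: H.
have u0 (t : R) : 0 <= t -> 0 <= m%:R * Phi t ^+ m.-1 * phi t.
  by move=> t0; rewrite mulr_ge0 ?phi_ge0// mulr_ge0// exprn_ge0// Phi_ge0.
have v0 (t : R) : 0 <= t -> 0 <= d.+1%:R * (t * phi t ^+ d.+1).
  by move=> t0; rewrite mulr_ge0// mulr_ge0// exprn_ge0// phi_ge0.
have U0 : 0 <= Phi 0 ^+ m :> R by rewrite exprn_ge0// Phi_ge0.
have V0 : phi x ^+ d.+1 @[x --> +oo] --> (0 : R).
  have -> : (0 : R) = 0 ^+ d.+1 by rewrite expr0n.
  have cphi : phi x @[x --> +oo] --> (0 : R).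
    rewrite -[X in _ --> X](mulr0 phi0).
    under eq_fun do rewrite phi_egauss.
    by apply: cvgM; [exact: cvg_cst|exact: cvg_egauss].
  apply: (@cvg_comp _ _ _ (@phi R) (fun y : R => y ^+ d.+1) _ _ _ cphi).
  exact: exprn_continuous.
rewrite (ge0_integration_by_parts_y dU cu u0 U0 dV cv v0 V0) Phi0 phi_at0.
congr (_ + _)%E; apply: eq_integral => t _; congr (_%:E).
by rewrite [phi t ^+ d.+2]exprS; ring.
Qed.

Lemma integral_Phi_phi_fin d m :
  (\int[mu]_(t in `[0%R, +oo[) (Phi t ^+ m * phi t ^+ d.+1)%:E =
   (\int[mu]_(t in `[0%R, +oo[) (Phi t ^+ m * phi t ^+ d.+1))%:E)%E.
Proof.
have F0 (t : R) : 0 <= Phi t ^+ m * phi t ^+ d.+1.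
  by rewrite mulr_ge0// exprn_ge0 ?Phi_ge0 ?phi_ge0.
rewrite /Rintegral fineK// ge0_fin_numE; last first.
  by apply: integral_ge0 => t _; rewrite lee_fin.
apply: (@le_lt_trans _ _ (\int[mu]_(t in `[0%R, +oo[) ((phi0 ^+ d)%:E * (phi t)%:E))%E).
  apply: ge0_le_integral => //.
  - by move=> t _; rewrite lee_fin.
  - apply: measurable_funTS; apply/measurable_EFinP; apply: measurable_funM; apply: measurable_funX.
      exact: measurable_Phi.
    exact: measurable_phi.
  - apply: measurable_funTS; apply: emeasurable_funM => //.
    by apply/measurable_EFinP; exact: measurable_phi.
  move=> t _; rewrite -EFinM lee_fin exprSr -[leRHS]mul1r.
  apply: ler_pM; rewrite ?exprn_ge0 ?Phi_ge0 ?mulr_ge0 ?exprn_ge0 ?phi_ge0//.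
    by rewrite exprn_ile1 ?Phi_ge0 ?Phi_le1.
  apply: ler_wpM2r; first exact: phi_ge0.
  apply: lerXn2r; rewrite ?nnegrE ?phi_ge0 ?phi_le//.
  exact/ltW/phi0_gt0.
rewrite ge0_integralZl_EFin//.
- by rewrite integral_half_phi -EFinM ltry.
- by move=> t _; rewrite lee_fin phi_ge0.
- by apply: measurable_funTS; apply/measurable_EFinP; exact: measurable_phi.
- by rewrite exprn_ge0// ltW// phi0_gt0.
Qed.

End gamma_profile.

(** * Facets *)

Section facet.
Context {R : realType}.
Local Notation mu := (@lebesgue_measure R).
Local Notation G := (@std_normal_density R _).

Lemma egauss_scale b (t : R) :
  egauss (Num.sqrt b.+1%:R * t) = egauss t ^+ b.+1.
Proof.
rewrite /egauss -expRM_natl exprMn sqr_sqrtr//; congr expR.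
by field.
Qed.

(** The substitution s = sqrt (b + 1) t turns exp (- s ^ 2 / 2) into the power egauss t ^ (b + 1);
    this is where the power of phi in the final formula originates. *)
Lemma profile_Phi b m :
  (profile (fun s : R => Phi (s / Num.sqrt b.+1%:R) ^+ m)%R =
   (2 * phi0 / phi0 ^+ b.+1)%:E *
   \int[mu]_(t in `[0%R, +oo[) (Phi t ^+ m * (b.+1%:R * (t * phi t ^+ b.+1)))%:E)%E.
Proof.
set r := Num.sqrt _.
have r0 : 0 < r by rewrite sqrtr_gt0.
have rn0 : r != 0 by rewrite gt_eqF.
have rr : r ^+ 2 = b.+1%:R by rewrite sqr_sqrtr.
have p0 := @phi0_gt0 R.
pose g (s : R) := Phi (s / r) ^+ m.
have cg : continuous g.
  have c1 : continuous (fun s : R => s / r).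
    by move=> x; apply: cvgM; [exact: cvg_id|exact: cvg_cst].
  have c2 : continuous (fun s : R => Phi (s / r)).
    by move=> x; apply: (@continuous_comp R R R (fun s => s / r) (@Phi R)); [exact: c1|exact: continuous_Phi].
  have H := @continuous_funX R (fun s : R => Phi (s / r)) m c2; exact: H.
have g0 s : 0 <= g s by rewrite exprn_ge0// Phi_ge0.
pose f (t : R) := phi t * (`|t| * g `|t|).
have f0 t : 0 <= f t by rewrite mulr_ge0 ?phi_ge0// mulr_ge0.
have cf : continuous f.
  move=> x; apply: cvgM; first exact: continuous_phi.
  apply: cvgM; first exact: norm_continuous.
  apply: (@continuous_comp R R R (fun s : R => `|s|) g); first exact: norm_continuous.
  exact: cg.
have fe : f =1 f \o -%R by move=> t; rewrite /f /= phi_even normrN.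
have E := ge0_symfun_integralT f0 cf fe.
apply: (eq_trans (y := (\int[mu]_t (f t)%:E)%E)).
  by apply: eq_integral => t _; rewrite -EFinM.
apply: (eq_trans E).
pose h (t : R) := \1_`[0, +oo[ t * (phi t * (t * g t)).
have h0 t : (0 <= (h t)%:E)%E.
  rewrite lee_fin /h indicE; case: (boolP (t \in _)) => [|_]; last by rewrite mul0r.
  by rewrite inE /= in_itv /= andbT => t0; rewrite mul1r mulr_ge0 ?phi_ge0// mulr_ge0.
have mh : measurable_fun setT (fun t => (h t)%:E).
  apply/measurable_EFinP; apply: measurable_funM => //; apply: measurable_funM.
    exact: measurable_phi.
  by apply: measurable_funM => //; exact: continuous_measurable_fun.
have -> : (\int[mu]_(x in [set x : R | (0 <= x)%R]) (f x)%:E = \int[mu]_t (h t)%:E)%E.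
  rewrite integral_mkcond; apply: eq_integral => t _; rewrite patchE /h indicE.
  rewrite (_ : (t \in [set x | 0 <= x]) = (0 <= t)); last by apply/idP/idP; rewrite inE.
  rewrite (_ : (t \in `[0, +oo[%classic) = (0 <= t)); last first.
    by apply/idP/idP; rewrite inE /= in_itv /= andbT.
  by case: ifPn => t0; rewrite ?mul1r ?mul0r// /f ger0_norm.
rewrite -(ge0_integral_affine 0 rn0 mh h0) (gtr0_norm r0) muleA -EFinM.
(* The 2 comes from the symmetry and [r] from the Jacobian; the remaining factor is moved into the
   integrand. *)
have -> : 2 * phi0 / phi0 ^+ b.+1 = (2 * r) * (phi0 / phi0 ^+ b.+1 / r) :> R.
  by field; rewrite rn0 expf_neq0// gt_eqF.
rewrite [in RHS]EFinM -[RHS]muleA; apply: (congr1 (mule _)).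
rewrite -ge0_integralZl_EFin//; last 3 first.
- move=> t /=; rewrite in_itv /= andbT lee_fin => t0.
  rewrite mulr_ge0 ?exprn_ge0 ?Phi_ge0// mulr_ge0// mulr_ge0// exprn_ge0// phi_ge0//.
- apply: measurable_funTS; apply/measurable_EFinP; apply: measurable_funM.
    by apply: measurable_funX; exact: measurable_Phi.
  apply: measurable_funM => //; apply: measurable_funM => //.
  by apply: measurable_funX; exact: measurable_phi.
- by apply: mulr_ge0; [apply: mulr_ge0; [exact: ltW|rewrite invr_ge0 exprn_ge0// ltW]|rewrite invr_ge0 ltW].
rewrite [RHS]integral_mkcond; apply: eq_integral => t _; rewrite patchE /h indicE addr0.
rewrite (_ : (r * t \in `[0, +oo[%classic) = (0 <= t)); last first.
  by apply/idP/idP; rewrite inE /= in_itv /= andbT pmulr_rge0.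
rewrite (_ : (t \in `[0, +oo[%classic) = (0 <= t)); last first.
  by apply/idP/idP; rewrite inE /= in_itv /= andbT.
case: ifPn => t0; rewrite ?mul0r// mul1r -EFinM; congr (_%:E).
rewrite /g [r * t / r]mulrAC divff// mul1r !phi_egauss egauss_scale exprMn -rr.
by field; rewrite rn0 expf_neq0// gt_eqF.
Qed.

Lemma profile1 : profile (fun=> 1 : R) = (2 * phi0)%:E.
Proof.
have := profile_Phi 0 0; rewrite Phi_integral_by_parts.
rewrite expr1 -mulrA divff ?gt_eqF ?phi0_gt0// mulr1 expr0 mul1r.
rewrite [X in (_ + X)%E](_ : _ = 0)%E ?adde0; last first.
  by apply: integral0_eq => t _; rewrite mul0r.
by move=> H; rewrite EFinM -H; apply: eq_integral => t _; rewrite expr0.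
Qed.

(** E |det A| = E |N| E (vol B) with E |N| = 2 phi0, while [absdet_moment] divides by moment 0 = 1 /
    (2 phi0); the two constants cancel. *)
Lemma gmx_vol_cross b :
  gmx (fun B : 'M[R]_(b, b.+1) => (vol_cross B)%:E) = (mom b.+1)%:E.
Proof.
rewrite -moment_mom absdet_moment moment0.
have := @gmx_det_profile R b (fun=> 1) (measurable_cst _) (fun=> ler01).
rewrite profile1; under eq_gmx do rewrite mulr1.
have p2 : 2 * phi0 != 0 :> R by rewrite gt_eqF// mulr_gt0// phi0_gt0.
by move=> ->; rewrite muleAC -EFinM divff// mul1e.
Qed.

(* The solution [a] of [A *m a = const_mx 1], and [0] when [A] is singular. *)
Definition facet_normal n (A : 'M[R]_n) : 'cV[R]_n :=
  (\det A)^-1 *: (\adj A *m const_mx 1).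

Lemma facet_normalE n (A : 'M[R]_n) : \det A != 0 ->
  facet_normal A = invmx A *m const_mx 1.
Proof.
by move=> dA; rewrite /facet_normal /invmx unitmxE unitfE dA scalemxAl.
Qed.

(** The normal of Q A is A^-1 Q 1 = sqrt (b + 1) A^-1 e_0. The first column of A^-1 consists of the
    cofactors of the first row, that is the cross product of the remaining rows, over det A. *)
Lemma sqn_facet_normal_rot b (Q A : 'M[R]_b.+1) : Q^T = Q -> Q *m Q = 1%:M ->
  const_mx 1 *m Q = Num.sqrt b.+1%:R *: delta_mx ord0 ord0 :> 'rV[R]_b.+1 ->
  \det A != 0 ->
  (Num.sqrt (sqn (facet_normal (Q *m A))^T))^-1 =
  `|\det A| / vol_cross (dsubmx (A : 'M[R]_(1 + b))) / Num.sqrt b.+1%:R.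
Proof.
move=> QT QQ Q1 dA.
have uA : A \in unitmx by rewrite unitmxE unitfE.
have [uQ _] := mulmx1_unit QQ.
have dQA : \det (Q *m A) != 0.
  by rewrite det_mulmx mulf_neq0// -unitfE -unitmxE.
have Q1T : Q *m const_mx 1 = Num.sqrt b.+1%:R *: delta_mx ord0 ord0 :> 'cV[R]_b.+1.
  by rewrite -[RHS]trmxK linearZ /= trmx_delta -Q1 trmx_mul QT trmx_const.
have iQ : invmx Q = Q by rewrite -[RHS]mul1mx -(mulVmx uQ) -mulmxA QQ mulmx1.
have E : (facet_normal (Q *m A))^T = (Num.sqrt b.+1%:R / \det A) *: cross (dsubmx (A : 'M[R]_(1 + b))).
  rewrite facet_normalE//.
  have uQA : Q *m A \in unitmx by rewrite unitmx_mul uQ.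
  have -> : invmx (Q *m A) = invmx A *m Q.
    transitivity (invmx (Q *m A) *m (Q *m A *m (invmx A *m Q))); last exact: mulKmx.
    by rewrite -(mulmxA Q A) (mulKVmx uA) QQ mulmx1.
  rewrite -mulmxA Q1T -scalemxAr /invmx uA -scalemxAl scalerA -colE linearZ /=.
  congr (_ *: _); apply/rowP => j.
  transitivity (cofactor A ord0 j); first by rewrite !mxE.
  rewrite -(@cofactor_col_mx R b (usubmx (A : 'M[R]_(1 + b)))).
  by rewrite (@vsubmxK _ 1 b).
rewrite E sqnZ sqrtrM ?sqr_ge0// sqrtr_sqr -/(vol_cross _) invfM normrM normfV.
by rewrite ger0_norm ?sqrtr_ge0// invfM invrK; ring.
Qed.

Lemma measurable_facet_normal d (T : measurableType d) n (f : T -> 'M[R]_n) :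
  (forall i j, measurable_fun setT (fun x => f x i j)) ->
  forall i j, measurable_fun setT (fun x => facet_normal (f x) i j).
Proof.
move=> mf i j; under eq_fun do rewrite mxE.
apply: measurable_funM; first by apply: measurable_funV; exact: measurable_det.
apply: measurable_mulmx => k l; first exact: measurable_adj.
by under eq_fun do rewrite mxE; exact: measurable_cst.
Qed.

Lemma mx_measurable_facet_profile b (g : R -> R) : measurable_fun setT g ->
  mx_measurable (fun A : 'M[R]_b.+1 =>
    (`|\det A| * g (Num.sqrt (sqn (facet_normal A)^T))^-1)%:E).
Proof.
move=> mg; apply/measurable_EFinP; apply: measurable_funM; first exact: measurable_absdet.
apply: (measurableT_comp mg); apply: measurable_funV.
apply: (measurableT_comp (@measurable_sqrt R)); apply: (measurableT_comp (@measurable_sqn R _)).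
apply/measurable_fun_rVP => i; under eq_fun do rewrite mxE.
by apply: measurable_facet_normal => k l; exact: measurable_vec_mx.
Qed.

Lemma gmx_facet_profile b (g : R -> R) : measurable_fun setT g -> (forall x, 0 <= g x) ->
  (gmx (fun A : 'M[R]_b.+1 => (`|\det A| * g (Num.sqrt (sqn (facet_normal A)^T))^-1)%:E) =
   (mom b.+1)%:E * profile (fun s => g (s / Num.sqrt b.+1%:R)%R))%E.
Proof.
move=> mg g0.
have [Q [QT QQ Q1]] := householder (const_mx 1 : 'rV[R]_b.+1).
have oQ : Q^T *m Q = 1%:M by rewrite QT.
have s1 : sqn (const_mx 1 : 'rV[R]_b.+1) = b.+1%:R.
  rewrite /sqn (eq_bigr (fun=> 1)); last by move=> i _; rewrite mxE expr1n.
  by rewrite sumr_const card_ord.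
rewrite s1 in Q1.
rewrite -(gmx_orthogonal oQ (mx_measurable_facet_profile mg)); last first.
  by move=> A; rewrite lee_fin mulr_ge0.
rewrite -gmx_vol_cross muleC.
have mg' : measurable_fun setT (fun s : R => g (s / Num.sqrt b.+1%:R)).
  by apply: (measurableT_comp mg); exact: measurable_funM.
apply: (eq_trans _ (@gmx_det_profile R b _ mg' (fun x => g0 _))).
apply: eq_gmx => A; congr (_%:E).
rewrite det_mulmx normrM (orthogonal_absdet oQ) mul1r.
have [->|dA] := eqVneq (\det A) 0; first by rewrite normr0 !mul0r.
by rewrite sqn_facet_normal_rot.
Qed.

Lemma gint_halfspace n (u : 'rV[R]_n) : u != 0 ->
  gint (fun x : 'rV[R]_n => (\1_[set t : R | t < 1] ((x *m u^T) ord0 ord0))%:E) =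
  (Phi (Num.sqrt (sqn u))^-1)%:E.
Proof.
move=> u0; set r := Num.sqrt _.
have r0 : 0 < r by rewrite sqrtr_gt0 lt_neqAle sqn_ge0 andbT eq_sym sqn_eq0.
have mS : measurable [set t : R | t < 1].
  by rewrite (_ : [set t | _] = `]-oo, 1[%classic)//; apply/seteqP; split=> x /=; rewrite in_itv.
rewrite (gint_linear u (F := fun t => (\1_[set t : R | t < 1] t)%:E)); last 2 first.
- by apply/measurable_EFinP; exact: measurable_indic.
- by move=> t; rewrite lee_fin.
rewrite -/r -Phi_ereal -integral_itv_bndo_bndc; last first.
  by apply: measurable_funTS; apply/measurable_EFinP; exact: measurable_phi.
rewrite [RHS]integral_mkcond; apply: eq_integral => t _; rewrite patchE indicE.
rewrite (_ : (r * t \in _) = (t < r^-1)); last first.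
  by apply/idP/idP; rewrite inE /= mulrC -ltr_pdivlMr// div1r.
rewrite (_ : (t \in _) = (t < r^-1)); last by apply/idP/idP; rewrite inE /= in_itv.
by case: ifPn => _; rewrite ?mule1 ?mule0.
Qed.

Lemma gmx_prod_row n d (q : 'rV[R]_d -> R) (p : R) : measurable_fun setT q ->
  (forall x, 0 <= q x) -> 0 <= p -> gint (fun x => (q x)%:E) = p%:E ->
  gmx (fun B : 'M[R]_(n, d) => (\prod_(i < n) q (row i B))%:E) = (p ^+ n)%:E.
Proof.
move=> mq q0 p0 qp; elim: n => [|n IH].
  rewrite expr0 -[RHS](@gint1 R (0 * d)); apply: eq_gint => x.
  by rewrite big_ord0.
have mrow m (i : 'I_m) : measurable_fun setT (fun x : 'rV[R]_(m * d) => q (row i (vec_mx x))).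
  apply: (measurableT_comp mq); apply/measurable_fun_rVP => j.
  by under eq_fun do rewrite mxE; exact: measurable_vec_mx.
rewrite (@gmx_row_mx R n d); last 2 first.
- by apply/measurable_EFinP; apply: measurable_prod => i _; exact: mrow.
- by move=> A; rewrite lee_fin prodr_ge0.
rewrite exprS EFinM -IH -gmxZl//; last 2 first.
- by apply/measurable_EFinP; apply: measurable_prod => i _; exact: mrow.
- by move=> A; rewrite lee_fin prodr_ge0.
apply: eq_gmx => B; rewrite muleC -qp -gintZl//; last 2 first.
- by apply: prodr_ge0.
- exact/measurable_EFinP.
apply: eq_gint => x; rewrite -EFinM big_ord_recl mulrC; congr ((_ * _)%:E).
  apply: eq_bigr => i _; congr q; apply/rowP => j; rewrite !mxE.
  have rE : lift ord0 i = rshift 1 i :> 'I_(1 + n) by exact/val_inj.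
  by rewrite rE (unsplitK (inr i : 'I_1 + 'I_n)).
have lE : ord0 = lshift n (ord0 : 'I_1) :> 'I_(1 + n) by exact/val_inj.
by congr q; apply/rowP => j; rewrite !mxE lE (unsplitK (inl ord0 : 'I_1 + 'I_n)).
Qed.

(** Given the first b + 1 rows, each of the m other points lies on the origin side of their
    hyperplane independently, with probability Phi (1 / |a|) for the facet normal a. *)
Lemma gmx_facet b m :
  (gmx (fun C : 'M[R]_(b.+1 + m, b.+1) =>
    (`|\det (usubmx C)| * \prod_(j < m)
      \1_[set t : R | t < 1] ((row j (dsubmx C) *m facet_normal (usubmx C)) ord0 ord0))%:E) =
   (mom b.+1)%:E * profile (fun s : R => Phi (s / Num.sqrt b.+1%:R) ^+ m)%R)%E.
Proof.
have mS : measurable [set t : R | t < 1].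
  by rewrite (_ : [set t | _] = `]-oo, 1[%classic)//; apply/seteqP; split=> x /=; rewrite in_itv.
have g0 (s : R) : 0 <= Phi s ^+ m by rewrite exprn_ge0// Phi_ge0.
have mg : measurable_fun setT (fun s : R => Phi s ^+ m).
  by apply: measurable_funX; exact: measurable_Phi.
rewrite -(@gmx_facet_profile b _ mg g0) (@gmx_col_mx R b.+1 m b.+1); last 2 first.
- apply/measurable_EFinP; apply: measurable_funM.
    apply: measurableT_comp => //; apply: measurable_det => i j.
    by under eq_fun do rewrite mxE; exact: measurable_vec_mx.
  apply: measurable_prod => j _; apply: measurableT_comp; first exact: measurable_indic.
  apply: measurable_mulmx => [k l|k l].
    by under eq_fun do rewrite !mxE; exact: measurable_coord.
  apply: measurable_facet_normal => i i'.
  by under eq_fun do rewrite mxE; exact: measurable_vec_mx.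
- move=> A; rewrite lee_fin mulr_ge0// prodr_ge0// => i _; by rewrite indicE.
apply: eq_gmx => A.
under eq_gmx do rewrite col_mxKu col_mxKd EFinM.
have mq : measurable_fun setT (fun x : 'rV[R]_b.+1 =>
    \1_[set t : R | t < 1] ((x *m facet_normal A) ord0 ord0) : R).
  apply: measurableT_comp; first exact: measurable_indic.
  apply: measurable_mulmx => // i j; rewrite (ord1 i); exact: measurable_coord.
rewrite gmxZl//; last 2 first.
- apply/measurable_EFinP; apply: measurable_prod => j _.
  apply: (measurableT_comp mq); apply/measurable_fun_rVP => k.
  by under eq_fun do rewrite mxE; exact: measurable_vec_mx.
- by move=> B; rewrite lee_fin prodr_ge0// => i _; rewrite indicE.
(* A singular block has no facet, but the factor |det A| removes it from both sides. *)
have [->|dA] := eqVneq (\det A) 0; first by rewrite normr0 mul0e mul0r.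
rewrite EFinM; congr (_ * _)%E.
apply: (@gmx_prod_row m b.+1 (fun x => \1_[set t : R | t < 1] ((x *m facet_normal A) ord0 ord0))) => //.
  exact: Phi_ge0.
rewrite -gint_halfspace.
  by apply: eq_gint => x; rewrite trmxK.
apply: contra_neq dA => /(congr1 trmx); rewrite trmxK trmx0 => a0.
apply/eqP; apply: contraTT isT => dA; move: a0; rewrite facet_normalE// => /(congr1 (mulmx A)).
rewrite mulKVmx ?unitmxE ?unitfE// mulmx0 => /matrixP/(_ ord0 ord0); rewrite !mxE => /eqP.
by rewrite oner_eq0.
Qed.

End facet.

(** * The optimal simplex containing a point *)

Section selection.
Variable n : nat.
Implicit Type I : {set 'I_n.+1}.

(** A permutation of the indices that lists [I] first, so that after relabelling the chosen rows
    become the top block. *)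
Definition enum_first I (k : 'I_n.+1) : 'I_n.+1 :=
  nth ord0 (enum I ++ enum (~: I)) k.

Lemma size_enum_first I : size (enum I ++ enum (~: I)) = n.+1.
Proof. by rewrite size_cat -!cardE cardsC card_ord. Qed.

Lemma uniq_enum_first I : uniq (enum I ++ enum (~: I)).
Proof.
rewrite cat_uniq !enum_uniq andbT /=; apply/hasPn => i.
by rewrite !mem_enum inE.
Qed.

Lemma enum_first_inj I : injective (enum_first I).
Proof.
move=> j k /eqP; rewrite nth_uniq ?size_enum_first ?uniq_enum_first//.
by move=> /eqP/val_inj.
Qed.

Lemma enum_first_in I k : (enum_first I k \in I) = (k < #|I|)%N.
Proof.
rewrite /enum_first nth_cat -cardE; case: ltnP => kI.
  by rewrite -mem_enum mem_nth// -cardE.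
have : nth ord0 (enum (~: I)) (k - #|I|) \in enum (~: I).
  by rewrite mem_nth// -cardE -(ltn_add2l #|I|) subnKC// cardsC card_ord.
by rewrite mem_enum inE => /negbTE.
Qed.

Lemma enum_first_surj I i : exists k, i = enum_first I k.
Proof. by have [g _ gK] := injF_bij (@enum_first_inj I); exists (g i). Qed.

End selection.

Section sel.
Variables b m : nat.
Implicit Types (I : {set 'I_(b.+1 + m)}) (i : 'I_(b.+1 + m)) (k : 'I_b.+1).

(** For a set of b + 1 indices this enumerates it. For a smaller set it continues into the
    complement, so its image completes the set to b + 1 indices; for a larger one it picks b + 1
    members. *)
Definition sel I k : 'I_(b.+1 + m) := @enum_first (b + m) I (lshift m k).

Lemma sel_inj I : injective (sel I).
Proof. by move=> j k /enum_first_inj jk; apply: val_inj; exact: (congr1 val jk). Qed.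

Lemma sel_in I k : (sel I k \in I) = (k < #|I|)%N.
Proof. exact: (@enum_first_in (b + m)). Qed.

Lemma sel_surj I i : (#|I| <= b.+1)%N -> i \in I -> exists k, i = sel I k.
Proof.
move=> cI iI; have [k ik] := @enum_first_surj (b + m) I i.
have kb : (k < b.+1)%N.
  by apply: leq_trans cI; rewrite -(@enum_first_in (b + m)) -ik.
by exists (Ordinal kb); rewrite ik; congr enum_first; exact: val_inj.
Qed.

Lemma card_sel I : #|[set sel I k | k : 'I_b.+1]| = b.+1.
Proof. by rewrite card_imset ?card_ord//; exact: sel_inj. Qed.

End sel.

Section pivot.
Context {R : realFieldType}.

Definition rsum n (c : 'rV[R]_n) : R := \sum_i c ord0 i.

Lemma rsumE n (c : 'rV[R]_n) : rsum c = (c *m const_mx 1) ord0 (ord0 : 'I_1).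
Proof. by rewrite mxE; apply: eq_bigr => i _; rewrite mxE mulr1. Qed.

Lemma rsumD n (c w : 'rV[R]_n) : rsum (c + w) = rsum c + rsum w.
Proof. by rewrite /rsum -big_split; apply: eq_bigr => i _; rewrite mxE. Qed.

Lemma rsumZ n (c : 'rV[R]_n) t : rsum (t *: c) = t * rsum c.
Proof. by rewrite /rsum mulr_sumr; apply: eq_bigr => i _; rewrite mxE. Qed.

(** The ratio test of the simplex method: t is the largest step along w that keeps all coefficients
    nonnegative, and i0 is a coefficient that reaches 0. *)
Lemma pivot n (c w : 'rV[R]_n) i1 : (forall i, 0 <= c ord0 i) -> w ord0 i1 < 0 ->
  exists t i0, [/\ w ord0 i0 < 0, t = c ord0 i0 / - w ord0 i0,
    forall i, 0 <= (c + t *: w) ord0 i & (c + t *: w) ord0 i0 = 0].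
Proof.
move=> c0 wi1.
case: (@arg_minP _ R 'I_n i1 (fun i => w ord0 i < 0)
  (fun i => c ord0 i / - w ord0 i) wi1) => i0 wi0 H.
exists (c ord0 i0 / - w ord0 i0), i0; split=> //.
- move=> i; rewrite !mxE.
  have t0 : 0 <= c ord0 i0 / - w ord0 i0 by rewrite divr_ge0// oppr_ge0 ltW.
  have [wi|wi] := ltP (w ord0 i) 0; last by rewrite addr_ge0// mulr_ge0.
  have := H _ wi; rewrite ler_pdivlMr ?oppr_gt0// mulrN => /=.
  by rewrite -subr_ge0 opprK.
- by rewrite !mxE; field; rewrite lt_eqF.
Qed.

Lemma delta_subE n (c : 'rV[R]_n) i j :
  (delta_mx ord0 j - c) ord0 i = (i == j)%:R - c ord0 i.
Proof. by rewrite !mxE eqxx. Qed.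

Definition supp n (c : 'rV[R]_n) : {set 'I_n} := [set i | c ord0 i != 0].

Lemma suppP n (c : 'rV[R]_n) (I : {set 'I_n}) :
  reflect (forall i, i \notin I -> c ord0 i = 0) (supp c \subset I).
Proof.
apply: (iffP fintype.subsetP) => [cI i|cI i]; rewrite ?inE.
  by apply: contraNeq => ci; apply: cI; rewrite inE.
by apply: contraNT => /cI ->.
Qed.

End pivot.

Section coords.
Context {R : realType}.
Variables b m : nat.
Local Notation d := b.+1.
Local Notation n := (b.+1 + m)%N.
Variable X : 'M[R]_(n, d).
Implicit Types (I J : {set 'I_n}) (v : 'rV[R]_d) (c : 'rV[R]_n).

Definition vertices I : 'M[R]_d := rowsub (sel I) X.
(** The coefficients of [v] in the basis of rows [I], padded with zeros to a vector indexed by all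
    rows, so that different bases can be compared. *)
Definition coords I v : 'rV[R]_n :=
  v *m invmx (vertices I) *m rowsub (sel I) 1%:M.

Lemma verticesE I : vertices I = rowsub (sel I) 1%:M *m X.
Proof. exact: rowsubE. Qed.

Lemma coordsK I v : \det (vertices I) != 0 -> coords I v *m X = v.
Proof.
by move=> dI; rewrite -mulmxA -verticesE mulmxKV// unitmxE unitfE.
Qed.

Lemma mul_rowsub1 I (c : 'rV[R]_d) i :
  (c *m rowsub (sel I) 1%:M) ord0 i = \sum_k c ord0 k * (sel I k == i)%:R.
Proof. by rewrite mxE; apply: eq_bigr => k _; rewrite !mxE. Qed.

Lemma mul_rowsub1_sel I (c : 'rV[R]_d) k :
  (c *m rowsub (sel I) 1%:M) ord0 (sel I k) = c ord0 k.
Proof.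
rewrite mul_rowsub1 (bigD1 k)//= eqxx mulr1 big1 ?addr0// => j jk.
by rewrite (inj_eq (@sel_inj b m I)) (negbTE jk) mulr0.
Qed.

Lemma supp_coords I v : #|I| = d -> supp (coords I v) \subset I.
Proof.
move=> cI; apply/suppP => i iI; rewrite mul_rowsub1 big1// => k _.
case: eqP => [ki|_]; last by rewrite mulr0.
by move: iI; rewrite -ki sel_in cI ltn_ord.
Qed.

Lemma coords_uniq I c : #|I| = d -> \det (vertices I) != 0 ->
  supp c \subset I -> c = coords I (c *m X).
Proof.
move=> cI dI /suppP sc.
have cE : c = (\row_k c ord0 (sel I k)) *m rowsub (sel I) 1%:M.
  apply/rowP => i; have [iI|iI] := boolP (i \in I).
    have [k ->] := sel_surj (eq_leq cI) iI.
    by rewrite mul_rowsub1_sel mxE.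
  rewrite sc// mul_rowsub1 big1// => k _.
  case: eqP => [ki|_]; last by rewrite mulr0.
  by move: iI; rewrite -ki sel_in cI ltn_ord.
rewrite {2}cE -mulmxA -verticesE /coords mulmxK// unitmxE unitfE//.
Qed.

Definition normal I : 'cV[R]_d := facet_normal (vertices I).

Lemma rsum_coords I v : \det (vertices I) != 0 ->
  rsum (coords I v) = (v *m normal I) ord0 ord0.
Proof.
move=> dI; rewrite rsumE /normal facet_normalE// -!mulmxA mul_rowsub_mx mul1mx.
by congr ((_ *m (_ *m _)) _ _); apply/matrixP => i j; rewrite !mxE.
Qed.

Lemma mul_normal I i : #|I| = d -> \det (vertices I) != 0 -> i \in I ->
  (X *m normal I) i ord0 = 1.
Proof.
move=> cI dI iI; have [k ->] := sel_surj (eq_leq cI) iI.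
have : vertices I *m normal I = const_mx 1.
  by rewrite /normal facet_normalE// mulKVmx// unitmxE unitfE.
move/matrixP/(_ k ord0); rewrite [RHS]mxE => <-.
by rewrite verticesE -mulmxA -rowsubE [RHS]mxE.
Qed.

Lemma mul_normal_sum c I :
  (c *m X *m normal I) ord0 ord0 = \sum_i c ord0 i * (X *m normal I) i ord0.
Proof. by rewrite -mulmxA mxE. Qed.

Hypothesis generic : forall I, #|I| = d -> \det (vertices I) != 0.

(* Caratheodory, moving along a relation between the rows in the direction that
   does not increase the coefficient sum. *)
Lemma rsum_coords_le c : (forall i, 0 <= c ord0 i) ->
  exists I, [/\ #|I| = d, forall i, 0 <= coords I (c *m X) ord0 i &
    rsum (coords I (c *m X)) <= rsum c].
Proof.
have [k] : exists k, (#|supp c| < k)%N by exists #|supp c|.+1.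
elim: k c => // k IH c ck c0.
have [cd|cd] := leqP #|supp c| d.
  (* A support with at most [d] elements is completed to a basis; genericity makes every such set a
     basis. *)
  pose I := [set sel (supp c) k | k : 'I_d].
  have cI : #|I| = d by exact: card_sel.
  have sI : supp c \subset I.
    apply/fintype.subsetP => i /(sel_surj cd) [j ->]; exact: imset_f.
  have E : coords I (c *m X) = c by rewrite -(coords_uniq cI (generic cI) sI).
  by exists I; rewrite E; split=> //; exact: lexx.
pose I := [set sel (supp c) k | k : 'I_d].
have cI : #|I| = d by exact: card_sel.
have dI := generic cI.
have Ic : I \subset supp c.
  by apply/fintype.subsetP => _ /imsetP[j _ ->]; rewrite sel_in (leq_trans _ (ltnW cd)).
have [j jc jI] : exists2 j, j \in supp c & j \notin I.
  by have /fintype.subsetPn[j] : ~~ (supp c \subset I);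
    [apply: contraTN cd => /subset_leq_card; rewrite cI -leqNgt|exists j].
(* Row j minus its expansion in the basis [I]: a linear relation among the rows, supported in
   [supp c]. *)
pose w : 'rV[R]_n := delta_mx ord0 j - coords I (row j X).
have wX : w *m X = 0 by rewrite mulmxBl coordsK// -rowE subrr.
have sw : supp w \subset supp c.
  apply/suppP => i ic; rewrite delta_subE.
  rewrite (suppP _ _ (supp_coords (row j X) cI)) ?subr0; last first.
    by apply: contra ic => /(fintype.subsetP Ic).
  by case: eqP => [ij|//]; move: ic; rewrite ij jc.
have wj : w ord0 j = 1.
  by rewrite delta_subE eqxx (suppP _ _ (supp_coords (row j X) cI))// subr0.
have [w' [wX' sw' w'j tw']] : exists w' : 'rV[R]_n,
    [/\ w' *m X = 0, supp w' \subset supp c, w' ord0 j != 0 & rsum w' <= 0].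
  have [tw|tw] := leP (rsum w) 0; first by exists w; rewrite wj oner_eq0.
  exists (- 1 *: w); split.
  - by rewrite -scalemxAl wX scaler0.
  - by apply/suppP => i /(suppP _ _ sw) wi; rewrite mxE wi mulr0.
  - by rewrite mxE wj mulr1 oppr_eq0 oner_eq0.
  - by rewrite rsumZ mulN1r oppr_le0 ltW.
(* Otherwise w' would be nonnegative with nonpositive sum, hence zero, against its entry at j. *)
have [i1 wi1] : exists i, w' ord0 i < 0.
  apply/existsP; apply: contraT; rewrite negb_exists => /forallP w0.
  have w0' i : 0 <= w' ord0 i by rewrite leNgt.
  have : rsum w' == 0 by rewrite eq_le tw' sumr_ge0.
  rewrite psumr_eq0// => /allP/(_ j); rewrite mem_index_enum => /(_ isT).
  by rewrite (negbTE w'j).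
have [t [i0 [wi0 tE c'0 c'i0]]] := pivot c0 wi1.
have t0 : 0 <= t by rewrite tE divr_ge0// oppr_ge0 ltW.
have c'X : (c + t *: w') *m X = c *m X.
  by rewrite mulmxDl -scalemxAl wX' scaler0 addr0.
have [||J [cJ J0 Jt]] := IH (c + t *: w').
- apply: (leq_trans _ (ck : (#|supp c| <= k)%N)); apply: proper_card.
  rewrite fintype.properE; apply/andP; split.
    apply/suppP => i ic; rewrite !mxE (suppP _ _ sw')// mulr0 addr0.
    by move: ic; rewrite inE negbK => /eqP.
  apply/fintype.subsetPn; exists i0; last by rewrite inE c'i0 eqxx.
  by apply: (fintype.subsetP sw'); rewrite inE lt_eqF.
- exact: c'0.
exists J; rewrite c'X in J0 Jt; split=> //; apply: (le_trans Jt).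
by rewrite rsumD rsumZ gerDl mulr_ge0_le0.
Qed.

(* [I] is an optimal basis of the program minimising [rsum c] subject to [0 <= c]
   and [c *m X = v]; the last clause is dual feasibility of [normal I]. *)
Definition optimal I v :=
  [forall i in I, 0 < coords I v ord0 i] && (rsum (coords I v) < 1) &&
  [forall j in ~: I, (X *m normal I) j ord0 < 1].

(** Strict weak duality: pairing the expansion of v in J with the normal of I shows that the sum for
    I is smaller than the sum for J unless J lies in I. Exchanging I and J gives a contradiction. *)
Lemma optimal_uniq I J v : #|I| = d -> #|J| = d -> optimal I v -> optimal J v ->
  I = J.
Proof.
move=> cI cJ /andP[/andP[/forall_inP I0 _] /forall_inP In].
move=> /andP[/andP[/forall_inP J0 _] /forall_inP Jn].
have lt (I' J' : {set 'I_n}) : #|I'| = d -> #|J'| = d ->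
    (forall i, i \in J' -> 0 < coords J' v ord0 i) ->
    (forall j, j \in ~: I' -> (X *m normal I') j ord0 < 1) ->
    ~~ (J' \subset I') -> rsum (coords I' v) < rsum (coords J' v).
  move=> cI' cJ' J'0 I'n /fintype.subsetPn[j jJ jI].
  have dI := generic cI'; have dJ := generic cJ'.
  rewrite (rsum_coords _ dI) -{1}(coordsK v dJ) mul_normal_sum /rsum.
  have le1 i : (X *m normal I') i ord0 <= 1.
    have [iI|iI] := boolP (i \in I'); first by rewrite mul_normal.
    by rewrite ltW// I'n// inE.
  have ge0 i : 0 <= coords J' v ord0 i.
    have [iJ|iJ] := boolP (i \in J'); first by rewrite ltW// J'0.
    by rewrite (suppP _ _ (supp_coords v cJ')).
  rewrite (bigD1 j)//= [ltRHS](bigD1 j)//= ltr_leD//.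
    by rewrite gtr_pMr ?J'0// I'n// inE.
  by apply: ler_sum => i _; rewrite ler_piMr.
apply/eqP; rewrite eqEcard cI cJ leqnn andbT; apply: contraT => IJ.
have JI : ~~ (J \subset I).
  apply: contra IJ => JI; have : J == I by rewrite eqEcard JI cI cJ leqnn.
  by move/eqP => ->.
have := lt _ _ cI cJ J0 In JI; have := lt _ _ cJ cI I0 Jn IJ.
by move=> /lt_trans H /H; rewrite ltxx.
Qed.

(* At a basis of minimal coefficient sum, a row beyond the facet could be
   pivoted in and would lower the sum. *)
Lemma optimal_exists v I0 :
  (forall I, #|I| = d -> forall i, i \in I -> coords I v ord0 i != 0) ->
  (forall I, #|I| = d -> rsum (coords I v) != 1) ->
  (forall I, #|I| = d -> forall j, j \notin I -> (X *m normal I) j ord0 != 1) ->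
  #|I0| = d -> (forall i, 0 <= coords I0 v ord0 i) -> rsum (coords I0 v) <= 1 ->
  exists2 I : {set 'I_n}, #|I| = d & optimal I v.
Proof.
move=> v0 v1 X1 cI0 I00 I01.
pose F (I : {set 'I_n}) := (#|I| == d) && [forall i, 0 <= coords I v ord0 i].
have FI0 : F I0 by apply/andP; split; [exact/eqP|exact/forallP].
case: (@arg_minP _ R _ I0 F (fun I => rsum (coords I v)) FI0) => I /andP[/eqP cI /forallP I00' H].
exists I => //.
have dI := generic cI.
have ipos i : i \in I -> 0 < coords I v ord0 i.
  by move=> iI; rewrite lt_neqAle I00' andbT eq_sym v0.
apply/andP; split; first (apply/andP; split).
- exact/forall_inP.
- by rewrite lt_neqAle v1//= (le_trans (H _ FI0)).
apply/forall_inP => j; rewrite inE => jI.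
rewrite lt_neqAle X1//= leNgt; apply/negP => j1.
pose mu := coords I (row j X).
have muX : mu *m X = row j X by rewrite coordsK.
have smu := supp_coords (row j X) cI.
pose w : 'rV[R]_n := delta_mx ord0 j - mu.
have wX : w *m X = 0 by rewrite mulmxBl muX -rowE subrr.
have tmu : rsum mu = (X *m normal I) j ord0.
  by rewrite rsum_coords// rowE -mulmxA -rowE mxE.
have tw : rsum w < 0.
  rewrite /w rsumD -[- mu]scaleN1r rsumZ tmu mulN1r subr_lt0.
  suff -> : rsum (delta_mx ord0 j : 'rV[R]_n) = 1 by [].
  rewrite /rsum (bigD1 j)//= mxE !eqxx big1 ?addr0// => i ij.
  by rewrite mxE eqxx (negbTE ij).
have wj : w ord0 j = 1.
  by rewrite delta_subE eqxx (suppP _ _ smu)// subr0.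
have [i1 wi1] : exists i, w ord0 i < 0.
  apply/existsP; apply: contraT; rewrite negb_exists => /forallP w0.
  have : 0 <= rsum w by apply: sumr_ge0 => i _; rewrite leNgt.
  by rewrite leNgt tw.
have [t [i0 [wi0 tE c0 ci0]]] := pivot I00' wi1.
(* Outside [I] the relation [w] vanishes except for the value 1 at j, so a negative entry sits in
   [I]. *)
have i0I : i0 \in I.
  apply: contraLR wi0 => i0I; rewrite -leNgt delta_subE (suppP _ _ smu)// subr0.
(* Nondegeneracy of [v] makes the step strictly positive, so the sum drops strictly; j enters the
   basis and i0 leaves it. *)
have t0 : 0 < t by rewrite tE divr_gt0 ?ipos// oppr_gt0.
pose J := j |: I :\ i0.
have cJ : #|J| = d.
  rewrite cardsU1 !inE (negbTE jI) andbF /=.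
  by move: cI; rewrite (cardsD1 i0) i0I.
have cX : (coords I v + t *: w) *m X = v.
  by rewrite mulmxDl -scalemxAl wX scaler0 addr0 coordsK.
have sJ : supp (coords I v + t *: w) \subset J.
  apply/suppP => i; rewrite in_setU1 in_setD1 negb_or negb_and negbK.
  move=> /andP[ij /orP[/eqP ->//|iI]].
  rewrite mxE (suppP _ _ (supp_coords v cI))// mxE delta_subE (negbTE ij).
  by rewrite (suppP _ _ smu)// subr0 mulr0 addr0.
have E := coords_uniq cJ (generic cJ) sJ; rewrite cX in E.
have FJ : F J by rewrite /F cJ eqxx /=; apply/forallP => i; rewrite -E.
have := H _ FJ; rewrite -E rsumD rsumZ lerDl.
by rewrite leNgt pmulr_rlt0// tw.
Qed.

End coords.

(** * Volume of the hull *)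

Section hull.
Context {R : realFieldType}.
Local Open Scope convex_scope.

Lemma convex_set_comb (E : lmodType R) (A : set E) (x y : E) (t : R) :
  convex_set A -> A x -> A y -> 0 <= t -> t <= 1 -> A (t *: x + (1 - t) *: y).
Proof.
move=> cA Ax Ay t0 t1; have := cA x y (Itv01 t0 t1).
by rewrite !inE => /(_ Ax Ay).
Qed.

(** Since 0 belongs to [A], weights of sum at most 1 suffice. The induction splits off the first
    weight and rescales the others by its complement to 1. *)
Lemma convex_set_sum (E : lmodType R) (A : set E) k (c : 'I_k -> R) (x : 'I_k -> E) :
  convex_set A -> A 0 -> (forall i, A (x i)) ->
  (forall i, 0 <= c i) -> \sum_i c i <= 1 -> A (\sum_i c i *: x i).
Proof.
move=> cA A0; elim: k c x => [|k IH] c x Ax c0 c1; first by rewrite big_ord0.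
rewrite big_ord_recl in c1; rewrite big_ord_recl.
have s0 : 0 <= \sum_(i < k) c (lift ord0 i) by apply: sumr_ge0.
have [e|ne] := eqVneq (c ord0) 1.
  have /eqP : \sum_(i < k) c (lift ord0 i) == 0.
    by rewrite eq_le s0 andbT -(lerD2l 1) addr0 -{1}e.
  move/eqP; rewrite psumr_eq0// => /allP H.
  rewrite e scale1r big1 ?addr0// => i _.
  by have /eqP -> := H i (mem_index_enum _); rewrite scale0r.
have lt1 : c ord0 < 1 by rewrite lt_neqAle ne (le_trans _ c1)// lerDl.
have u0 : 0 < 1 - c ord0 by rewrite subr_gt0.
have -> : \sum_(i < k) c (lift ord0 i) *: x (lift ord0 i) =
    (1 - c ord0) *: \sum_(i < k) (c (lift ord0 i) / (1 - c ord0)) *: x (lift ord0 i).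
  rewrite scaler_sumr; apply: eq_bigr => i _.
  by rewrite scalerA mulrC divfK// gt_eqF.
apply: convex_set_comb => //; last exact: ltW.
apply: IH => //.
- by move=> i; rewrite divr_ge0// ltW.
- by rewrite -mulr_suml ler_pdivrMr// mul1r lerBrDl.
Qed.

Lemma convex_hull0P (E : lmodType R) n (x : 'I_n -> E) (v : E) :
  convex_hull ([set 0] `|` range x) v <->
  exists c : 'I_n -> R, [/\ forall i, 0 <= c i, \sum_i c i <= 1 & v = \sum_i c i *: x i].
Proof.
split=> [|[c [c0 c1 ->]] A [cA Ax]]; last first.
  apply: convex_set_sum => //; first by apply: Ax; left.
  by move=> i; apply: Ax; right; exists i.
move=> /(_ [set v | exists c : 'I_n -> R,
    [/\ forall i, 0 <= c i, \sum_i c i <= 1 & v = \sum_i c i *: x i]]).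
apply; split; last first.
  move=> _ [->|[i _ <-]].
    exists (fun=> 0); split=> //; first by rewrite big1.
    by rewrite big1// => i _; rewrite scale0r.
  exists (fun j => (j == i)%:R); split=> //.
  - by rewrite (bigD1 i)//= eqxx big1 ?addr0// => j /negbTE ->.
  - rewrite (bigD1 i)//= eqxx scale1r big1 ?addr0// => j /negbTE ->.
    by rewrite scale0r.
move=> _ _ t /set_mem[c [c0 c1 ->]] /set_mem[e [e0 e1 ->]]; apply/mem_set.
have t0 : 0 <= t%:num by [].
have t1 : t%:num <= 1 by [].
exists (fun i => t%:num * c i + (1 - t%:num) * e i); split.
- by move=> i; rewrite addr_ge0// mulr_ge0// subr_ge0.
- rewrite big_split /= -!mulr_sumr -[leRHS](subrK t%:num) addrC.
  rewrite lerD ?ler_piMr// ?subr_ge0//.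
- rewrite /conv /= !scaler_sumr -big_split; apply: eq_bigr => i _ /=.
  by rewrite !scalerA -scalerDl.
Qed.

End hull.

Section simplex.
Context {R : realType}.
Local Notation mu := (@lebesgue_measure R).

Definition open_simplex n (s : R) : set 'rV[R]_n :=
  [set x : 'rV[R]_n | (forall i, 0 < x ord0 i) /\ rsum x < s].
Arguments open_simplex n s : clear implicits.

Lemma measurable_halfline (s : R) : measurable [set t : R | t < s].
Proof.
by rewrite (_ : [set t | _] = `]-oo, s[%classic)//; apply/seteqP; split=> x /=; rewrite in_itv.
Qed.

Lemma measurable_posline : measurable [set t : R | 0 < t].
Proof.
rewrite (_ : [set t | _] = `]0, +oo[%classic)//.
by apply/seteqP; split=> x /=; rewrite in_itv /= andbT.
Qed.

Lemma measurable_rsum n : measurable_fun setT (@rsum R n).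
Proof. by apply: measurable_sum => i; exact: measurable_coord. Qed.

Lemma measurable_open_simplex n s : measurable (open_simplex n s).
Proof.
rewrite (_ : open_simplex n s = rV_box (fun=> [set t : R | 0 < t]) `&`
    (@rsum R n) @^-1` [set t | t < s])//.
apply: measurableI; first by apply: measurable_rV_box => i; exact: measurable_posline.
rewrite -[X in measurable X]setTI; apply: measurable_rsum => //.
exact: measurable_halfline.
Qed.

Lemma open_simplex_cons n s (t : R) (y : 'rV[R]_n) :
  open_simplex n.+1 s (cons_rV (t, y)) <-> 0 < t /\ open_simplex n (s - t) y.
Proof.
have E : rsum (cons_rV (t, y)) = t + rsum y.
  rewrite /rsum big_ord_recl cons_rV0; congr (_ + _); apply: eq_bigr => i _.
  by rewrite cons_rVS.
rewrite /open_simplex /= E ltrBrDl; split=> [[y0 ys]|[t0 [y0 ys]]].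
  split; first by have := y0 ord0; rewrite cons_rV0.
  by split=> // i; have := y0 (lift ord0 i); rewrite cons_rVS.
split=> // i; have [j ->|->] := unliftP ord0 i; first by rewrite cons_rVS.
by rewrite cons_rV0.
Qed.

(** The integral of the slice volumes of a simplex of size s; the indicator covers s <= 0, where the
    simplex is empty. *)
Lemma integral_simplex_slice (s : R) n :
  (\int[mu]_t (\1_`]0, s[ t * ((s - t) ^+ n / n`!%:R))%:E =
   (\1_[set t : R | 0 < t] s * (s ^+ n.+1 / n.+1`!%:R))%:E)%E.
Proof.
pose f (t : R) := (s - t) ^+ n / n`!%:R.
have cf : continuous f.
  have cs : continuous (fun t : R => s - t).
    by move=> x; apply: cvgB; [exact: cvg_cst|exact: cvg_id].
  move=> x; apply: cvgM; last exact: cvg_cst.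
  have H := @continuous_funX R (fun t : R => s - t) n cs; exact: H.
have -> : (\int[mu]_t (\1_`]0%R, s[ t * ((s - t) ^+ n / n`!%:R))%:E =
    \int[mu]_(t in `]0%R, s[) (f t)%:E)%E.
  rewrite [RHS]integral_mkcond; apply: eq_integral => t _; rewrite patchE indicE.
  by case: (t \in _); rewrite ?mul1r ?mul0r.
have [s0|s0] := ltP 0 s; last first.
  rewrite set_itv_ge ?integral_set0 ?bnd_simp -?leNgt// indicE memNset ?mul0r//=.
  by apply/negP; rewrite -leNgt.
rewrite indicE mem_set//= mul1r.
rewrite -(integral_itv_bndoo true false); last first.
  by apply: measurable_funTS; apply/measurable_EFinP; exact: continuous_measurable_fun.
pose F (t : R) := - n.+1`!%:R^-1 * (s - t) ^+ n.+1.
have n0 : n.+1%:R != 0 :> R by rewrite pnatr_eq0.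
have nf : n`!%:R != 0 :> R by rewrite pnatr_eq0 -lt0n fact_gt0.
have dF (x : R) : is_derive x 1 F (f x).
  have -> : F = (- n.+1`!%:R^-1) *: ((cst s - id) ^+ n.+1).
    by apply/funext => t; rewrite /F /GRing.scale /= exprfctE.
  apply: is_derive_eq; rewrite /GRing.scale /= /f factS natrM.
  rewrite (_ : (cst s - id) x = s - x)//.
  by move: (n.+1%:R : R) (n`!%:R : R) n0 nf => a c a0 c0; field; rewrite a0 c0.
rewrite (integral_derive dF cf (ltW s0)) /F subrr expr0n /= mulr0 sub0r subr0.
by rewrite mulNr opprK mulrC.
Qed.

Lemma lebesgue_open_simplex n (s : R) :
  lebesgue_rV n (open_simplex n s) = (\1_[set t : R | 0 < t] s * (s ^+ n / n`!%:R))%:E.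
Proof.
rewrite -(setIT (open_simplex n s)) -integral_indic//; last exact: measurable_open_simplex.
elim: n s => [|n IH] s.
  rewrite ge0_integral_rV0//.
  rewrite expr0 fact0 divr1 mulr1 !indicE; congr (_%:R%:E); congr nat_of_bool.
  apply/idP/idP; rewrite !inE /open_simplex /= /rsum big_ord0; first by case.
  by split=> // -[].
rewrite ge0_integral_rVS; last 2 first.
- by apply/measurable_EFinP; apply: measurable_indic; exact: measurable_open_simplex.
- by move=> x; rewrite lee_fin.
rewrite -integral_simplex_slice; apply: eq_integral => t _.
have E y : ((\1_(open_simplex n.+1 s) (cons_rV (t, y)))%:E =
    (\1_[set t : R | (0 < t)%R] t)%:E * (\1_(open_simplex n (s - t)%R) y)%:E)%E.
  rewrite -EFinM !indicE -natrM mulnb; congr (nat_of_bool _)%:R%:E.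
  apply/idP/andP; rewrite !inE => /open_simplex_cons //.
under eq_integral do rewrite E.
rewrite ge0_integralZl_EFin//; last first.
  by apply/measurable_EFinP; apply: measurable_indic; exact: measurable_open_simplex.
rewrite IH -EFinM mulrA; congr ((_ * _)%:E).
rewrite !indicE -natrM mulnb; congr (nat_of_bool _)%:R.
by apply/andP/idP; rewrite !inE /= in_itv /= subr_gt0 => /andP.
Qed.

End simplex.

Arguments open_simplex {R} n s.

Section volume.
Context {R : realType}.
Local Notation mu := (@lebesgue_measure R).

Lemma measurable_mul_col n (u : 'cV[R]_n) :
  measurable_fun setT (fun v : 'rV[R]_n => (v *m u) ord0 ord0).
Proof.
apply: measurable_mulmx => // i j; rewrite (ord1 i); exact: measurable_coord.
Qed.

(** A line in the direction of a coordinate on which [u] does not vanish meets the hyperplane in one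
    point. *)
Lemma hyperplane_null n (u : 'cV[R]_n) (c : R) : u != 0 ->
  lebesgue_rV n [set v | (v *m u) ord0 ord0 = c] = 0%E.
Proof.
move=> u0; have [k uk] : exists k, u k ord0 != 0.
  apply/existsP; apply: contraNT u0; rewrite negb_exists => /forallP u0.
  by apply/eqP/colP => k; rewrite mxE; apply/eqP; have := u0 k; rewrite negbK.
apply: (@lebesgue_rV_null R n _ (delta_mx ord0 k)).
  rewrite (_ : [set v | _] = (fun v : 'rV[R]_n => (v *m u) ord0 ord0) @^-1` [set c]).
    by rewrite -[X in measurable X]setTI; apply: measurable_mul_col.
  by [].
move=> x; rewrite (_ : [set t | _] = [set (c - (x *m u) ord0 ord0) / u k ord0]).
  exact: lebesgue_measure_set1.
have E (t : R) : ((x + t *: delta_mx ord0 k) *m u) ord0 ord0 =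
    (x *m u) ord0 ord0 + t * u k ord0.
  by rewrite mulmxDl -scalemxAl -rowE !mxE.
apply/seteqP; split=> t /=; rewrite E.
  by move=> <-; rewrite addrAC subrr add0r mulfK.
by move=> ->; rewrite divfK// addrC subrK.
Qed.

Lemma ae_hyperplane n (u : 'cV[R]_n) (c : R) : u != 0 ->
  {ae lebesgue_rV n, forall v, (v *m u) ord0 ord0 != c}.
Proof.
move=> u0; exists [set v | (v *m u) ord0 ord0 = c]; split.
- rewrite (_ : [set v | _] = (fun v : 'rV[R]_n => (v *m u) ord0 ord0) @^-1` [set c]).
    by rewrite -[X in measurable X]setTI; apply: measurable_mul_col.
  by [].
- exact: hyperplane_null.
- by move=> v /= /negP; rewrite negbK => /eqP.
Qed.

Lemma facet_normal_neq0 n (A : 'M[R]_n.+1) : \det A != 0 -> facet_normal A != 0.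
Proof.
move=> dA; rewrite facet_normalE//; apply/eqP => /(congr1 (mulmx A)).
rewrite mulKVmx ?unitmxE ?unitfE// mulmx0 => /matrixP/(_ ord0 ord0); rewrite !mxE => /eqP.
by rewrite oner_eq0.
Qed.

Lemma integral_simplex n (A : 'M[R]_n) : \det A != 0 ->
  (\int[lebesgue_rV n]_v (\1_(open_simplex n 1) (v *m invmx A))%:E =
   (`|\det A| / n`!%:R)%:E)%E.
Proof.
move=> dA; have uA : A \in unitmx by rewrite unitmxE unitfE.
have mS := @measurable_open_simplex R n 1.
rewrite -(lin_cov_unit uA); last 2 first.
- apply/measurable_EFinP; apply: (measurableT_comp (measurable_indic mS)).
  by apply: measurable_fun_mx_sum.
- by move=> x; rewrite lee_fin.
under eq_integral do rewrite mulmxK//.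
rewrite integral_indic// setIT.
apply: (eq_trans (congr1 (mule _) (lebesgue_open_simplex n 1))).
rewrite indicE mem_set/= ?mul1r// expr1n -EFinM.
by rewrite mul1r.
Qed.

Variables b m : nat.
Local Notation d := b.+1.
Local Notation n := (b.+1 + m)%N.
Variable X : 'M[R]_(n, d).
Hypothesis generic : forall I : {set 'I_n}, #|I| = d -> \det (vertices X I) != 0.
Hypothesis genericN : forall I : {set 'I_n}, #|I| = d ->
  forall j, j \notin I -> (X *m normal X I) j ord0 != 1.

Lemma hullP v : convex_hull ([set 0] `|` range (fun i => row i X)) v <->
  exists I : {set 'I_n}, [/\ #|I| = d, forall i, 0 <= coords X I v ord0 i &
    rsum (coords X I v) <= 1].
Proof.
rewrite convex_hull0P; split=> [[c [c0 c1 vE]]|[I [cI I0 I1]]]; last first.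
  exists (fun i => coords X I v ord0 i); split=> //.
  by rewrite -mulmx_sum_row coordsK//; exact: generic.
have c0' i : 0 <= (\row_i c i) ord0 i by rewrite mxE.
have [I [cI I0 I1]] := rsum_coords_le generic c0'.
have E : \row_i c i *m X = v.
  by rewrite mulmx_sum_row vE; apply: eq_bigr => i _; rewrite mxE.
rewrite E in I0 I1; exists I; split=> //; apply: (le_trans I1).
by rewrite /rsum; under eq_bigr do rewrite mxE.
Qed.

Lemma measurable_hull :
  measurable (convex_hull ([set 0] `|` range (fun i => row i X))).
Proof.
rewrite (_ : convex_hull _ = \big[setU/set0]_(I : {set 'I_n} | #|I| == d)
    [set v | (forall i, 0 <= coords X I v ord0 i) /\ rsum (coords X I v) <= 1]).
  apply: bigsetU_measurable => I _.
  have mc i : measurable_fun setT (fun v : 'rV[R]_d => coords X I v ord0 i).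
    move: i; apply/measurable_fun_rVP; rewrite /coords.
    by do 2 apply: measurable_fun_mx_sum.
  rewrite (_ : [set v | _] = (\bigcap_(i in [set: 'I_n]) ((fun v => coords X I v ord0 i) @^-1` `[0, +oo[%classic))
      `&` (fun v => rsum (coords X I v)) @^-1` `]-oo, 1]%classic).
    apply: measurableI.
      apply: fin_bigcap_measurable => [|i _]; first exact: finite_finset.
      by rewrite -[X in measurable X]setTI; apply: mc.
    by rewrite -[X in measurable X]setTI; apply: measurable_sum.
  apply/seteqP; split=> v /=.
    by move=> [v0 v1]; split=> [i _|]; rewrite /= in_itv/= ?andbT.
  move=> [v0 v1]; split; last by move: v1; rewrite in_itv.
  by move=> i; have := v0 i Logic.I; rewrite /= in_itv/= andbT.
apply/seteqP; split=> v.
  move/hullP => [I [/eqP cI I0 I1]]; rewrite -bigcup_seq_cond/=.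
  by exists I => //=; rewrite mem_index_enum.
rewrite -bigcup_seq_cond/= => -[I /= /andP[_ /eqP cI] [I0 I1]].
by apply/hullP; exists I.
Qed.

(** Dual feasibility of [normal X I], which does not involve v, as a real factor with values 0 and
    1. *)
Definition facet (I : {set 'I_n}) : R :=
  \prod_(j in ~: I) \1_[set t : R | t < 1] ((X *m normal X I) j ord0).

Lemma prod_indic_lt1 (T : finType) (A : {set T}) (f : T -> R) :
  \prod_(j in A) (\1_[set t : R | t < 1] (f j) : R) = [forall j in A, f j < 1]%:R :> R.
Proof.
have E j : (f j \in [set t : R | t < 1]) = (f j < 1).
  by apply/idP/idP; rewrite inE.
have [/forall_inP H|] := boolP [forall j in A, f j < 1].
  by rewrite big1// => j jA; rewrite indicE E H.
rewrite negb_forall_in => /exists_inP[j jA fj].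
by rewrite (bigD1 j)//= indicE E (negbTE fj) mul0r.
Qed.

Lemma open_simplex_coords (I : {set 'I_n}) v : #|I| = d ->
  (v *m invmx (vertices X I) \in open_simplex d 1) =
  [forall i in I, 0 < coords X I v ord0 i] && (rsum (coords X I v) < 1).
Proof.
move=> cI; have dI := generic cI.
have E : rsum (v *m invmx (vertices X I)) = rsum (coords X I v).
  by rewrite rsum_coords// rsumE /normal facet_normalE// mulmxA.
apply/idP/andP; rewrite inE /= /open_simplex /= E => -[v0 v1]; split=> //.
  apply/forall_inP => i /(sel_surj (eq_leq cI))[k ->].
  by rewrite mul_rowsub1_sel.
move=> k; have /forall_inP/(_ (sel I k)) := v0.
by rewrite sel_in cI ltn_ord mul_rowsub1_sel => /(_ isT).
Qed.

Lemma optimalE (I : {set 'I_n}) v : #|I| = d ->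
  (optimal X I v)%:R = (\1_(open_simplex d 1) (v *m invmx (vertices X I)) * facet I : R).
Proof.
by move=> cI; rewrite indicE open_simplex_coords// /facet prod_indic_lt1 -natrM mulnb.
Qed.

Lemma optimal_hull (I : {set 'I_n}) v : #|I| = d -> optimal X I v ->
  convex_hull ([set 0] `|` range (fun i => row i X)) v.
Proof.
move=> cI /andP[/andP[/forall_inP v0 v1] _]; apply/hullP; exists I; split=> //.
  move=> i; have [iI|iI] := boolP (i \in I); first exact/ltW/v0.
  by rewrite (suppP _ _ (supp_coords X v cI)).
exact: ltW.
Qed.

(** Each excluded equality confines v to a hyperplane, and there are finitely many. These are the
    nondegeneracy assumptions of [optimal_exists]. *)
Lemma ae_coords : {ae lebesgue_rV d, forall v, forall I : {set 'I_n}, #|I| = d ->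
  (forall i, i \in I -> coords X I v ord0 i != 0) /\ rsum (coords X I v) != 1}.
Proof.
apply: filter_forall => I.
have [cI|cI] := eqVneq #|I| d; last by apply: aeW => v /eqP; rewrite (negbTE cI).
have dI := generic cI.
have H1 : {ae lebesgue_rV d, forall v, forall k, (v *m col k (invmx (vertices X I))) ord0 ord0 != 0}.
  apply: filter_forall => k; apply: ae_hyperplane.
  apply/eqP => /(congr1 (mulmx (vertices X I))).
  rewrite colE mulKVmx ?unitmxE ?unitfE// mulmx0 => /matrixP/(_ k ord0).
  by rewrite !mxE !eqxx => /eqP; rewrite oner_eq0.
have H2 := ae_hyperplane 1 (facet_normal_neq0 dI).
apply: filterS2 H1 H2 => v v0 v1 _; split.
  move=> i /(sel_surj (eq_leq cI))[k ->]; rewrite mul_rowsub1_sel.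
  by have := v0 k; rewrite colE mulmxA -colE mxE.
by rewrite rsum_coords.
Qed.

(** For almost every v of the hull exactly one [I] is optimal, so the indicator of the hull is the
    sum of those of [optimal X I]. Each such region is an open simplex of volume |det| / d! or
    empty, as [facet] decides. *)
Lemma lebesgue_hull :
  lebesgue_rV d (convex_hull ([set 0] `|` range (fun i => row i X))) =
  (\sum_(I : {set 'I_n} | #|I| == d) `|\det (vertices X I)| / d`!%:R * facet I)%:E.
Proof.
have mH := measurable_hull.
have mS := @measurable_open_simplex R d 1.
have f0 I : 0 <= facet I by apply: prodr_ge0 => j _.
pose g I (v : 'rV[R]_d) : \bar R :=
  (\1_(open_simplex d 1) (v *m invmx (vertices X I)) * facet I)%:E.
have mg I : measurable_fun setT (g I).
  apply/measurable_EFinP; apply: measurable_funM => //.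
  by apply: (measurableT_comp (measurable_indic mS)); apply: measurable_fun_mx_sum.
have g0 I v : (0 <= g I v)%E by rewrite lee_fin mulr_ge0.
transitivity (\int[lebesgue_rV d]_v \sum_(I : {set 'I_n} | #|I| == d) g I v)%E.
  rewrite -[X in lebesgue_rV d X]setIT -integral_indic//.
  apply: ge0_ae_eq_integral => //.
  - exact/measurable_EFinP/measurable_indic.
  - under eq_fun do rewrite -big_filter.
    by apply: emeasurable_sum.
  - by move=> v _; exact: sume_ge0.
  apply: filterS ae_coords => v gv _ /=.
  have -> : (\sum_(I : {set 'I_n} | #|I| == d) g I v =
      (\sum_(I : {set 'I_n} | #|I| == d) (optimal X I v)%:R : R)%:E)%E.
    by rewrite -sumEFin; apply: eq_bigr => I /eqP cI; rewrite optimalE.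
  congr (_%:E); rewrite indicE.
  have [|vH] := boolP (v \in _).
    rewrite inE => /hullP[I0 [cI0 v0 v1]].
    have [I cI oI] := optimal_exists generic (fun I cI => (gv I cI).1)
      (fun I cI => (gv I cI).2) genericN cI0 v0 v1.
    rewrite (bigD1 I) ?cI//= oI big1 ?addr0// => J /andP[/eqP cJ JI].
    case: (boolP (optimal X J v)) => // oJ.
    by move: JI; rewrite (optimal_uniq generic cJ cI oJ oI) eqxx.
  rewrite big1// => I /eqP cI; case: (boolP (optimal X I v)) => // oI.
  by move: vH; rewrite mem_set//; exact: optimal_hull oI.
rewrite -sumEFin; under eq_integral do rewrite -big_filter.
rewrite ge0_integral_sum// big_filter; apply: eq_bigr => I /eqP cI.
rewrite /g; under eq_integral do rewrite mulrC EFinM.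
rewrite ge0_integralZl_EFin//; last first.
  apply/measurable_EFinP.
  by apply: (measurableT_comp (measurable_indic mS)); apply: measurable_fun_mx_sum.
by rewrite integral_simplex ?generic// -EFinM mulrC.
Qed.

End volume.

Section ae_integral.
Context d (T : measurableType d) (R : realType) (mu : {measure set T -> \bar R}).
Local Open Scope ereal_scope.

(** Measurability is not assumed: the integral of a nonnegative function is a supremum over the
    simple functions below it. *)
Lemma nnintegral_le (f g : T -> \bar R) : (forall x, 0 <= f x) -> (forall x, f x <= g x) ->
  \int[mu]_x f x <= \int[mu]_x g x.
Proof.
move=> f0 fg; rewrite !ge0_integralTE//; last by move=> x; exact: le_trans (fg x).
apply: ereal_sup_le => _ [h hf <-]; exists h => // x.
exact: le_trans (fg x).
Qed.

(* The function [f] need not be measurable; it is squeezed between two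
   measurable modifications of [g] on a null set. *)
Lemma ge0_integral_ae (f g : T -> \bar R) : (forall x, 0 <= f x) -> (forall x, 0 <= g x) ->
  measurable_fun setT g -> {ae mu, forall x, f x = g x} ->
  \int[mu]_x f x = \int[mu]_x g x.
Proof.
move=> f0 g0 mg [N [mN N0 fgN]].
have fE x : x \notin N -> f x = g x.
  move=> xN; apply: contrapT => fg; move/negP: xN; apply; apply/mem_set.
  exact: fgN.
pose h (y : \bar R) x := if x \in N then y else g x.
have mh y : measurable_fun setT (h y).
  apply: measurable_fun_ifT => //.
  by apply: (measurable_fun_bool true); rewrite setTI preimage_mem_true.
have h0 y x : 0 <= y -> 0 <= h y x by rewrite /h; case: ifP.
have hg y : 0 <= y -> \int[mu]_x h y x = \int[mu]_x g x.
  move=> y0; apply: ge0_ae_eq_integral => //; first by move=> x _; exact: h0.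
  exists N; split=> // x /=; apply: contra_notP => xN _; rewrite /h memNset//.
apply/eqP; rewrite eq_le -{1}(hg +oo)// -(hg 0 (lexx _)).
apply/andP; split; apply: nnintegral_le => // x; rewrite /h.
- by case: ifPn => [_|/fE ->//]; rewrite leey.
- by case: ifPn.
- by case: ifPn => [//|/fE ->].
Qed.

End ae_integral.

(** * Expected volume *)

Section expected_volume.
Context {R : realType}.

Lemma gint_null n (S : set 'rV[R]_n) : measurable S -> lebesgue_rV n S = 0%E ->
  gint (fun x => (\1_S x)%:E) = 0%E.
Proof.
move=> mS S0; rewrite /gint.
have mG : measurable_fun setT (fun x : 'rV[R]_n => (std_normal_density x)%:E).
  by apply/measurable_EFinP; exact: measurable_std_normal_density.
rewrite -[RHS](null_set_integral mS (measurable_funTS mG) S0).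
rewrite [RHS]integral_mkcond; apply: eq_integral => x _.
by rewrite patchE indicE; case: ifPn; rewrite ?mule1 ?mule0.
Qed.

Lemma gmx_eq0 n d (F : 'M[R]_(n, d) -> \bar R) : F =1 (fun=> 0%E) -> gmx F = 0%E.
Proof.
move=> F0; rewrite /gmx /gint; apply: integral0_eq => x _.
by rewrite F0 mule0.
Qed.

Lemma gmx_det_eq0 b : gmx (fun A : 'M[R]_b.+1 => (\1_[set 0 : R] (\det A))%:E) = 0%E.
Proof.
pose S := [set x : 'rV[R]_(b.+1 * b.+1) | \det (vec_mx x : 'M[R]_b.+1) = 0].
have SE : S = (fun x : 'rV[R]_(b.+1 * b.+1) => \det (vec_mx x : 'M[R]_b.+1)) @^-1` [set 0 : R] by [].
have mS : measurable S.
  rewrite SE -[X in measurable X]setTI; apply: measurable_det => // i j.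
  exact: measurable_vec_mx.
have := gint_null mS (@det_null R b).
by apply: eq_trans; apply: eq_gint => x; rewrite !indicE.
Qed.

(** For a nonzero [a] this is a hyperplane of flattened matrices. Requiring c to be nonzero covers a
    = 0 as well, the value of [facet_normal] at a singular matrix. *)
Lemma gmx_row_mul_eq n d (k : 'I_n) (a : 'cV[R]_d) (c : R) : c != 0 ->
  gmx (fun B : 'M[R]_(n, d) => (\1_[set c] ((row k B *m a) ord0 ord0))%:E) = 0%E.
Proof.
move=> c0; have [->|a0] := eqVneq a 0.
  apply: gmx_eq0 => B; rewrite mulmx0 mxE indicE memNset//=.
  by move=> c0'; rewrite -c0' eqxx in c0.
pose u : 'cV[R]_(n * d) := lin1_mx (mulmxr a \o row k \o vec_mx).
have uE (x : 'rV[R]_(n * d)) : x *m u = row k (vec_mx x) *m a.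
  by rewrite mul_rV_lin1.
have u0 : u != 0.
  apply: contra_neq a0 => u0; apply/colP => l; rewrite [RHS]mxE.
  have := uE (mxvec (delta_mx k l)); rewrite u0 mulmx0 mxvecK => /matrixP/(_ ord0 ord0).
  rewrite mxE => ->; rewrite (_ : row k _ = delta_mx ord0 l).
    by rewrite -rowE mxE.
  by apply/rowP => j; rewrite !mxE !eqxx.
have mS : measurable [set x : 'rV[R]_(n * d) | (x *m u) ord0 ord0 = c].
  rewrite (_ : [set v | _] = (fun v : 'rV[R]_(n * d) => (v *m u) ord0 ord0) @^-1` [set c]).
    by rewrite -[X in measurable X]setTI; apply: measurable_mul_col.
  by [].
rewrite -[RHS](gint_null mS (hyperplane_null c u0)).
by apply: eq_gint => x; rewrite !indicE -uE.
Qed.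

Lemma measurable_row_dsubmx b m k : measurable_fun setT (fun x : 'rV[R]_((b.+1 + m) * b.+1) =>
  (row k (dsubmx (vec_mx x : 'M[R]_(b.+1 + m, b.+1))) *m
   facet_normal (usubmx (vec_mx x : 'M[R]_(b.+1 + m, b.+1)))) ord0 ord0).
Proof.
apply: measurable_mulmx => [i j|i j].
  by under eq_fun do rewrite !mxE; exact: measurable_coord.
apply: measurable_facet_normal => i' j'.
by under eq_fun do rewrite mxE; exact: measurable_vec_mx.
Qed.

Lemma measurable_det_usubmx b m : measurable_fun setT (fun x : 'rV[R]_((b.+1 + m) * b.+1) =>
  \det (usubmx (vec_mx x : 'M[R]_(b.+1 + m, b.+1)))).
Proof.
apply: measurable_det => i j.
by under eq_fun do rewrite mxE; exact: measurable_vec_mx.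
Qed.

Variables (b m : nat).
Local Notation d := b.+1.
Local Notation n := (b.+1 + m)%N.
Variables (disp : measure_display) (Omega : measurableType disp)
  (P : probability Omega R) (X : 'I_n -> {RV P >-> 'rV[R]_d}).
Hypotheses (X_indep : mutually_independent X)
  (X_normal : forall i : 'I_n, std_normal_vector (X i)).

Definition sample (w : Omega) : 'M[R]_(n, d) := \matrix_(i, j) X i w ord0 j.

Definition resample (I : {set 'I_n}) (w : Omega) : 'M[R]_(n, d) :=
  rowsub (@enum_first (b + m) I) (sample w).

(** Relabelling an independent, identically distributed sample preserves its law, so every [I] can
    be treated as the set of the first rows. *)
Lemma integral_resample (I : {set 'I_n}) (F : 'M[R]_(n, d) -> \bar R) :
  mx_measurable F -> (forall A, 0 <= F A)%E ->
  (\int[P]_w F (resample I w) = gmx F)%E.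
Proof.
move=> mF F0.
have indY := mutually_independent_comp (@enum_first_inj (b + m) I) X_indep.
rewrite -(gmx_joint indY (fun i => X_normal _) mF F0).
apply: eq_integral => w _; congr F; apply/matrixP => i j; by rewrite !mxE.
Qed.

Lemma usubmx_resample I w : usubmx (resample I w) = vertices (sample w) I.
Proof. by apply/matrixP => i j; rewrite !mxE. Qed.

Lemma row_dsubmx_resample I w k :
  row k (dsubmx (resample I w)) = row (@enum_first (b + m) I (rshift d k)) (sample w).
Proof. by apply/rowP => j; rewrite !mxE. Qed.

Lemma measurable_sample i j : measurable_fun setT (fun w => sample w i j).
Proof.
under eq_fun do rewrite mxE.
by move: j; apply/measurable_fun_rVP.
Qed.

Lemma measurable_resample I i j : measurable_fun setT (fun w => resample I w i j).
Proof. by under eq_fun do rewrite mxE; exact: measurable_sample. Qed.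

Lemma ae_resample (I : {set 'I_n}) (h : 'M[R]_(n, d) -> R) (c : R) :
  measurable_fun setT (fun x : 'rV[R]_(n * d) => h (vec_mx x)) ->
  gmx (fun C => (\1_[set c] (h C))%:E) = 0%E ->
  {ae P, forall w, h (resample I w) != c}.
Proof.
move=> mh h0.
have mr : measurable_fun setT (fun w => mxvec (resample I w)).
  apply/measurable_fun_rVP => l; case/mxvec_indexP: l => i j.
  by under eq_fun do rewrite mxvecE; exact: measurable_resample.
have mhr : measurable_fun setT (fun w => h (resample I w)).
  rewrite (_ : (fun w => _) = (fun x => h (vec_mx x)) \o (fun w => mxvec (resample I w))).
    exact: measurableT_comp.
  by apply/funext => w /=; rewrite mxvecK.
have mS : measurable ((fun w => h (resample I w)) @^-1` [set c]).
  by rewrite -[X in measurable X]setTI; apply: mhr.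
exists ((fun w => h (resample I w)) @^-1` [set c]); split=> //.
- rewrite -[X in P X]setIT -integral_indic//.
  transitivity (\int[P]_w (\1_[set c] (h (resample I w)))%:E)%E => //.
  rewrite -[RHS]h0.
  apply: (@integral_resample I (fun C => (\1_[set c] (h C))%:E)).
    by apply/measurable_EFinP; apply: (measurableT_comp _ mh).
  by move=> A; rewrite lee_fin.
- by move=> w /= /negP; rewrite negbK => /eqP.
Qed.

Lemma ae_generic : {ae P, forall w, forall I : {set 'I_n}, #|I| = d ->
  \det (vertices (sample w) I) != 0 /\
  forall j, j \notin I -> (sample w *m normal (sample w) I) j ord0 != 1}.
Proof.
apply: filter_forall => I.
have [cI|cI] := eqVneq #|I| d; last by apply: aeW => w /eqP; rewrite (negbTE cI).
have H1 : {ae P, forall w, \det (usubmx (resample I w)) != 0}.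
  apply: (@ae_resample I (fun C : 'M[R]_(n, d) => \det (usubmx C))).
    exact: measurable_det_usubmx.
  rewrite gmx_col_mx.
  - rewrite -[RHS](gmx_det_eq0 b); apply: eq_gmx => A.
    under eq_gmx do rewrite col_mxKu.
    by rewrite /gmx gint_cst.
  - by apply/measurable_EFinP; apply: (measurableT_comp _ (@measurable_det_usubmx b m)).
  - by move=> A; rewrite lee_fin.
have H2 : {ae P, forall w, forall k, (row k (dsubmx (resample I w)) *m
    facet_normal (usubmx (resample I w))) ord0 ord0 != 1}.
  apply: filter_forall => k.
  apply: (@ae_resample I (fun C : 'M[R]_(n, d) =>
    (row k (dsubmx C) *m facet_normal (usubmx C)) ord0 ord0)).
    exact: measurable_row_dsubmx.
  rewrite gmx_col_mx.
  - apply: gmx_eq0 => A; rewrite -[RHS](@gmx_row_mul_eq m d k (facet_normal A) 1 (oner_neq0 _)).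
    by apply: eq_gmx => B; rewrite col_mxKu col_mxKd.
  - by apply/measurable_EFinP; apply: (measurableT_comp _ (measurable_row_dsubmx _)).
  - by move=> A; rewrite lee_fin.
apply: filterS2 H1 H2 => w w1 w2 _; rewrite usubmx_resample in w1 w2; split=> // j jI.
have [k jk] := @enum_first_surj (b + m) I j.
move: jI; rewrite jk (@enum_first_in (b + m)) cI -leqNgt => dk.
have km : (k - d < m)%N by rewrite ltn_subLR.
have kE : k = rshift d (Ordinal km) by apply: val_inj; rewrite /= subnKC.
have := w2 (Ordinal km); rewrite row_dsubmx_resample -kE.
by rewrite -row_mul mxE.
Qed.

Lemma facet_resample (I : {set 'I_n}) w : #|I| = d ->
  facet (sample w) I = \prod_(k < m) \1_[set t : R | t < 1]
    ((row k (dsubmx (resample I w)) *m facet_normal (usubmx (resample I w))) ord0 ord0).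
Proof.
move=> cI; have ei : @injective 'I_n 'I_n (@enum_first (b + m) I) by exact: enum_first_inj.
rewrite /facet (reindex_inj ei) (@big_split_ord _ _ _ d m) /=.
rewrite big1 ?mul1r => [|i]; last first.
  by rewrite inE (@enum_first_in (b + m)) cI /= ltn_ord.
apply: eq_big => [k|k _].
  by rewrite inE (@enum_first_in (b + m)) cI /= -leqNgt leq_addr.
rewrite row_dsubmx_resample usubmx_resample; congr (\1_ _ _).
by rewrite -row_mul [RHS]mxE.
Qed.

Lemma expected_hull :
  (\int[P]_w lebesgue_rV d (convex_hull ([set 0%R] `|` range (fun i => X i w))) =
   ('C(n, d)%:R / d`!%:R * mom d)%:E *
   profile (fun s : R => Phi (s / Num.sqrt d%:R) ^+ m)%R)%E.
Proof.
pose g I (w : Omega) := (`|\det (vertices (sample w) I)| * facet (sample w) I)%:E.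
have mV I i j : measurable_fun setT (fun w => vertices (sample w) I i j).
  by under eq_fun do rewrite mxE; exact: measurable_sample.
have f0 I w : 0 <= facet (sample w) I by apply: prodr_ge0 => j _.
have g0 I w : (0 <= g I w)%E by rewrite lee_fin mulr_ge0.
have mg I : measurable_fun setT (g I).
  apply/measurable_EFinP; apply: measurable_funM.
    by apply: measurableT_comp => //; exact: measurable_det.
  under eq_fun do rewrite /facet -big_filter.
  apply: measurable_prod => j _; apply: measurableT_comp.
    by apply: measurable_indic; exact: measurable_halfline.
  apply: measurable_mulmx => [k l|k l]; first exact: measurable_sample.
  exact: measurable_facet_normal.
transitivity (\int[P]_w (d`!%:R^-1%:E *
    \sum_(I <- [seq I : {set 'I_n} <- index_enum _ | #|I| == d]) g I w))%E.
  apply: ge0_integral_ae => //.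
  - by move=> w; apply: mule_ge0; [rewrite lee_fin invr_ge0|exact: sume_ge0].
  - by apply: emeasurable_funM => //; apply: emeasurable_sum.
  apply: filterS ae_generic => w gw.
  have -> : (fun i => X i w) = (fun i => row i (sample w)).
    by apply/funext => i; apply/rowP => j; rewrite !mxE.
  rewrite (lebesgue_hull (fun I cI => (gw I cI).1) (fun I cI => (gw I cI).2)).
  rewrite big_filter sumEFin -EFinM mulr_sumr; congr (_%:E).
  by apply: eq_bigr => I _; rewrite mulrAC mulrC.
rewrite ge0_integralZl_EFin//; last 2 first.
- by move=> w _; exact: sume_ge0.
- exact: emeasurable_sum.
rewrite ge0_integral_sum// big_filter.
pose c := ((mom d)%:E * profile (fun s : R => Phi (s / Num.sqrt d%:R) ^+ m)%R)%E.
(* Every subset contributes the same [c]; the factor 1 lets [c] be pulled out, leaving the number of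
   subsets. *)
rewrite (eq_bigr (fun=> 1%:E * c)%E); last first.
  move=> I /eqP cI; rewrite mul1e /c -gmx_facet.
  pose F (C : 'M[R]_(n, d)) : \bar R := (`|\det (usubmx C)| * \prod_(j < m)
      \1_[set t : R | t < 1] ((row j (dsubmx C) *m facet_normal (usubmx C)) ord0 ord0))%:E.
  apply: (eq_trans _ (@integral_resample I F _ _)).
  - by apply: eq_integral => w _; rewrite /g /F facet_resample// usubmx_resample.
  - apply/measurable_EFinP; apply: measurable_funM.
      by apply: measurableT_comp => //; exact: measurable_det_usubmx.
    apply: measurable_prod => j _; apply: measurableT_comp (measurable_row_dsubmx _).
    by apply: measurable_indic; exact: measurable_halfline.
  - by move=> A; rewrite lee_fin mulr_ge0// prodr_ge0.
rewrite -ge0_sume_distrl// sumEFin.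
rewrite (eq_bigl (fun I => I \in [set I : {set 'I_n} | #|I| == d]%SET)); last first.
  by move=> I; rewrite inE.
rewrite sumr_const card_draws card_ord /c !muleA -!EFinM.
by congr (_%:E * _)%E; congr (_ * _); rewrite mulrC.
Qed.

End expected_volume.

(** * Matching the constants *)

Section constants.
Context {R : realType}.
Local Notation mu := (@lebesgue_measure R).

Lemma powR_half (a : R) k : 0 <= a -> a `^ (k%:R / 2) = Num.sqrt a ^+ k.
Proof.
by move=> a0; rewrite mulrC powRrM powR12_sqrt// powR_mulrn// sqrtr_ge0.
Qed.

Lemma phi0E : phi0 = (Num.sqrt 2 * Num.sqrt pi)^-1 :> R.
Proof. by rewrite /phi0 powRN div1r powR12_sqrt ?sqrtrM// mulr_ge0// pi_ge0. Qed.

(** The powers of sqrt 2 in [Gamma_half] and in [phi0] cancel. *)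
Lemma unit_ball_volE b : unit_ball_vol b.+1 = (phi0 ^+ b.+1 * mom b.+2)^-1 :> R.
Proof.
rewrite /unit_ball_vol Gamma_half powR_half ?pi_ge0// phi0E.
have s2 : Num.sqrt 2 != 0 :> R by rewrite gt_eqF// sqrtr_gt0.
have sp : Num.sqrt pi != 0 :> R by rewrite gt_eqF// sqrtr_gt0 pi_gt0.
have B0 : mom b.+2 != 0 :> R by rewrite gt_eqF// mom_gt0.
rewrite exprVn exprMn; field.
by rewrite B0 !expf_neq0.
Qed.

Lemma powR_two_half b m :
  2 `^ ((b.+1 + m)%:R - b.+1%:R / 2) = 2 ^+ m * Num.sqrt 2 ^+ b.+1 :> R.
Proof.
rewrite -powR_half// -powR_mulrn// -powRD; last by apply/implyP => _.
by congr (_ `^ _); rewrite natrD; field.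
Qed.

Lemma profile_int b m :
  (profile (fun s : R => Phi (s / Num.sqrt b.+1%:R) ^+ m)%R =
   (2 * phi0 / phi0 ^+ b.+1 * (2^-1 ^+ m * phi0 ^+ b.+1 +
     m%:R * \int[mu]_(t in `[0%R, +oo[) (Phi t ^+ m.-1 * phi t ^+ b.+2)))%:E)%E.
Proof.
rewrite profile_Phi Phi_integral_by_parts [RHS]EFinM; congr (_ * _)%E.
rewrite [RHS]EFinD; congr (_ + _)%E; rewrite [RHS]EFinM -integral_Phi_phi_fin.
under eq_integral do rewrite EFinM.
rewrite ge0_integralZl_EFin//.
- by move=> t _; rewrite lee_fin mulr_ge0// exprn_ge0 ?Phi_ge0 ?phi_ge0.
- apply: measurable_funTS; apply/measurable_EFinP; apply: measurable_funM.
    by apply: measurable_funX; exact: measurable_Phi.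
  by apply: measurable_funX; exact: measurable_phi.
Qed.

Lemma volume_constants b m (J : R) :
  'C(b.+1 + m, b.+1)%:R / b.+1`!%:R * mom b.+1 *
    (2 * phi0 / phi0 ^+ b.+1 * (2^-1 ^+ m * phi0 ^+ b.+1 + m%:R * J)) =
  'C(b.+1 + m, b.+1)%:R / (2 `^ ((b.+1 + m)%:R - b.+1%:R / 2) * Gamma (b.+1%:R / 2 + 1)) +
  (if (0 < m)%N then
     unit_ball_vol b.+1 * (b.+1 + m)`!%:R / (b.+1`!%:R * m.-1`!%:R) * J else 0).
Proof.
have B0 : mom b.+2 != 0 :> R by rewrite gt_eqF// mom_gt0.
have p0 : phi0 != 0 :> R by rewrite gt_eqF// phi0_gt0.
have d0 : b.+1`!%:R != 0 :> R by rewrite pnatr_eq0 -lt0n fact_gt0.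
have s2 : Num.sqrt 2 != 0 :> R by rewrite gt_eqF// sqrtr_gt0.
(* By [mom_mulS], with mom 0 = 1 / (2 phi0); it trades mom d for mom (d + 1), the moment in Gamma (d
   / 2 + 1). *)
have AE : mom b.+1 = b.+1`!%:R / (2 * phi0 * mom b.+2) :> R.
  have := @mom_mulS R b.+1; rewrite [mom 0]/= => E.
  rewrite -[LHS](mulfK B0) E; field.
  by rewrite B0 p0.
rewrite AE powR_two_half Gamma_half unit_ball_volE.
have t1 : 'C(b.+1 + m, b.+1)%:R / b.+1`!%:R * (b.+1`!%:R / (2 * phi0 * mom b.+2)) *
    (2 * phi0 / phi0 ^+ b.+1 * (2^-1 ^+ m * phi0 ^+ b.+1 + m%:R * J)) =
    'C(b.+1 + m, b.+1)%:R / (2 ^+ m * mom b.+2) +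
    'C(b.+1 + m, b.+1)%:R * m%:R / (phi0 ^+ b.+1 * mom b.+2) * J :> R.
  rewrite exprVn; field.
  by rewrite !expf_neq0 ?B0 ?p0 ?d0.
rewrite t1; congr (_ + _).
  congr (_ / _); rewrite -mulrA; congr (_ * _).
  by rewrite mulrA divff ?mul1r// expf_neq0.
move: {AE t1} (mom b.+2) B0 => B B0.
(* For m = 0, that is n = d, the factor [m%:R] removes the second term, in accordance with the
   convention of the statement. *)
case: m => [|m] /=; first by rewrite mulr0 !mul0r.
have m0 : m`!%:R != 0 :> R by rewrite pnatr_eq0 -lt0n fact_gt0.
have -> : (b.+1 + m.+1)`!%:R = 'C(b.+1 + m.+1, b.+1)%:R * (b.+1`!%:R * (m.+1%:R * m`!%:R)) :> R.
  by rewrite -!natrM -factS -[in LHS](bin_fact (leq_addr m.+1 b.+1)) addKn.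
congr (_ * _); field.
by rewrite B0 m0 d0 expf_neq0.
Qed.

End constants.

Theorem mainTheorem4 (R : realType) (d n : nat)
    (d_gt0 : (1 <= d)%N) (le_dn : (d <= n)%N)
    (disp : measure_display) (Omega : measurableType disp)
    (P : probability Omega R) (X : 'I_n -> {RV P >-> 'rV[R]_d})
    (X_indep : mutually_independent X)
    (X_normal : forall i : 'I_n, std_normal_vector (X i)) :
  (\int[P]_w
     lebesgue_rV d (convex_hull ([set 0%R] `|` range (fun i => X i w))) =
   ('C(n, d)%:R / (2 `^ (n%:R - d%:R / 2) * Gamma (d%:R / 2 + 1))
    + (if (d < n)%N then
         unit_ball_vol d * n`!%:R / (d`!%:R * (n - d - 1)`!%:R)
         * \int[lebesgue_measure]_(t in `[0%R, +oo[)
             (Phi t ^+ (n - d - 1) * phi t ^+ d.+1)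
       else 0))%R%:E)%E.
Proof.
case: d d_gt0 le_dn X X_indep X_normal => // b _ le_dn X X_indep X_normal.
have [m nE] : exists m, n = (b.+1 + m)%N by exists (n - b.+1)%N; rewrite subnKC.
subst n; rewrite (expected_hull X_indep X_normal) profile_int -EFinM volume_constants.
have -> : (b.+1 < b.+1 + m)%N = (0 < m)%N by rewrite -[ltnLHS]addn0 ltn_add2l.
by rewrite addKn subn1.
Qed.
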